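(* Let $r\ge2$, and let $\boldsymbol h_{2r-2}(\tau)=(h_1(\tau),\ldots,h_{2r-2}(\tau))^T$ and $\boldsymbol h_{2r-2}^\vee(\tau)=(h_1^\vee(\tau),\ldots,h_{2r-2}^\vee(\tau))^T$, with $h_j,h_j^\vee$ as defined in the context. Then $$\boldsymbol h_{2r-2}\Big(-\frac1{2\tau}\Big)=2\widetilde S\,\boldsymbol h_{2r-2}^\vee(\tau),\qquad \boldsymbol h_{2r-2}^\vee\Big(-\frac1{2\tau}\Big)=\widetilde S\,\boldsymbol h_{2r-2}(\tau),$$ where $\widetilde S=(\widetilde s_{j,k})_{(2r-2)\times(2r-2)}$ with $\widetilde s_{j,k}=\sqrt{\frac2{4r-3}}\cos\frac{(2j-1)(2k-1)\pi}{8r-6}$.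
   Context: Notation: $\tau\in\mathbb{H}$ (upper half-plane), $q=e^{2\pi i\tau}$, $q^x=e^{2\pi ix\tau}$ for rational $x$; $(a;p)_\infty=\prod_{n\ge0}(1-ap^n)$, $(a_1,\ldots,a_k;p)_\infty=\prod_i(a_i;p)_\infty$ for $|p|<1$. For $1\le j\le 2r-2$, the functions $h_j,h_j^\vee$ on $\mathbb{H}$ are defined by $$h_j(\tau)=q^{\frac{(4j-4r+1)^2}{32r-24}}\left(q^{\frac{4j-2r-1}4}\frac{(q^{4(2r-1-j)},q^{8r+4j-8},q^{16r-12};q^{16r-12})_\infty}{(q,q^3,q^4;q^4)_\infty}+\frac{(q^{2(2r-j-1)},-q^{2j-1},-q^{4r-3};-q^{4r-3})_\infty}{(q^2,q^2,q^4;q^4)_\infty}\right),$$ $$h_j^\vee(2\tau)=\frac12q^{\frac{j^2-j-r+1}{8r-6}}\left(\frac{(q^{2r-j-1},q^{2r+j-2},q^{4r-3};q^{4r-3})_\infty}{(q,q^3,q^4;q^4)_\infty}+\frac{((-q)^{2r-j-1},(-q)^{2r+j-2},-q^{4r-3};-q^{4r-3})_\infty}{(-q,-q^3,q^4;q^4)_\infty}\right).$$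
   Formalization: In the definition of h_j^∨(2τ), the second summand (the one with −q) is multiplied by (−1)^{j(j−1)/2}; without this sign both formulas are false, e.g. r=2, j=2, τ=i/√2, where the second would read 0.8008=0.0010. *)

(* Defs.v *)
From Stdlib Require Export Reals List.
From Coquelicot Require Export Coquelicot.

Open Scope R_scope.

(** Complex exponential: e^(x + i y) = e^x (cos y + i sin y). *)
Definition Cexp (z : C) : C :=
  (exp (Re z) * cos (Im z), exp (Re z) * sin (Im z)).

(** q^x = e^(2 pi i x tau). For non-integral [x] this depends on [tau], not
    only on q, hence the argument [tau]. *)
Definition qpow (tau : C) (x : R) : C := Cexp (2 * PI * x * Ci * tau)%C.

Fixpoint qpoch_partial (a p : C) (n : nat) : C :=
  match n with
  | O => 1
  | S m => qpoch_partial a p m * (1 - a * p ^ m)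
  end%C.

(** (a; p)_oo, meaningful for |p| < 1. [lim] is a total operator: it returns
    an unspecified value when the partial products diverge. *)
Definition qpoch (a p : C) : C :=
  lim (T := C_CompleteNormedModule)
    (filtermap (fun n => qpoch_partial a p n : C_CompleteNormedModule)
       eventually).

(** (a_1, ..., a_k; p)_oo *)
Definition qpochs (l : list C) (p : C) : C :=
  fold_right (fun a acc => qpoch a p * acc)%C (RtoC 1) l.

(** In [h], [hvee_double], [hvee] and [smx] the index [j] (and [k]) is the
    1-based index of the mathematical text, 1 <= j <= 2r-2. *)
Definition h (r j : nat) (tau : C) : C :=
  let q := qpow tau in
  let r' := INR r in
  let j' := INR j in
  (q ((4 * j' - 4 * r' + 1) ^ 2 / (32 * r' - 24))%R *
   (q ((4 * j' - 2 * r' - 1) / 4)%R *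
      (qpochs (q (4 * (2 * r' - 1 - j'))%R :: q (8 * r' + 4 * j' - 8)%R
                 :: q (16 * r' - 12)%R :: nil) (q (16 * r' - 12)%R)
       / qpochs (q 1%R :: q 3%R :: q 4%R :: nil) (q 4%R))
    + qpochs (q (2 * (2 * r' - j' - 1))%R :: - q (2 * j' - 1)%R
                :: - q (4 * r' - 3)%R :: nil) (- q (4 * r' - 3)%R)
      / qpochs (q 2%R :: q 2%R :: q 4%R :: nil) (q 4%R)))%C.

(** CORRECTION: the source prints [hvee_double] without this sign, i.e. with
    1 in place of (-1)^(j(j-1)/2), and then both transformation formulas are
    false: e.g. for r = 2, j = 2 at tau = i/sqrt 2, which is fixed
    by tau |-> -1/(2 tau), the second formula would read 0.8008 = 0.0010.
    The sign comes from the shift tau |-> tau + (4r-3)/2, which sends q to -q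
    and multiplies q^((j^2-j-r+1)/(8r-6)) by (-1)^(j(j-1)/2), up to a factor
    independent of j. *)
Definition hvee_sign (j : nat) : C := (RtoC (-1) ^ (j * (j - 1) / 2))%C.

(** The value of h_j^vee at 2 tau. The powers of -q are natural-number
    powers; the truncated subtractions are exact for 1 <= j <= 2r-2. *)
Definition hvee_double (r j : nat) (tau : C) : C :=
  let q := qpow tau in
  let mq := (- qpow tau 1)%C in
  let r' := INR r in
  let j' := INR j in
  (RtoC (1 / 2)%R * q ((j' ^ 2 - j' - r' + 1) / (8 * r' - 6))%R *
   (qpochs (q (2 * r' - j' - 1)%R :: q (2 * r' + j' - 2)%R
              :: q (4 * r' - 3)%R :: nil) (q (4 * r' - 3)%R)
      / qpochs (q 1%R :: q 3%R :: q 4%R :: nil) (q 4%R)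
    + hvee_sign j *
      (qpochs (mq ^ (2 * r - j - 1)%nat :: mq ^ (2 * r + j - 2)%nat
                 :: - q (4 * r' - 3)%R :: nil) (- q (4 * r' - 3)%R)
       / qpochs (- q 1%R :: - q 3%R :: q 4%R :: nil) (q 4%R))))%C.

Definition hvee (r j : nat) (tau : C) : C := hvee_double r j (tau / 2)%C.

(** Column vector (f 1, ..., f n)^T; matrix rows and columns are numbered
    from 0 in Coquelicot. *)
Definition colvec (n : nat) (f : nat -> C) : @matrix C_Ring n 1 :=
  mk_matrix n 1 (fun i _ => f (S i)).

Definition Mscale {n m : nat} (c : C) (A : @matrix C_Ring n m) :
  @matrix C_Ring n m :=
  mk_matrix n m (fun i j => (c * coeff_mat (RtoC 0) A i j)%C).

Definition smx (r j k : nat) : R :=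
  sqrt (2 / (4 * INR r - 3)) *
  cos ((2 * INR j - 1) * (2 * INR k - 1) * PI / (8 * INR r - 6)).

Definition Stilde (r : nat) : @matrix C_Ring (2 * r - 2) (2 * r - 2) :=
  mk_matrix (2 * r - 2) (2 * r - 2) (fun i j => RtoC (smx r (S i) (S j))).

Definition hvec (r : nat) (tau : C) : @matrix C_Ring (2 * r - 2) 1 :=
  colvec (2 * r - 2) (fun j => h r j tau).

Definition hveevec (r : nat) (tau : C) : @matrix C_Ring (2 * r - 2) 1 :=
  colvec (2 * r - 2) (fun j => hvee r j tau).

(* Main.v *)
Require Import Defs.
From Stdlib Require Import Lra Lia.
Open Scope R_scope.

(** By the Jacobi triple product, all numerators and denominators of [h] and
    [hvee] are theta series. Poisson summation, at the half-integers, of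
    [exp (- a t^2) cos (2 pi y t)] expresses
    [sum_(m >= 0) cos (pi y (2 m + 1)) q^((2 m + 1)^2 / (16 P))] as
    [sqrt P * c] times [sum_k (-1)^k q'^(2 P (k + y)^2)], where
    [q' = e^(2 pi i tau')], [tau' = -1/(2 tau)], and [c] depends neither on [y]
    nor on the scale [P > 0]. So every theta series occurring in [h] at [tau']
    becomes a sum over the positive odd integers, and [c] cancels in the quotients:
    it is enough to know that [c <> 0], and [P = 4 r - 3] in the numerators
    against [P = 1] in the denominators leaves the factor [sqrt (2 / (4 r - 3))].
    Sorting the odd integers by their residue modulo [2 (4 r - 3)], up to sign,
    yields the cosine matrix applied to the theta series of [hvee]; the residue
    [4 r - 3] contributes [0]. The second formula follows from the first one at
    [tau'], because the square of the cosine matrix is [1/2]. *)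

(** * Complex sequences and series *)

(** The obstacle is the second quotient of [h]: its base [- q^(4r-3)] gives the theta series signs
    to which the Poisson formula does not apply directly. Splitting that series by the parity of its
    index yields two ordinary theta series, with [y] shifted by [1/4] and by [- 1/4]. After
    transformation their cosines add up to [2 cos(pi y (2m+1)) cos(pi (2m+1)/4)], whose last factor
    is [(-1)^tri m / sqrt 2]. This sign pattern is the origin of the base [- q] in [hvee], and its
    value at the residue [k] is [hvee_sign (k+1)]. The [sqrt 2] of the matrix thus has two sources:
    this factor in the second quotient, and in the first one the denominator, where [y = - 1/4]
    produces the same cosine. The constant [c] hides a complex square root. Its branch is never
    chosen, because a differential equation in the frequency gives the Gaussian transform up to its
    value at frequency 0. Convergence of the dual series comes from the triple product, which also
    sums it, so Poisson summation only has to compare Cesàro means. *)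

Definition clim (u : nat -> C) (l : C) : Prop :=
  is_lim_seq (fun n => Cmod (u n - l)) 0.

Fixpoint csum (f : nat -> C) (n : nat) : C :=
  match n with O => 0%C | S m => (csum f m + f m)%C end.

Definition cser (f : nat -> C) (s : C) : Prop := clim (csum f) s.

Lemma is_lim_seq_squeeze0 (u v : nat -> R) :
  (forall n, 0 <= u n <= v n) -> is_lim_seq v 0 -> is_lim_seq u 0.
Proof.
  intros H Hv. apply is_lim_seq_le_le with (fun _ => 0) v; auto.
  apply is_lim_seq_const.
Qed.

Lemma clim_eps (u : nat -> C) (l : C) :
  clim u l <-> (forall eps : R, 0 < eps ->
    exists N, forall n, (N <= n)%nat -> Cmod (u n - l) < eps).
Proof.
  unfold clim. split.
  - intros H eps He. apply is_lim_seq_spec in H.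
    destruct (H (mkposreal eps He)) as [N HN]. exists N. intros n Hn.
    specialize (HN n Hn). simpl in HN. rewrite Rminus_0_r in HN.
    rewrite Rabs_pos_eq in HN; auto. apply Cmod_ge_0.
  - intros H. apply is_lim_seq_spec. intros [eps He]. destruct (H eps He) as [N HN].
    exists N. intros n Hn. simpl. rewrite Rminus_0_r, Rabs_pos_eq; auto.
    apply Cmod_ge_0.
Qed.

Lemma clim_ext (u v : nat -> C) (l : C) :
  (forall n, u n = v n) -> clim u l -> clim v l.
Proof. intros E. apply is_lim_seq_ext. intros n. now rewrite E. Qed.

Lemma clim_const (c : C) : clim (fun _ => c) c.
Proof.
  apply is_lim_seq_ext with (fun _ => 0).
  - intros n. replace (c - c)%C with (0 : C) by ring. now rewrite Cmod_0.
  - apply is_lim_seq_const.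
Qed.

Lemma clim_unique (u : nat -> C) (l m : C) : clim u l -> clim u m -> l = m.
Proof.
  intros Hl Hm.
  assert (H : is_lim_seq (fun _ : nat => Cmod (l - m)) 0).
  { apply is_lim_seq_squeeze0 with (fun n => Cmod (u n - l) + Cmod (u n - m)).
    - intros n. split; [apply Cmod_ge_0|].
      replace (l - m)%C with (- (u n - l) + (u n - m))%C by ring.
      eapply Rle_trans; [apply Cmod_triangle|]. rewrite Cmod_opp. lra.
    - replace 0 with (0 + 0) by ring. now apply is_lim_seq_plus'. }
  assert (E : Cmod (l - m) = 0).
  { apply is_lim_seq_unique in H. rewrite Lim_seq_const in H. now injection H. }
  apply Cmod_eq_0 in E. replace l with ((l - m) + m)%C by ring. rewrite E. ring.
Qed.

Lemma clim_plus (u v : nat -> C) (l m : C) :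
  clim u l -> clim v m -> clim (fun n => u n + v n)%C (l + m)%C.
Proof.
  intros Hl Hm.
  apply is_lim_seq_squeeze0 with (fun n => Cmod (u n - l) + Cmod (v n - m)).
  - intros n. split; [apply Cmod_ge_0|].
    replace (u n + v n - (l + m))%C with ((u n - l) + (v n - m))%C by ring.
    apply Cmod_triangle.
  - replace 0 with (0 + 0) by ring. now apply is_lim_seq_plus'.
Qed.

Lemma clim_mult (u v : nat -> C) (l m : C) :
  clim u l -> clim v m -> clim (fun n => u n * v n)%C (l * m)%C.
Proof.
  intros Hl Hm.
  apply is_lim_seq_squeeze0 with (fun n => Cmod (u n - l) * Cmod (v n - m)
    + (Cmod (u n - l) * Cmod m + Cmod l * Cmod (v n - m))).
  - intros n. split; [apply Cmod_ge_0|].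
    replace (u n * v n - l * m)%C with
      ((u n - l) * (v n - m) + ((u n - l) * m + l * (v n - m)))%C by ring.
    rewrite <- !Cmod_mult.
    eapply Rle_trans; [apply Cmod_triangle|]. apply Rplus_le_compat_l, Cmod_triangle.
  - replace 0 with (0 * 0 + (0 * Cmod m + Cmod l * 0)) by ring.
    apply is_lim_seq_plus'; [|apply is_lim_seq_plus'];
      apply is_lim_seq_mult'; auto; apply is_lim_seq_const.
Qed.

Lemma clim_subseq (u : nat -> C) (phi : nat -> nat) (l : C) :
  filterlim phi eventually eventually -> clim u l -> clim (fun n => u (phi n)) l.
Proof.
  intros Hphi Hu. now apply (is_lim_seq_subseq (fun n => Cmod (u n - l))).
Qed.

Lemma Cmod_le_Re_Im (z : C) : Cmod z <= Rabs (Re z) + Rabs (Im z).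
Proof.
  replace z with (RtoC (Re z) + RtoC (Im z) * Ci)%C at 1.
  - eapply Rle_trans; [apply Cmod_triangle|].
    rewrite Cmod_mult, Cmod_Ci, !Cmod_R. lra.
  - destruct z as [a b]. unfold Cplus, Cmult, RtoC, Ci; simpl. f_equal; ring.
Qed.

Lemma Rabs_Im_le_Cmod (z : C) : Rabs (Im z) <= Cmod z.
Proof.
  pose proof (re_le_Cmod (z * Ci)%C) as H.
  rewrite Cmod_mult, Cmod_Ci, Rmult_1_r in H.
  replace (Re (z * Ci)%C) with (- Im z) in H.
  - now rewrite Rabs_Ropp in H.
  - destruct z as [a b]; simpl; ring.
Qed.

Lemma clim_Re_Im (u : nat -> C) (l : C) :
  clim u l <-> is_lim_seq (fun n => Re (u n)) (Re l) /\
               is_lim_seq (fun n => Im (u n)) (Im l).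
Proof.
  split.
  - intros H. split; apply is_lim_seq_spec; intros [eps He];
      rewrite clim_eps in H; destruct (H eps He) as [N HN]; exists N; intros n Hn;
      simpl; eapply Rle_lt_trans; [|apply (HN n Hn)| |apply (HN n Hn)].
    + apply (re_le_Cmod (u n - l)%C).
    + apply (Rabs_Im_le_Cmod (u n - l)%C).
  - intros [H1 H2].
    apply is_lim_seq_squeeze0 with
      (fun n => Rabs (Re (u n) - Re l) + Rabs (Im (u n) - Im l)).
    + intros n. split; [apply Cmod_ge_0|]. apply (Cmod_le_Re_Im (u n - l)%C).
    + replace 0 with (0 + 0) by ring.
      assert (K : forall (w : nat -> R) (x : R), is_lim_seq w x ->
        is_lim_seq (fun n => Rabs (w n - x)) 0).
      { intros w x Hw. apply (is_lim_seq_abs_0 (fun n => w n - x)).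
        replace 0 with (x - x) by ring.
        apply is_lim_seq_minus'; [exact Hw|apply is_lim_seq_const]. }
      apply is_lim_seq_plus'; now apply K.
Qed.

Lemma clim_RtoC (u : nat -> R) (l : R) :
  clim (fun n => RtoC (u n)) (RtoC l) <-> is_lim_seq u l.
Proof.
  rewrite clim_Re_Im. simpl. split; [now intros [H _]|].
  intros H; split; [exact H|apply is_lim_seq_const].
Qed.

Lemma csum_ext (f g : nat -> C) (n : nat) :
  (forall i, (i < n)%nat -> f i = g i) -> csum f n = csum g n.
Proof.
  induction n as [|n IH]; intros H; simpl; [easy|].
  rewrite IH, H; auto.
Qed.

Lemma csum_plus (f g : nat -> C) (n : nat) :
  csum (fun i => f i + g i)%C n = (csum f n + csum g n)%C.
Proof. induction n as [|n IH]; simpl; [ring|rewrite IH; ring]. Qed.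

Lemma csum_scal (c : C) (f : nat -> C) (n : nat) :
  csum (fun i => c * f i)%C n = (c * csum f n)%C.
Proof. induction n as [|n IH]; simpl; [ring|rewrite IH; ring]. Qed.

Lemma csum_add (f : nat -> C) (n m : nat) :
  csum f (n + m) = (csum f n + csum (fun i => f (n + i)%nat) m)%C.
Proof.
  induction m as [|m IH]; simpl.
  - rewrite Nat.add_0_r. ring.
  - rewrite Nat.add_succ_r. simpl. rewrite IH. ring.
Qed.

Lemma csum_S_l (f : nat -> C) (n : nat) :
  csum f (S n) = (f O + csum (fun i => f (S i)) n)%C.
Proof. rewrite <- Nat.add_1_l, csum_add. simpl. ring. Qed.

Lemma csum_rev (f : nat -> C) (n : nat) :
  csum f n = csum (fun i => f (n - 1 - i)%nat) n.
Proof.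
  induction n as [|n IH]; [easy|].
  rewrite (csum_S_l (fun i => f (S n - 1 - i)%nat)).
  change (csum f (S n)) with (csum f n + f n)%C. rewrite IH.
  rewrite Cplus_comm. f_equal; [f_equal; lia|].
  apply csum_ext. intros i Hi. f_equal. lia.
Qed.

Lemma csum_block (f : nat -> C) (N n : nat) :
  csum f (N * n) = csum (fun k => csum (fun i => f (N * k + i)%nat) N) n.
Proof.
  induction n as [|n IH].
  - now rewrite Nat.mul_0_r.
  - simpl. rewrite <- IH. replace (N * S n)%nat with (N * n + N)%nat by lia.
    apply csum_add.
Qed.

Lemma csum_exchange (f : nat -> nat -> C) (n m : nat) :
  csum (fun i => csum (f i) m) n = csum (fun j => csum (fun i => f i j) n) m.
Proof.
  induction n as [|n IH]; simpl.
  - induction m as [|m IHm]; simpl; [easy|]. rewrite <- IHm. ring.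
  - rewrite IH, <- csum_plus. reflexivity.
Qed.

Lemma csum_Cmod_le (f : nat -> C) (b : nat -> R) (n : nat) :
  (forall i, Cmod (f i) <= b i) ->
  Cmod (csum f n) <= Re (csum (fun i => RtoC (b i)) n).
Proof.
  intros H. induction n as [|n IH]; simpl.
  - rewrite Cmod_0. lra.
  - eapply Rle_trans; [apply Cmod_triangle|]. specialize (H n).
    unfold Re in IH. lra.
Qed.

Lemma cser_ext (f g : nat -> C) (s : C) :
  (forall n, f n = g n) -> cser f s -> cser g s.
Proof. intros E. apply clim_ext. intros n. apply csum_ext. auto. Qed.

Lemma cser_unique (f : nat -> C) (s t : C) : cser f s -> cser f t -> s = t.
Proof. apply clim_unique. Qed.

Lemma cser_plus (f g : nat -> C) (s t : C) :
  cser f s -> cser g t -> cser (fun i => f i + g i)%C (s + t)%C.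
Proof.
  intros Hf Hg.
  apply clim_ext with (fun n => csum f n + csum g n)%C.
  - intros n. now rewrite csum_plus.
  - now apply clim_plus.
Qed.

Lemma cser_scal (c : C) (f : nat -> C) (s : C) :
  cser f s -> cser (fun i => c * f i)%C (c * s)%C.
Proof.
  intros Hf. apply clim_ext with (fun n => c * csum f n)%C.
  - intros n. now rewrite csum_scal.
  - apply clim_mult; [apply clim_const|exact Hf].
Qed.

Lemma cser_csum (f : nat -> nat -> C) (s : nat -> C) (n : nat) :
  (forall k, (k < n)%nat -> cser (f k) (s k)) ->
  cser (fun i => csum (fun k => f k i) n) (csum s n).
Proof.
  induction n as [|n IH]; intros H; simpl.
  - apply clim_ext with (fun _ => RtoC 0); [|apply clim_const].
    intros m. induction m as [|m IHm]; simpl; [easy|]. rewrite <- IHm. ring.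
  - apply cser_plus; auto.
Qed.

(** The partial sums of the blocked series are a subsequence of the original ones: consecutive terms
    are grouped, nothing is rearranged. *)
Lemma cser_block (f : nat -> C) (N : nat) (s : C) :
  (0 < N)%nat -> cser f s ->
  cser (fun k => csum (fun i => f (N * k + i)%nat) N) s.
Proof.
  intros HN H. apply clim_ext with (fun n => csum f (N * n)).
  - intros n. apply csum_block.
  - apply (clim_subseq (csum f)); [|exact H].
    intros P [M HM]. exists M. intros n Hn. apply HM. nia.
Qed.

Lemma csum_Re (f : nat -> C) (n : nat) :
  Re (csum f (S n)) = sum_n (fun i => Re (f i)) n.
Proof.
  induction n as [|n IH].
  - rewrite sum_O. apply Rplus_0_l.
  - rewrite sum_Sn, <- IH. reflexivity.
Qed.

Lemma csum_Im (f : nat -> C) (n : nat) :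
  Im (csum f (S n)) = sum_n (fun i => Im (f i)) n.
Proof.
  induction n as [|n IH].
  - rewrite sum_O. apply Rplus_0_l.
  - rewrite sum_Sn, <- IH. reflexivity.
Qed.

Lemma cser_Re_Im (f : nat -> C) (s : C) :
  cser f s <-> is_series (fun i => Re (f i)) (Re s) /\
               is_series (fun i => Im (f i)) (Im s).
Proof.
  unfold cser. rewrite clim_Re_Im.
  split; intros [H1 H2]; split.
  - apply is_lim_seq_incr_1 in H1. revert H1. apply is_lim_seq_ext. intros n. apply csum_Re.
  - apply is_lim_seq_incr_1 in H2. revert H2. apply is_lim_seq_ext. intros n. apply csum_Im.
  - apply is_lim_seq_incr_1.
    apply is_lim_seq_ext with (sum_n (fun i => Re (f i))); [|exact H1].
    intros n. symmetry. apply csum_Re.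
  - apply is_lim_seq_incr_1.
    apply is_lim_seq_ext with (sum_n (fun i => Im (f i))); [|exact H2].
    intros n. symmetry. apply csum_Im.
Qed.

Lemma cser_RtoC (f : nat -> R) (s : R) :
  cser (fun i => RtoC (f i)) (RtoC s) <-> is_series f s.
Proof.
  rewrite cser_Re_Im. simpl. split; [now intros [H _]|].
  intros H; split; [exact H|].
  apply (is_lim_seq_ext (fun _ => 0) _ 0); [|apply is_lim_seq_const].
  intros n. induction n as [|n IH]; [now rewrite sum_O|].
  rewrite sum_Sn, <- IH. symmetry. apply Rplus_0_l.
Qed.

Lemma cser_dominated (f : nat -> C) (b : nat -> R) :
  ex_series b -> (forall i, Cmod (f i) <= b i) -> exists s, cser f s.
Proof.
  intros Hb H.
  assert (E1 : ex_series (fun i => Re (f i))).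
  { apply (ex_series_le (V := R_CompleteNormedModule)) with b; [|exact Hb].
    intros n. eapply Rle_trans; [apply re_le_Cmod|apply H]. }
  assert (E2 : ex_series (fun i => Im (f i))).
  { apply (ex_series_le (V := R_CompleteNormedModule)) with b; [|exact Hb].
    intros n. eapply Rle_trans; [apply Rabs_Im_le_Cmod|apply H]. }
  destruct E1 as [x Hx], E2 as [y Hy]. exists (x, y).
  apply cser_Re_Im. now split.
Qed.

Lemma clim_Cmod_le (u : nat -> C) (l : C) (B : R) (K : nat) :
  clim u l -> (forall n, (K <= n)%nat -> Cmod (u n) <= B) -> Cmod l <= B.
Proof.
  intros H HB. apply le_epsilon. intros eps He.
  rewrite clim_eps in H. destruct (H eps He) as [N HN].
  set (n := Nat.max N K).
  specialize (HN n (Nat.le_max_l _ _)). specialize (HB n (Nat.le_max_r _ _)).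
  replace l with (- (u n - l) + u n)%C by ring.
  eapply Rle_trans; [apply Cmod_triangle|]. rewrite Cmod_opp. lra.
Qed.

Lemma cser_tail_le (f : nat -> C) (b : nat -> R) (s : C) (B : R) (M : nat) :
  is_series b B -> (forall i, Cmod (f i) <= b i) -> cser f s ->
  Cmod (s - csum f M) <= B - Re (csum (fun i => RtoC (b i)) M).
Proof.
  intros Hb H Hs.
  assert (Hb' := proj2 (cser_RtoC b B) Hb).
  apply clim_Cmod_le with (u := fun n => (csum f n - csum f M)%C) (K := M).
  - apply clim_plus; [exact Hs|apply clim_const].
  - intros n Hn. replace n with (M + (n - M))%nat by lia.
    rewrite csum_add.
    replace (csum f M + csum (fun i => f (M + i)%nat) (n - M) - csum f M)%C
      with (csum (fun i => f (M + i)%nat) (n - M)) by ring.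
    eapply Rle_trans; [apply (csum_Cmod_le _ (fun i => b (M + i)%nat)); auto|].
    assert (E : Re (csum (fun i => RtoC (b i)) (M + (n - M))) <= B).
    { unfold cser in Hb'. rewrite clim_Re_Im in Hb'. destruct Hb' as [Hb' _].
      apply (is_lim_seq_incr_compare _ _ Hb').
      intros k. simpl. pose proof (Rle_trans _ _ _ (Cmod_ge_0 _) (H k)).
      unfold Re in *. lra. }
    rewrite csum_add in E. rewrite re_plus in E. lra.
Qed.

(** Dominated convergence for series: past some [M] both tails are below [eps / 3] uniformly in [n],
    and only finitely many columns remain. It gives the limit of the finite triple product and that
    of the Fejér means in Poisson summation. *)
Lemma tannery (a : nat -> nat -> C) (l : nat -> C) (b : nat -> R)
    (s : nat -> C) (S : C) :
  ex_series b -> (forall n m, Cmod (a n m) <= b m) ->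
  (forall m, clim (fun n => a n m) (l m)) ->
  (forall n, cser (a n) (s n)) -> cser l S -> clim s S.
Proof.
  intros [B HB] Hab Hl Hs HS.
  assert (Hlb : forall m, Cmod (l m) <= b m).
  { intros m. apply clim_Cmod_le with (u := fun n => a n m) (K := O); auto. }
  apply clim_eps. intros eps He.
  assert (HB' := proj2 (cser_RtoC b B) HB). unfold cser in HB'.
  rewrite clim_eps in HB'. destruct (HB' (eps / 3) ltac:(lra)) as [M HM].
  specialize (HM M (le_n _)).
  assert (T : B - Re (csum (fun i => RtoC (b i)) M) < eps / 3).
  { eapply Rle_lt_trans; [|apply HM].
    eapply Rle_trans; [|apply re_le_Cmod].
    rewrite <- Rabs_Ropp. eapply Rle_trans; [|apply Rle_abs]. simpl. unfold Re. lra. }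
  assert (F : clim (fun n => csum (a n) M) (csum l M)).
  { clear - Hl. induction M as [|M IH]; simpl; [apply clim_const|].
    now apply clim_plus. }
  rewrite clim_eps in F. destruct (F (eps / 3) ltac:(lra)) as [N HN].
  exists N. intros n Hn. specialize (HN n Hn).
  pose proof (cser_tail_le _ _ _ _ M HB (Hab n) (Hs n)) as T1.
  pose proof (cser_tail_le _ _ _ _ M HB Hlb HS) as T2.
  replace (s n - S)%C with ((s n - csum (a n) M) + ((csum (a n) M - csum l M)
    + - (S - csum l M)))%C by ring.
  eapply Rle_lt_trans; [apply Cmod_triangle|].
  eapply Rle_lt_trans; [apply Rplus_le_compat_l, Cmod_triangle|].
  rewrite Cmod_opp. lra.
Qed.

(** * The Jacobi triple product *)

(** The operator [lim] is specified only on Cauchy filters; convergence provides the Cauchy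
    property, and uniqueness of limits then identifies the value. *)
Lemma qpoch_clim (a p l : C) : clim (qpoch_partial a p) l -> qpoch a p = l.
Proof.
  intros H. rewrite clim_eps in H.
  assert (Hl : filterlim (fun n => qpoch_partial a p n : C_CompleteNormedModule)
    eventually (locally (l : C_CompleteNormedModule))).
  { apply (filterlim_locally_ball_norm (K := C_AbsRing) (U := C_CompleteNormedModule)).
    intros [eps He]. destruct (H eps He) as [N HN]. exists N. exact HN. }
  apply (filterlim_locally_unique (K := C_AbsRing) (V := C_CompleteNormedModule)
    (F := eventually) (fun n => qpoch_partial a p n)); [|exact Hl].
  apply filterlim_locally. intros eps.
  apply (complete_cauchy (T := C_CompleteNormedModule)
    (filtermap (fun n => qpoch_partial a p n : C_CompleteNormedModule) eventually)).
  - apply filtermap_proper_filter, eventually_filter.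
  - intros e. exists l. apply (proj1 (filterlim_locally _ _) Hl e).
Qed.

(** The factors are written [1 + v k] so that [qpoch_partial], the reciprocals of q-factorials and
    the q-binomial theorem share one set of lemmas. *)
Fixpoint cprod (v : nat -> C) (n : nat) : C :=
  match n with O => 1%C | S m => (cprod v m * (1 + v m))%C end.

Lemma exp_le_compat (x y : R) : x <= y -> exp x <= exp y.
Proof.
  intros [H| ->]; [|lra]. now apply Rlt_le, exp_increasing.
Qed.

Lemma exp_sum_geom_le (M rho : R) (n : nat) :
  0 <= M -> 0 <= rho < 1 ->
  sum_f_R0 (fun k => M * rho ^ k) n <= M / (1 - rho).
Proof.
  intros HM Hr. rewrite (sum_eq _ (fun k => rho ^ k * M)) by (intros; ring).
  rewrite <- scal_sum, tech3 by lra.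
  pose proof (pow_le rho (S n) (proj1 Hr)).
  unfold Rdiv. apply Rmult_le_compat_l; [exact HM|].
  rewrite <- (Rmult_1_l (/ (1 - rho))) at 2.
  apply Rmult_le_compat_r; [apply Rlt_le, Rinv_0_lt_compat|]; lra.
Qed.

Lemma ex_series_geom_scal (M rho : R) :
  0 <= rho < 1 -> ex_series (fun k => M * rho ^ k).
Proof.
  intros Hr. apply (ex_series_scal (K := R_AbsRing) M (fun k => rho ^ k)).
  apply ex_series_geom. rewrite Rabs_pos_eq; lra.
Qed.

(** The inequality [1 + x <= exp x] turns the product into the exponential of a geometric sum. *)
Lemma cprod_bounded (v : nat -> C) (M rho : R) :
  0 <= rho < 1 -> (forall k, Cmod (v k) <= M * rho ^ k) ->
  forall n, Cmod (cprod v n) <= exp (M / (1 - rho)).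
Proof.
  intros Hr Hv.
  assert (HM : 0 <= M).
  { pose proof (Hv O) as H0. pose proof (Cmod_ge_0 (v O)). simpl in H0. lra. }
  assert (K : forall n, Cmod (cprod v (S n)) <= exp (sum_f_R0 (fun k => M * rho ^ k) n)).
  { assert (S1 : forall k, Cmod (1 + v k) <= exp (M * rho ^ k)).
    { intros k. eapply Rle_trans; [apply Cmod_triangle|]. rewrite Cmod_1.
      eapply Rle_trans; [|apply exp_ineq1_le]. specialize (Hv k). lra. }
    induction n as [|n IH].
    - simpl. rewrite Cmult_1_l. apply (S1 O).
    - change (cprod v (S (S n))) with (cprod v (S n) * (1 + v (S n)))%C.
      change (sum_f_R0 (fun k => M * rho ^ k) (S n)) with
        (sum_f_R0 (fun k => M * rho ^ k) n + M * rho ^ (S n)).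
      rewrite exp_plus, Cmod_mult. apply Rmult_le_compat; auto using Cmod_ge_0. }
  intros [|n].
  - simpl. rewrite Cmod_1.
    assert (0 <= M / (1 - rho)).
    { apply Rmult_le_pos; [lra|]. apply Rlt_le, Rinv_0_lt_compat. lra. }
    pose proof (exp_ineq1_le (M / (1 - rho))). lra.
  - eapply Rle_trans; [apply K|]. now apply exp_le_compat, exp_sum_geom_le.
Qed.

(** Successive products differ by [cprod v n * v n]; as the products are bounded, this telescoping
    series is dominated by a geometric one. *)
Lemma cprod_cv (v : nat -> C) (M rho : R) :
  0 <= rho < 1 -> (forall k, Cmod (v k) <= M * rho ^ k) ->
  exists l, clim (cprod v) l.
Proof.
  intros Hr Hv.
  destruct (cser_dominated (fun n => cprod v n * v n)%C
    (fun n => exp (M / (1 - rho)) * M * rho ^ n)) as [s Hs].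
  - now apply ex_series_geom_scal.
  - intros n. rewrite Cmod_mult, Rmult_assoc.
    apply Rmult_le_compat; auto using Cmod_ge_0.
    now apply cprod_bounded.
  - exists (1 + s)%C.
    apply clim_ext with (fun n => 1 + csum (fun n => cprod v n * v n)%C n)%C.
    + induction n as [|n IH]; simpl; [ring|].
      rewrite Cplus_assoc, IH. ring.
    + apply clim_plus; [apply clim_const|exact Hs].
Qed.

Lemma Cmod_mult_Cpow (a p : C) (k : nat) : Cmod (a * p ^ k)%C = Cmod a * Cmod p ^ k.
Proof. now rewrite Cmod_mult, Cmod_pow. Qed.

Lemma qpoch_partial_cprod (a p : C) (n : nat) :
  qpoch_partial a p n = cprod (fun k => - (a * p ^ k))%C n.
Proof. induction n as [|n IH]; simpl; [easy|]. now rewrite IH. Qed.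

Lemma qpoch_cv (a p : C) : Cmod p < 1 -> clim (qpoch_partial a p) (qpoch a p).
Proof.
  intros Hp.
  destruct (cprod_cv (fun k => - (a * p ^ k))%C (Cmod a) (Cmod p)) as [l Hl].
  - split; [apply Cmod_ge_0|exact Hp].
  - intros k. rewrite Cmod_opp, Cmod_mult_Cpow. lra.
  - assert (H : clim (qpoch_partial a p) l).
    { revert Hl. apply clim_ext. intros n. now rewrite qpoch_partial_cprod. }
    now rewrite (qpoch_clim _ _ _ H).
Qed.

Lemma qpoch_partial_bounded (a p : C) :
  Cmod p < 1 -> exists B, forall n, Cmod (qpoch_partial a p n) <= B.
Proof.
  intros Hp. eexists. intros n. rewrite qpoch_partial_cprod.
  apply (cprod_bounded _ (Cmod a) (Cmod p)).
  - split; [apply Cmod_ge_0|exact Hp].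
  - intros k. rewrite Cmod_opp, Cmod_mult_Cpow. lra.
Qed.

(** * Gaussian binomials, the finite triple product and its limit *)

Section JacobiTriple.
Variable p : C.
Hypothesis Hp : Cmod p < 1.

Let qfact : nat -> C := qpoch_partial p p.

Lemma one_minus_pow_neq_0 (k : nat) : (1 - p ^ S k)%C <> 0.
Proof.
  intros H. assert (E : (p ^ S k)%C = 1) by (rewrite <- (Cplus_0_r (p ^ S k)), <- H; ring).
  assert (F : Cmod (p ^ S k)%C = 1) by (rewrite E; apply Cmod_1).
  rewrite Cmod_pow in F.
  pose proof (pow_lt_1_compat (Cmod p) (S k)) as G.
  specialize (G (conj (Cmod_ge_0 p) Hp) ltac:(lia)). lra.
Qed.

Lemma qfact_S (k : nat) : qfact (S k) = (qfact k * (1 - p ^ S k))%C.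
Proof. reflexivity. Qed.

(** Chosen so that [1 + v k] is the reciprocal of [1 - p^(k+1)]: the inverse of [qfact] becomes a
    [cprod] and inherits its bound and its limit. *)
Let v (k : nat) : C := (p ^ S k / (1 - p ^ S k))%C.
Let qfact_inv : nat -> C := cprod v.

Lemma qfact_inverse (n : nat) : (qfact n * qfact_inv n = 1)%C.
Proof.
  induction n as [|n IH]; [unfold qfact, qfact_inv; simpl; ring|].
  rewrite qfact_S. change (qfact_inv (S n)) with (qfact_inv n * (1 + v n))%C.
  transitivity (qfact n * qfact_inv n)%C; [|exact IH]. unfold v. field. apply one_minus_pow_neq_0.
Qed.

Lemma Cmod_inverse_factor_le (k : nat) : Cmod (v k) <= / (1 - Cmod p) * Cmod p ^ k.
Proof.
  pose proof (Cmod_ge_0 p) as H0.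
  unfold v. rewrite Cmod_div by apply one_minus_pow_neq_0. unfold Rdiv.
  rewrite Rmult_comm.
  assert (L : 1 - Cmod p <= Cmod (1 - p ^ S k)).
  { pose proof (Cmod_triangle (1 - p ^ S k) (p ^ S k)) as T.
    replace (1 - p ^ S k + p ^ S k)%C with (1 : C) in T by ring.
    rewrite Cmod_1, Cmod_pow in T.
    assert (Cmod p ^ S k <= Cmod p); [|lra].
    rewrite <- (Rmult_1_r (Cmod p)) at 2. simpl. apply Rmult_le_compat_l; [lra|].
    rewrite <- (pow1 k). apply pow_incr. lra. }
  apply Rmult_le_compat.
  - apply Rlt_le, Rinv_0_lt_compat. lra.
  - apply Cmod_ge_0.
  - apply Rinv_le_contravar; lra.
  - rewrite Cmod_pow. simpl. rewrite <- (Rmult_1_l (Cmod p ^ k)) at 2.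
    apply Rmult_le_compat_r; [apply pow_le|]; lra.
Qed.

Lemma qfact_inverse_cv : exists l, clim qfact_inv l.
Proof.
  apply (cprod_cv _ (/ (1 - Cmod p)) (Cmod p)); [|apply Cmod_inverse_factor_le].
  split; [apply Cmod_ge_0|exact Hp].
Qed.

Lemma qfact_inverse_bounded : exists B, forall n, Cmod (qfact_inv n) <= B.
Proof.
  eexists. apply (cprod_bounded _ (/ (1 - Cmod p)) (Cmod p)); [|apply Cmod_inverse_factor_le].
  split; [apply Cmod_ge_0|exact Hp].
Qed.

(** The Gaussian binomial coefficient, by the Pascal rule that avoids division. The truncated
    [n' - k'] is harmless, since [qbin n' k'] vanishes for [k' > n']. *)
Fixpoint qbin (n k : nat) : C :=
  match n, k with
  | _, O => 1%C
  | O, S _ => 0%C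
  | S n', S k' => (qbin n' (S k') + p ^ (n' - k')%nat * qbin n' k')%C
  end.

Lemma qbin_gt (n k : nat) : (n < k)%nat -> qbin n k = 0%C.
Proof.
  revert k. induction n as [|n IH]; intros [|k] H; simpl; try lia; auto.
  rewrite !IH by lia. ring.
Qed.

Lemma qbin_qfact (n k : nat) : (k <= n)%nat -> (qbin n k * qfact k * qfact (n - k) = qfact n)%C.
Proof.
  revert k. induction n as [|n IH]; intros [|k] H.
  - unfold qfact; simpl; ring.
  - lia.
  - simpl qbin. rewrite Nat.sub_0_r. unfold qfact at 1. simpl. ring.
  - simpl qbin. simpl Nat.sub.
    destruct (Nat.eq_dec k n) as [->|Hk].
    + rewrite qbin_gt by lia. pose proof (IH n (le_n _)) as E.
      rewrite Nat.sub_diag in *. rewrite qfact_S. rewrite <- E at 2. simpl. ring.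
    + pose proof (IH (S k) ltac:(lia)) as E1.
      pose proof (IH k ltac:(lia)) as E2.
      replace (n - k)%nat with (S (n - S k))%nat in * by lia.
      (* The splitting [1 - p^(n+1) = (1 - p^(n-k)) + p^(n-k) (1 - p^(k+1))] mirrors the two terms
         of the Pascal rule. *)
      transitivity (qbin n (S k) * qfact (S k) * qfact (n - S k) * (1 - p ^ S (n - S k))
        + p ^ S (n - S k) * (1 - p ^ S k) * (qbin n k * qfact k * qfact (S (n - S k))))%C.
      * rewrite !qfact_S. ring.
      * rewrite E1, E2, qfact_S.
        replace (S n) with (S (n - S k) + S k)%nat by lia.
        rewrite Cpow_add_r. ring.
Qed.


Fixpoint tri (n : nat) : nat :=
  match n with O => O | S m => (tri m + S m)%nat end.

(** Gauss's q-binomial theorem: multiplication by one more factor reproduces the Pascal rule of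
    [qbin]. *)
Lemma qbinomial (z : C) (n : nat) :
  cprod (fun k => z * p ^ S k)%C n =
  csum (fun k => p ^ tri k * qbin n k * z ^ k)%C (S n).
Proof.
  induction n as [|n IH].
  - simpl. ring.
  - change (cprod (fun k => z * p ^ S k)%C (S n)) with
      (cprod (fun k => z * p ^ S k)%C n * (1 + z * p ^ S n))%C.
    rewrite IH, Cmult_plus_distr_l, Cmult_1_r.
    replace (csum (fun k => p ^ tri k * qbin n k * z ^ k)%C (S n)) with
      (csum (fun k => p ^ tri k * qbin n k * z ^ k)%C (S (S n))) at 1
      by (simpl; rewrite (qbin_gt n (S n)) by lia; ring).
    rewrite csum_S_l, (csum_S_l (fun k => p ^ tri k * qbin (S n) k * z ^ k)%C).
    rewrite <- Cplus_assoc. f_equal; [destruct n; simpl; ring|].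
    rewrite Cmult_comm, <- csum_scal, <- csum_plus.
    apply csum_ext. intros k Hk. simpl qbin. simpl tri.
    replace (p ^ S n)%C with (p ^ (n - k)%nat * p ^ S k)%C
      by (rewrite <- Cpow_add_r; f_equal; lia).
    rewrite Cpow_add_r. simpl. ring.
Qed.

Lemma cprod_add (f : nat -> C) (n m : nat) :
  cprod f (n + m) = (cprod f n * cprod (fun i => f (n + i)%nat) m)%C.
Proof.
  induction m as [|m IH]; simpl.
  - rewrite Nat.add_0_r. ring.
  - rewrite Nat.add_succ_r. simpl. rewrite IH. ring.
Qed.

Lemma cprod_ext (f g : nat -> C) (n : nat) :
  (forall i, (i < n)%nat -> f i = g i) -> cprod f n = cprod g n.
Proof.
  induction n as [|n IH]; intros H; simpl; [easy|].
  rewrite IH, H; auto.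
Qed.

Lemma cprod_rev (f : nat -> C) (n : nat) :
  cprod (fun i => f (n - i)%nat) n = cprod (fun i => f (S i)) n.
Proof.
  induction n as [|n IH]; [easy|].
  change (S n) with (1 + n)%nat at 2. rewrite cprod_add.
  change (cprod (fun i => f (S i)) (S n)) with
    (cprod (fun i => f (S i)) n * (1 + f (S n)))%C.
  rewrite <- IH. simpl cprod at 1. rewrite Cmult_1_l. apply Cmult_comm.
Qed.

Lemma tri_add (i d : nat) : tri (i + d) = (tri i + tri d + i * d)%nat.
Proof.
  induction d as [|d IH]; simpl; [rewrite Nat.add_0_r; lia|].
  rewrite Nat.add_succ_r. simpl. rewrite IH. nia.
Qed.

Lemma two_tri (i : nat) : (2 * tri i = i * (i + 1))%nat.
Proof. induction i as [|i IH]; simpl tri; lia. Qed.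

Hypothesis p_neq_0 : p <> 0.
Variable w : C.
Hypothesis w_neq_0 : w <> 0.

Lemma Cpow_inv_mult (x : C) (n : nat) : x <> 0 -> ((/ x) ^ n * x ^ n = 1)%C.
Proof.
  intros Hx. rewrite <- Cpow_mult_l, Cinv_l by exact Hx. apply Cpow_1_l.
Qed.

Lemma finite_jtp (m : nat) :
  (qpoch_partial w p m * qpoch_partial (p / w) p m =
   csum (fun i => (- / w) ^ i * p ^ tri i * qbin (2 * m) (m - i)) (S m) +
   csum (fun i => (- w) ^ S i * p ^ tri i * qbin (2 * m) (m + 1 + i)) m)%C.
Proof.
  (* With this [z] the [2 m] factors of [qbinomial] are [1 - w p^k] for [k] from [- m] to [m - 1].
     The upper half is [(w;p)_m], the lower half is [(p/w;p)_m] up to a monomial. *)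
  set (z := (- w * (/ p) ^ S m)%C).
  pose proof (qbinomial z (2 * m)) as Q.
  assert (A : cprod (fun i => z * p ^ S (m + i))%C m = qpoch_partial w p m).
  { rewrite qpoch_partial_cprod. apply cprod_ext. intros i _. unfold z.
    replace (S (m + i)) with (S m + i)%nat by lia. rewrite Cpow_add_r.
    transitivity (- w * p ^ i * ((/ p) ^ S m * p ^ S m))%C; [ring|].
    rewrite Cpow_inv_mult by auto. ring. }
  (* Each factor [1 - w p^(-k)] times [- p^k / w] is [1 - p^k / w]; over [k = 1, ..., m] the
     multipliers collect to [(- / w)^m p^(tri m)]. *)
  assert (B : (cprod (fun k => z * p ^ S k) m * ((- / w) ^ m * p ^ tri m)
    = qpoch_partial (p / w) p m)%C).
  { rewrite (cprod_ext _ (fun k => - w * (/ p) ^ (m - k)%nat)%C).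
    - rewrite (cprod_rev (fun k => - w * (/ p) ^ k)%C). clear Q A z.
      induction m as [|m IH]; [simpl; ring|].
      change (cprod (fun i => - w * (/ p) ^ S i)%C (S m)) with
        (cprod (fun i => - w * (/ p) ^ S i)%C m * (1 + - w * (/ p) ^ S m))%C.
      simpl qpoch_partial. rewrite <- IH. simpl tri. rewrite Cpow_add_r.
      transitivity (cprod (fun i => - w * (/ p) ^ S i) m * (((- / w) ^ m * p ^ tri m) *
        (- / w * p ^ S m + (/ w * w) * ((/ p) ^ S m * p ^ S m))))%C; [simpl; ring|].
      rewrite Cpow_inv_mult, Cinv_l by auto. simpl. unfold Cdiv. ring.
    - intros k Hk. unfold z. replace (S m) with (m - k + S k)%nat by lia.
      rewrite Cpow_add_r.
      transitivity (- w * (/ p) ^ (m - k)%nat * ((/ p) ^ S k * p ^ S k))%C; [ring|].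
      rewrite Cpow_inv_mult by auto. ring. }
  rewrite <- A, <- B.
  transitivity (cprod (fun k => z * p ^ S k)%C (2 * m) * ((- / w) ^ m * p ^ tri m))%C.
  { replace (2 * m)%nat with (m + m)%nat by lia. rewrite cprod_add. ring. }
  rewrite Q. replace (S (2 * m)) with (S m + m)%nat by lia.
  rewrite csum_add, Cmult_plus_distr_r. f_equal.
  (* The lower half of the sum is read downwards, so that [i] is the distance to the central index
     [m]. *)
  - rewrite csum_rev. rewrite Cmult_comm, <- csum_scal. apply csum_ext. intros i Hi.
    replace (S m - 1 - i)%nat with (m - i)%nat by lia.
    unfold z. rewrite Cpow_mult_l, <- Cpow_mult_r.
    replace ((- / w) ^ m)%C with ((- / w) ^ i * (- / w) ^ (m - i)%nat)%C
      by (rewrite <- Cpow_add_r; f_equal; lia).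
    assert (E : (p ^ tri m * p ^ tri (m - i) = p ^ tri i * p ^ (S m * (m - i)))%C).
    { rewrite <- !Cpow_add_r. f_equal.
      replace m with (i + (m - i))%nat at 1 3 by lia. rewrite tri_add.
      pose proof (two_tri (m - i)). nia. }
    transitivity ((- / w) ^ i * qbin (2 * m) (m - i) * (((- / w) ^ (m - i)%nat * (- w) ^ (m - i)%nat) *
      ((p ^ tri m * p ^ tri (m - i)) * (/ p) ^ (S m * (m - i)))))%C; [ring|].
    rewrite E, <- Cpow_mult_l.
    transitivity ((- / w) ^ i * qbin (2 * m) (m - i) * ((/ w * w) ^ (m - i)%nat *
      (p ^ tri i * ((/ p) ^ (S m * (m - i)) * p ^ (S m * (m - i))))))%C.
    { replace (- / w * - w)%C with (/ w * w)%C by ring. ring. }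
    rewrite Cpow_inv_mult, Cinv_l, Cpow_1_l by auto. ring.
  - rewrite Cmult_comm, <- csum_scal. apply csum_ext. intros i Hi.
    replace (S m + i)%nat with (m + S i)%nat by lia.
    replace (m + 1 + i)%nat with (m + S i)%nat by lia.
    unfold z. rewrite Cpow_mult_l, <- Cpow_mult_r.
    assert (E : (p ^ tri m * p ^ tri (m + S i) = p ^ tri i * p ^ (S m * (m + S i)))%C).
    { rewrite <- !Cpow_add_r. f_equal. rewrite tri_add. simpl tri.
      pose proof (two_tri m). nia. }
    rewrite (Cpow_add_r (- w)).
    transitivity ((- w) ^ S i * qbin (2 * m) (m + S i) * (((- / w) ^ m * (- w) ^ m) *
      ((p ^ tri m * p ^ tri (m + S i)) * (/ p) ^ (S m * (m + S i)))))%C; [ring|].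
    rewrite E, <- Cpow_mult_l.
    transitivity ((- w) ^ S i * qbin (2 * m) (m + S i) * ((/ w * w) ^ m *
      (p ^ tri i * ((/ p) ^ (S m * (m + S i)) * p ^ (S m * (m + S i))))))%C.
    { replace (- / w * - w)%C with (/ w * w)%C by ring. ring. }
    rewrite Cpow_inv_mult, Cinv_l, Cpow_1_l by auto. ring.
Qed.


Lemma cser_finite (f : nat -> C) (K : nat) :
  (forall i, (K <= i)%nat -> f i = 0) -> cser f (csum f K).
Proof.
  intros H. apply clim_eps. intros eps He. exists K. intros n Hn.
  replace n with (K + (n - K))%nat by lia. rewrite csum_add.
  replace (csum (fun i => f (K + i)%nat) (n - K)) with (RtoC 0).
  - replace (csum f K + 0 - csum f K)%C with (RtoC 0) by ring. now rewrite Cmod_0.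
  - generalize (n - K)%nat. intros d. induction d as [|d IH]; simpl; [easy|].
    rewrite <- IH, H by lia. ring.
Qed.

(** The ratio of consecutive terms is [x rho^(n+1)], which tends to 0 however large [x] is; hence
    any nonzero [w] is admissible in the triple product. *)
Lemma ex_series_pow_tri (x rho : R) :
  0 < x -> 0 < rho < 1 -> ex_series (fun i => x ^ i * rho ^ tri i).
Proof.
  intros Hx Hr. apply ex_series_Rabs, ex_series_DAlembert with 0; [lra| |].
  - intros n. apply Rgt_not_eq, Rmult_lt_0_compat; apply pow_lt; lra.
  - apply is_lim_seq_ext with (fun n => x * (rho * rho ^ n)).
    + intros n. simpl tri. rewrite pow_add. simpl.
      pose proof (pow_lt x n Hx). pose proof (pow_lt rho n (proj1 Hr)).
      pose proof (pow_lt rho (tri n) (proj1 Hr)).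
      rewrite Rabs_pos_eq; [field; lra|].
      apply Rlt_le, Rdiv_lt_0_compat; repeat apply Rmult_lt_0_compat; lra.
    + replace 0 with (x * (rho * 0)) by ring.
      apply is_lim_seq_mult'; [apply is_lim_seq_const|].
      apply is_lim_seq_mult'; [apply is_lim_seq_const|].
      apply is_lim_seq_geom. rewrite Rabs_pos_eq; lra.
Qed.

(** Uniformity in both indices supplies the dominating sequence for [tannery]. The expression is
    [(p;p)_m (p;p)_(2m) / ((p;p)_k (p;p)_(2m-k))], a product of four bounded factors. *)
Lemma qfact_qbin_bounded :
  exists B, forall m k, Cmod (qfact m * qbin (2 * m) k) <= B.
Proof.
  destruct (qpoch_partial_bounded p p Hp) as [B HB]. fold qfact in HB.
  destruct qfact_inverse_bounded as [D HD].
  exists (B * (B * (D * D))). intros m k.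
  pose proof (Rle_trans _ _ _ (Cmod_ge_0 _) (HB O)).
  pose proof (Rle_trans _ _ _ (Cmod_ge_0 _) (HD O)).
  destruct (Nat.le_gt_cases k (2 * m)) as [Hk|Hk].
  - replace (qbin (2 * m) k) with (qfact (2 * m) * (qfact_inv k * qfact_inv (2 * m - k)))%C.
    + rewrite !Cmod_mult.
      repeat (apply Rmult_le_compat; auto using Cmod_ge_0, Rmult_le_pos).
    + rewrite <- (qbin_qfact _ _ Hk).
      transitivity (qbin (2 * m) k * (qfact k * qfact_inv k) *
        (qfact (2 * m - k) * qfact_inv (2 * m - k)))%C; [ring|].
      rewrite !qfact_inverse. ring.
  - rewrite qbin_gt by exact Hk. rewrite Cmult_0_r, Cmod_0.
    apply Rmult_le_pos; [|apply Rmult_le_pos; [|apply Rmult_le_pos]]; auto.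
Qed.

(** As [m], [k] and its complement [l] all grow, the four q-factorials tend to the same
    [c = (p;p)_oo], and the quotient tends to [c c / (c c)]. That [c] is invertible follows from the
    convergence of the reciprocals to [u]. *)
Lemma qfact_qbin_cv (k l : nat -> nat) :
  filterlim k eventually eventually -> filterlim l eventually eventually ->
  eventually (fun m => (k m + l m = 2 * m)%nat) ->
  clim (fun m => qfact m * qbin (2 * m) (k m))%C 1.
Proof.
  intros Hk Hl [N HN].
  pose proof (qpoch_cv p p Hp) as Hq. fold qfact in Hq.
  destruct qfact_inverse_cv as [u Hu].
  set (c := qpoch p p) in *.
  assert (E : (c * u = 1)%C).
  { apply clim_unique with (fun n => qfact n * qfact_inv n)%C.
    - now apply clim_mult.
    - apply clim_ext with (fun _ => RtoC 1); [|apply clim_const].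
      intros n. now rewrite qfact_inverse. }
  assert (T : clim (fun m => qfact m * (qfact (2 * m) * (qfact_inv (k m) * qfact_inv (l m))))%C 1).
  { replace (RtoC 1) with (c * (c * (u * u)))%C.
    - apply clim_mult; [exact Hq|]. apply clim_mult.
      + apply (clim_subseq qfact (fun m => (2 * m)%nat)); [|exact Hq].
        intros P [M HM]. exists M. intros n Hn. apply HM. lia.
      + apply clim_mult; now apply (clim_subseq qfact_inv).
    - transitivity ((c * u) * (c * u))%C; [ring|]. rewrite E. ring. }
  apply clim_eps. intros eps He. rewrite clim_eps in T.
  destruct (T eps He) as [M HM]. exists (Nat.max N M). intros n Hn.
  specialize (HM n ltac:(lia)). specialize (HN n ltac:(lia)).
  replace (qbin (2 * n) (k n)) with (qfact (2 * n) * (qfact_inv (k n) * qfact_inv (l n)))%C; [exact HM|].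
  rewrite <- (qbin_qfact (2 * n) (k n)) by lia.
  replace (2 * n - k n)%nat with (l n) by lia.
  transitivity (qbin (2 * n) (k n) * (qfact (k n) * qfact_inv (k n)) *
        (qfact (l n) * qfact_inv (l n)))%C; [ring|].
  rewrite !qfact_inverse. ring.
Qed.

(** Serves both halves of the bilateral sum: [k i m] is the lower index of the binomial, [l i m] its
    complement, and [K m] the number of terms present at stage [m]. *)
Lemma one_sided_theta_cv (x : C) (K : nat -> nat) (k l : nat -> nat -> nat) :
  x <> 0 ->
  (forall i, filterlim (k i) eventually eventually) ->
  (forall i, filterlim (l i) eventually eventually) ->
  (forall i, eventually (fun m => (k i m + l i m = 2 * m)%nat)) ->
  filterlim K eventually eventually ->
  exists s, cser (fun i => x ^ i * p ^ tri i)%C s /\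
    clim (fun m => csum (fun i => x ^ i * p ^ tri i *
      (qfact m * qbin (2 * m) (k i m)))%C (K m)) s.
Proof.
  intros Hx Hk Hl Hkl HK.
  assert (Hx' := proj1 (Cmod_gt_0 x) Hx).
  assert (Hp' := proj1 (Cmod_gt_0 p) p_neq_0).
  destruct qfact_qbin_bounded as [B HB].
  pose proof (ex_series_pow_tri (Cmod x) (Cmod p) Hx' (conj Hp' Hp)) as HE.
  assert (Hb : forall i, Cmod (x ^ i * p ^ tri i) <= Cmod x ^ i * Cmod p ^ tri i).
  { intros i. rewrite Cmod_mult, !Cmod_pow. lra. }
  destruct (cser_dominated _ _ HE Hb) as [s Hs].
  exists s. split; [exact Hs|].
  (* Padding with zeros beyond [K m] turns each finite sum into a series, as [tannery] requires. *)
  set (a := fun m i => (if Nat.ltb i (K m) then x ^ i * p ^ tri i *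
      (qfact m * qbin (2 * m) (k i m)) else 0)%C).
  apply clim_ext with (fun m => csum (a m) (K m)).
  { intros m. apply csum_ext. intros i Hi. unfold a.
    apply Nat.ltb_lt in Hi. now rewrite Hi. }
  apply tannery with (a := a) (l := fun i => (x ^ i * p ^ tri i)%C)
    (b := fun i => B * (Cmod x ^ i * Cmod p ^ tri i)).
  - apply (ex_series_scal (K := R_AbsRing) B
      (fun i => Cmod x ^ i * Cmod p ^ tri i)). exact HE.
  - intros m i. unfold a.
    assert (H0 := Rle_trans _ _ _ (Cmod_ge_0 _) (Hb i)).
    destruct (Nat.ltb i (K m)).
    + rewrite Cmod_mult, Rmult_comm. apply Rmult_le_compat; auto using Cmod_ge_0.
    + rewrite Cmod_0. apply Rmult_le_pos; [|exact H0].
      exact (Rle_trans _ _ _ (Cmod_ge_0 _) (HB O O)).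
  - intros i. pose proof (qfact_qbin_cv (k i) (l i) (Hk i) (Hl i) (Hkl i)) as Q.
    pose proof (clim_mult _ _ _ _ (clim_const (x ^ i * p ^ tri i)%C) Q) as T.
    rewrite Cmult_1_r in T. rewrite clim_eps in T |- *.
    intros eps He. destruct (T eps He) as [N HN].
    destruct (HK (fun n => (i < n)%nat)) as [M HM]; [now exists (S i)|].
    exists (Nat.max N M). intros n Hn. unfold a.
    specialize (HM n ltac:(lia)). apply Nat.ltb_lt in HM. rewrite HM.
    apply HN. lia.
  - intros m. apply cser_finite. intros i Hi. unfold a.
    apply Nat.ltb_ge in Hi. now rewrite Hi.
  - exact Hs.
Qed.

Lemma filterlim_eventually_le (k : nat -> nat) (c : nat) :
  (forall n, (n <= k n + c)%nat) -> filterlim k eventually eventually.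
Proof.
  intros H P [N HN]. exists (N + c)%nat. intros n Hn. apply HN.
  specialize (H n). lia.
Qed.

(** The index [i] carries the two terms [n = - i] and [n = i + 1] of the
    bilateral series; both have [n (n - 1) / 2 = tri i]. All bilateral series
    below are folded in this way. *)
Theorem jacobi_triple_product :
  cser (fun i => p ^ tri i * ((- / w) ^ i + (- w) ^ S i))%C
    (qpochs (w :: p / w :: p :: nil) p)%C.
Proof.
  assert (W1 : (- / w)%C <> 0).
  { intros E. apply C1_nz. rewrite <- (Cinv_l w w_neq_0).
    replace (/ w)%C with (- - / w)%C by ring. rewrite E. ring. }
  assert (W2 : (- w)%C <> 0).
  { intros E. apply w_neq_0. replace w with (- - w)%C by ring. rewrite E. ring. }
  destruct (one_sided_theta_cv (- / w) S (fun i m => (m - i)%nat) (fun i m => (m + i)%nat) W1)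
    as [s [Hs Ls]].
  - intros i. apply filterlim_eventually_le with i. intros n. lia.
  - intros i. apply filterlim_eventually_le with O. intros n. lia.
  - intros i. exists i. intros n Hn. lia.
  - apply filterlim_eventually_le with O. intros n. lia.
  - destruct (one_sided_theta_cv (- w) (fun m => m) (fun i m => (m + 1 + i)%nat)
      (fun i m => (m - 1 - i)%nat) W2) as [t [Ht Lt]].
    + intros i. apply filterlim_eventually_le with O. intros n. lia.
    + intros i. apply filterlim_eventually_le with (S i). intros n. lia.
    + intros i. exists (S i). intros n Hn. lia.
    + apply filterlim_eventually_le with O. intros n. lia.
    + replace (qpochs (w :: p / w :: p :: nil) p)%C with (s + - w * t)%C.
      * apply cser_ext with (fun i => (- / w) ^ i * p ^ tri i +
          - w * ((- w) ^ i * p ^ tri i))%C; [intros i; simpl; ring|].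
        apply cser_plus; [exact Hs|now apply cser_scal].
      (* The finite identity times [qfact m]: this factor brings in the third product [(p;p)_oo] on
         one side and normalizes the Gaussian binomials on the other. *)
      * apply clim_unique with (fun m =>
          qpoch_partial w p m * (qpoch_partial (p / w) p m * (qfact m * 1)))%C.
        -- apply clim_ext with (fun m => csum (fun i => (- / w) ^ i * p ^ tri i *
             (qfact m * qbin (2 * m) (m - i)))%C (S m) +
             - w * csum (fun i => (- w) ^ i * p ^ tri i *
             (qfact m * qbin (2 * m) (m + 1 + i)))%C m)%C.
           ++ intros m.
              transitivity (qfact m * (qpoch_partial w p m * qpoch_partial (p / w) p m))%C;
                [|ring].
              rewrite finite_jtp, Cmult_plus_distr_l, <- !csum_scal.
              f_equal; apply csum_ext; intros i _; simpl; ring.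
           ++ apply clim_plus; [exact Ls|].
              apply clim_mult; [apply clim_const|exact Lt].
        -- unfold qpochs, fold_right.
           apply clim_mult; [now apply qpoch_cv|].
           apply clim_mult; [now apply qpoch_cv|].
           apply clim_mult; [now apply qpoch_cv|apply clim_const].
Qed.

End JacobiTriple.

(** * Integrals over the half-line *)

Definition is_int_half_line (f : R -> R) (l : R) : Prop :=
  is_lim (fun X => RInt f 0 X) p_infty l.

(** Gaussian decay is weakened to [exp (- t)], which has an elementary primitive and gives geometric
    bounds on the unit cells of Poisson summation. *)
Definition decays (f : R -> R) (M : R) : Prop :=
  (forall t, continuous f t) /\ (forall t, 0 <= t -> Rabs (f t) <= M * exp (- t)).

Lemma ex_RInt_cont (f : R -> R) (a b : R) :
  (forall t, continuous f t) -> ex_RInt f a b.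
Proof. intros H. apply (ex_RInt_continuous (V := R_CompleteNormedModule)). auto. Qed.

Lemma is_RInt_exp_neg (M X Y : R) :
  is_RInt (fun t => M * exp (- t)) X Y (M * exp (- X) - M * exp (- Y)).
Proof.
  replace (M * exp (- X) - M * exp (- Y)) with
    (minus (- M * exp (- Y)) (- M * exp (- X))) by (unfold minus, plus, opp; simpl; ring).
  apply (is_RInt_derive (V := R_CompleteNormedModule) (fun t => - M * exp (- t))).
  - intros t _. auto_derive; [easy|ring].
  - intros t _. apply (ex_derive_continuous (V := R_NormedModule)). auto_derive. easy.
Qed.

Lemma decays_RInt_le (f : R -> R) (M X Y : R) :
  decays f M -> 0 <= X <= Y ->
  Rabs (RInt f X Y) <= M * exp (- X) - M * exp (- Y).
Proof.
  intros [Hc Hf] HX.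
  apply (norm_RInt_le (V := R_NormedModule) f (fun t => M * exp (- t)) X Y).
  - lra.
  - intros t Ht. apply Hf. lra.
  - apply (RInt_correct (V := R_CompleteNormedModule)). now apply ex_RInt_cont.
  - apply is_RInt_exp_neg.
Qed.

Lemma decays_bound_pos (f : R -> R) (M : R) : decays f M -> 0 <= M.
Proof.
  intros [_ H]. specialize (H 0 (Rle_refl 0)). rewrite Ropp_0, exp_0 in H.
  pose proof (Rabs_pos (f 0)). lra.
Qed.

Lemma RInt_Chasles_cont (f : R -> R) (a b c : R) :
  (forall t, continuous f t) -> RInt f a b + RInt f b c = RInt f a c.
Proof.
  intros Hc. apply (RInt_Chasles (V := R_CompleteNormedModule)); now apply ex_RInt_cont.
Qed.

Lemma is_lim_exp_neg (M : R) : is_lim (fun X => M * exp (- X)) p_infty 0.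
Proof.
  replace (Finite 0) with (Rbar_mult M 0) by (simpl; f_equal; ring).
  apply is_lim_scal_l.
  apply is_lim_comp with m_infty.
  - apply is_lim_exp_m.
  - replace m_infty with (Rbar_opp p_infty) by easy. apply is_lim_opp, is_lim_id.
  - exists 0. intros y _. discriminate.
Qed.

Lemma is_lim_p_infty_spec (f : R -> R) (l : R) :
  is_lim f p_infty l <->
  forall eps, 0 < eps -> exists A, forall x, A < x -> Rabs (f x - l) < eps.
Proof.
  rewrite <- is_lim_spec. simpl. split.
  - intros H eps He. destruct (H (mkposreal eps He)) as [A HA]. now exists A.
  - intros H [eps He]. destruct (H eps He) as [A HA]. now exists A.
Qed.

Lemma int_half_line_ex (f : R -> R) (M : R) : decays f M -> exists l, is_int_half_line f l.
Proof.
  intros Hf. pose proof (decays_bound_pos f M Hf) as HM.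
  apply (proj1 (filterlim_locally_cauchy (U := R_CompleteSpace)
    (F := Rbar_locally p_infty) (fun X => RInt f 0 X))).
  intros [eps He].
  destruct (proj1 (is_lim_p_infty_spec _ _) (is_lim_exp_neg M) eps He) as [A HA].
  exists (fun X => Rmax A 0 < X). split; [now exists (Rmax A 0)|].
  assert (K : forall u v, Rmax A 0 < u -> u <= v ->
    Rabs (RInt f 0 v - RInt f 0 u) < eps).
  { intros u v Hu Huv. pose proof (Rmax_l A 0). pose proof (Rmax_r A 0).
    rewrite <- (RInt_Chasles_cont f 0 u v), Rplus_minus_l by apply Hf.
    eapply Rle_lt_trans; [apply (decays_RInt_le f M); [exact Hf|lra]|].
    specialize (HA u ltac:(lra)). rewrite Rminus_0_r in HA.
    pose proof (Rle_abs (M * exp (- u))).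
    pose proof (Rmult_le_pos _ _ HM (Rlt_le _ _ (exp_pos (- v)))). lra. }
  intros u v Hu Hv. change (Rabs (RInt f 0 v - RInt f 0 u) < eps).
  destruct (Rle_dec u v).
  - now apply K.
  - rewrite Rabs_minus_sym. apply K; lra.
Qed.

Definition int_half_line (f : R -> R) : R := real (Lim (fun X => RInt f 0 X) p_infty).

Lemma int_half_line_correct (f : R -> R) (M : R) :
  decays f M -> is_int_half_line f (int_half_line f).
Proof.
  intros Hf. destruct (int_half_line_ex f M Hf) as [l Hl].
  unfold int_half_line. now rewrite (is_lim_unique _ _ _ Hl).
Qed.

Lemma int_half_line_unique (f : R -> R) (l m : R) :
  is_int_half_line f l -> is_int_half_line f m -> l = m.
Proof.
  intros H1 H2. apply is_lim_unique in H1. apply is_lim_unique in H2.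
  rewrite H1 in H2. now injection H2.
Qed.

Lemma int_half_line_ext (f g : R -> R) (l : R) :
  (forall t, f t = g t) -> is_int_half_line f l -> is_int_half_line g l.
Proof.
  intros E. apply is_lim_ext. intros X.
  apply (RInt_ext (V := R_CompleteNormedModule)). auto.
Qed.

Lemma int_half_line_lin (f g : R -> R) (a b l m : R) :
  (forall t, continuous f t) -> (forall t, continuous g t) ->
  is_int_half_line f l -> is_int_half_line g m ->
  is_int_half_line (fun t => a * f t + b * g t) (a * l + b * m).
Proof.
  intros Hf Hg Hl Hm.
  apply is_lim_ext with (fun X => a * RInt f 0 X + b * RInt g 0 X).
  - intros X. symmetry. apply is_RInt_unique.
    apply (is_RInt_plus (V := R_NormedModule));
      apply (is_RInt_scal (V := R_NormedModule));
      apply (RInt_correct (V := R_CompleteNormedModule)); now apply ex_RInt_cont.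
  - apply is_lim_plus';
    (match goal with |- is_lim (fun x => ?c * _) _ (Finite (_ * ?y)) =>
      apply (is_lim_scal_l _ c p_infty y) end); assumption.
Qed.

Lemma int_half_line_le (f : R -> R) (M l : R) : decays f M -> is_int_half_line f l -> Rabs l <= M.
Proof.
  intros Hf Hl. apply le_epsilon. intros eps He.
  destruct (proj1 (is_lim_p_infty_spec _ _) Hl eps He) as [A HA].
  set (X := Rmax A 0 + 1).
  pose proof (Rmax_l A 0). pose proof (Rmax_r A 0).
  specialize (HA X ltac:(unfold X; lra)).
  pose proof (decays_RInt_le f M 0 X Hf ltac:(unfold X; lra)) as B.
  rewrite Ropp_0, exp_0 in B.
  pose proof (Rmult_le_pos _ _ (decays_bound_pos _ _ Hf) (Rlt_le _ _ (exp_pos (- X)))).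
  pose proof (Rabs_triang (RInt f 0 X) (- (RInt f 0 X - l))) as T.
  rewrite Rabs_Ropp in T.
  replace (RInt f 0 X + - (RInt f 0 X - l)) with l in T by ring. lra.
Qed.

Lemma int_half_line_derive (F f : R -> R) (l : R) :
  (forall t, is_derive F t (f t)) -> (forall t, continuous f t) ->
  is_lim F p_infty l -> is_int_half_line f (l - F 0).
Proof.
  intros HF Hf Hl.
  apply is_lim_ext with (fun X => F X - F 0).
  - intros X. symmetry. apply is_RInt_unique.
    apply (is_RInt_derive (V := R_CompleteNormedModule) F f); auto.
  - apply is_lim_minus'; [exact Hl|apply is_lim_const].
Qed.

Lemma int_half_line_scale (f : R -> R) (s l : R) :
  0 < s -> (forall t, continuous f t) -> is_int_half_line f l ->
  is_int_half_line (fun t => f (s * t)) (/ s * l).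
Proof.
  intros Hs Hc Hl.
  apply is_lim_ext with (fun X => / s * RInt f 0 (s * X)).
  - intros X. symmetry. apply is_RInt_unique.
    apply (is_RInt_ext (V := R_NormedModule) (fun t => scal (/ s) (scal s (f (s * t + 0))))).
    + intros t _. unfold scal; simpl; unfold mult; simpl. rewrite Rplus_0_r. field. lra.
    + apply (is_RInt_scal (V := R_NormedModule)).
      apply (is_RInt_comp_lin (V := R_NormedModule) f s 0 0 X).
      rewrite Rmult_0_r, !Rplus_0_r.
      apply (RInt_correct (V := R_CompleteNormedModule)). now apply ex_RInt_cont.
  - apply (is_lim_scal_l _ (/ s) p_infty l).
    apply (is_lim_comp (fun X => RInt f 0 X) (fun X => s * X) p_infty l p_infty).
    + exact Hl.
    + apply is_lim_spec. intros A. exists (A / s). intros x Hx.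
      apply Rmult_lt_reg_l with (/ s); [now apply Rinv_0_lt_compat|].
      replace (/ s * (s * x)) with x by (field; lra).
      unfold Rdiv in Hx. lra.
    + exists 0. intros y _. discriminate.
Qed.

(** The quadratic polynomial covers the bounded factor [cos], the factor [t] produced by
    differentiation and the factor [t^2] of a second-order remainder. *)
Lemma gauss_dominated (p : R) :
  0 < p -> exists M, forall t, 0 <= t ->
    (1 + t + t ^ 2) * exp (- p * t ^ 2) <= M * exp (- t).
Proof.
  (* The [4] comes from squaring [1 + t/2 <= exp (t/2)], and [exp (/ p)] from completing the square
     in [2 t - p t^2 <= 1/p]. *)
  intros Hp. exists (4 * exp (/ p)). intros t Ht.
  assert (H1 : 1 + t + t ^ 2 <= 4 * exp t).
  { pose proof (exp_ineq1_le (t / 2)) as H.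
    replace (exp t) with (exp (t / 2) * exp (t / 2))
      by (rewrite <- exp_plus; f_equal; field).
    nra. }
  assert (H2 : exp t * exp (- p * t ^ 2) <= exp (/ p) * exp (- t)).
  { rewrite <- !exp_plus. apply exp_le_compat.
    assert (0 <= / p * (p * t - 1) ^ 2).
    { apply Rmult_le_pos; [apply Rlt_le, Rinv_0_lt_compat, Hp|apply pow2_ge_0]. }
    replace (/ p * (p * t - 1) ^ 2) with (p * t ^ 2 - 2 * t + / p) in H by (field; lra).
    lra. }
  pose proof (exp_pos (- p * t ^ 2)). nra.
Qed.

(** * The Gaussian integral *)

(** The tool for differentiating under the integral sign: a second-order bound on the integrand
    integrates to such an error estimate. *)
Lemma is_derive_quadratic_error (f : R -> R) (x l M : R) :
  (forall h, Rabs (f (x + h) - f x - l * h) <= M * h ^ 2) -> is_derive f x l.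
Proof.
  intros H. apply is_derive_Reals. intros eps He.
  assert (HM : 0 <= M).
  { specialize (H 1). pose proof (Rabs_pos (f (x + 1) - f x - l * 1)). lra. }
  assert (Hd : 0 < eps / (M + 1)) by (apply Rdiv_lt_0_compat; lra).
  exists (mkposreal _ Hd). intros h Hh Hlt. simpl in Hlt.
  replace ((f (x + h) - f x) / h - l) with ((f (x + h) - f x - l * h) / h)
    by (field; exact Hh).
  unfold Rdiv. rewrite Rabs_mult, Rabs_inv.
  assert (Hp : 0 < Rabs h) by now apply Rabs_pos_lt.
  apply Rle_lt_trans with (M * Rabs h).
  - apply Rmult_le_reg_r with (Rabs h); [exact Hp|].
    rewrite Rmult_assoc, Rinv_l by lra.
    specialize (H h). rewrite <- pow2_abs in H. simpl in H. lra.
  - apply Rle_lt_trans with (M * (eps / (M + 1))).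
    + apply Rmult_le_compat_l; lra.
    + apply Rmult_lt_reg_r with (M + 1); [lra|].
      replace (M * (eps / (M + 1)) * (M + 1)) with (M * eps) by (field; lra). nra.
Qed.

Lemma Rabs_sin_minus_le (x y : R) : Rabs (sin y - sin x) <= Rabs (y - x).
Proof.
  destruct (MVT_gen sin x y cos) as [c [_ Hc]].
  - intros t _. auto_derive; [easy|ring].
  - intros t _. apply continuity_sin.
  - rewrite Hc, Rabs_mult.
    rewrite <- (Rmult_1_l (Rabs (y - x))) at 2.
    apply Rmult_le_compat_r; [apply Rabs_pos|].
    apply Rabs_le, COS_bound.
Qed.

Lemma cos_taylor_le (x d : R) : Rabs (cos (x + d) - cos x + d * sin x) <= d ^ 2.
Proof.
  destruct (MVT_gen cos x (x + d) (fun t => - sin t)) as [c [Hc E]].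
  - intros t _. auto_derive; [easy|ring].
  - intros t _. apply continuity_cos.
  - rewrite E.
    replace (- sin c * (x + d - x) + d * sin x) with (- d * (sin c - sin x)) by ring.
    rewrite Rabs_mult, Rabs_Ropp.
    replace (d ^ 2) with (Rabs d * Rabs d) by (rewrite <- pow2_abs; ring).
    apply Rmult_le_compat_l; [apply Rabs_pos|].
    eapply Rle_trans; [apply Rabs_sin_minus_le|].
    unfold Rmin, Rmax in Hc. apply Rabs_le.
    destruct (Rle_dec x (x + d)); unfold Rabs; destruct (Rcase_abs d); lra.
Qed.

(** * Fourier integrals of an amplitude dominated by a Gaussian *)

Section GaussAmplitude.
Variables (p : R) (g : R -> R).
Hypothesis Hp : 0 < p.
Hypothesis Hgc : forall t, continuous g t.
Hypothesis Hg : forall t, Rabs (g t) <= exp (- p * t ^ 2).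

(** [M] is fixed before [c] and [phi], which makes the later bounds uniform in the frequency and in
    the increment. *)
Lemma amplitude_decays : exists M, forall c phi, 0 <= c ->
  (forall t, continuous phi t) ->
  (forall t, 0 <= t -> Rabs (phi t) <= c * (1 + t + t ^ 2)) ->
  decays (fun t => g t * phi t) (c * M).
Proof.
  destruct (gauss_dominated p Hp) as [M HM]. exists M.
  intros c phi Hc Hphic Hphi. split.
  - intros t. apply (continuous_mult (K := R_AbsRing)); auto.
  - intros t Ht. specialize (HM t Ht). specialize (Hphi t Ht). specialize (Hg t).
    rewrite Rabs_mult, Rmult_assoc.
    eapply Rle_trans; [|apply Rmult_le_compat_l; [exact Hc|exact HM]].
    pose proof (Rabs_pos (g t)). pose proof (Rabs_pos (phi t)).
    pose proof (exp_pos (- p * t ^ 2)). nra.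
Qed.

Lemma continuous_cos_lin (w t : R) : continuous (fun t => cos (w * t)) t.
Proof. apply (ex_derive_continuous (V := R_NormedModule)). auto_derive. easy. Qed.

Lemma continuous_id_sin_lin (w t : R) : continuous (fun t => t * sin (w * t)) t.
Proof. apply (ex_derive_continuous (V := R_NormedModule)). auto_derive. easy. Qed.

Lemma continuous_amplitude_mult (phi : R -> R) :
  (forall t, continuous phi t) -> forall t, continuous (fun t => g t * phi t) t.
Proof. intros H t. apply (continuous_mult (K := R_AbsRing)); auto. Qed.

Lemma cos_decays : exists M, forall w, decays (fun t => g t * cos (w * t)) M.
Proof.
  destruct amplitude_decays as [M HM]. exists M. intros w.
  rewrite <- (Rmult_1_l M). apply HM; [lra|apply continuous_cos_lin|].
  intros t Ht. rewrite Rmult_1_l.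
  apply Rle_trans with 1; [apply Rabs_le, COS_bound|nra].
Qed.

Lemma id_sin_decays : exists M, forall w, decays (fun t => g t * (t * sin (w * t))) M.
Proof.
  destruct amplitude_decays as [M HM]. exists M. intros w.
  rewrite <- (Rmult_1_l M). apply HM; [lra|apply continuous_id_sin_lin|].
  intros t Ht. rewrite Rmult_1_l, Rabs_mult, (Rabs_pos_eq t) by exact Ht.
  assert (Rabs (sin (w * t)) <= 1) by apply Rabs_le, SIN_bound. nra.
Qed.

Lemma int_half_line_cos_derive (Cf Sf : R -> R) :
  (forall w, is_int_half_line (fun t => g t * cos (w * t)) (Cf w)) ->
  (forall w, is_int_half_line (fun t => g t * (t * sin (w * t))) (Sf w)) ->
  forall w, is_derive Cf w (- Sf w).
Proof.
  intros HC HS w. destruct amplitude_decays as [M HM].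
  (* The error is the integral of [g] times a Taylor remainder of size at most [h^2 t^2], so
     [amplitude_decays] applies with [c = h^2]. *)
  apply is_derive_quadratic_error with M. intros h.
  rewrite (Rmult_comm M).
  apply int_half_line_le with (fun t => g t *
    (cos ((w + h) * t) + (-1) * cos (w * t) + h * (t * sin (w * t)))).
  - apply HM.
    + apply pow2_ge_0.
    + intros t. apply (ex_derive_continuous (V := R_NormedModule)). auto_derive. easy.
    + intros t Ht. pose proof (cos_taylor_le (w * t) (h * t)) as T.
      replace (w * t + h * t) with ((w + h) * t) in T by ring.
      replace (cos ((w + h) * t) + -1 * cos (w * t) + h * (t * sin (w * t)))
        with (cos ((w + h) * t) - cos (w * t) + h * t * sin (w * t)) by ring.
      pose proof (pow2_ge_0 h). nra.
  - replace (Cf (w + h) - Cf w - - Sf w * h) with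
      (1 * (1 * Cf (w + h) + (-1) * Cf w) + h * Sf w) by ring.
    apply int_half_line_ext with (fun t => 1 * (1 * (g t * cos ((w + h) * t)) +
      (-1) * (g t * cos (w * t))) + h * (g t * (t * sin (w * t)))).
    { intros t. ring. }
    assert (C1 : forall v, forall t, continuous (fun t => g t * cos (v * t)) t)
      by (intros v; apply continuous_amplitude_mult, continuous_cos_lin).
    assert (C2 := continuous_amplitude_mult _ (continuous_id_sin_lin w)).
    pose proof (int_half_line_lin _ _ 1 (-1) _ _ (C1 (w + h)) (C1 w) (HC (w + h)) (HC w)) as G1.
    refine (int_half_line_lin _ _ 1 h _ _ _ C2 G1 (HS w)).
    intros t. apply (continuous_plus (V := R_NormedModule));
      apply (continuous_scal_r (V := R_NormedModule)), C1.
Qed.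

Lemma is_lim_amplitude_sin (w : R) : is_lim (fun t => g t * sin (w * t)) p_infty 0.
Proof.
  destruct (gauss_dominated p Hp) as [M HM].
  apply is_lim_p_infty_spec. intros eps He.
  destruct (proj1 (is_lim_p_infty_spec _ _) (is_lim_exp_neg M) eps He) as [A HA].
  exists (Rmax A 0). intros t Ht.
  pose proof (Rmax_l A 0). pose proof (Rmax_r A 0).
  specialize (HA t ltac:(lra)). specialize (HM t ltac:(lra)).
  rewrite Rminus_0_r in *. specialize (Hg t).
  eapply Rle_lt_trans; [|apply HA].
  eapply Rle_trans; [|apply Rle_abs].
  eapply Rle_trans; [|apply HM].
  rewrite Rabs_mult.
  assert (Rabs (sin (w * t)) <= 1) by apply Rabs_le, SIN_bound.
  pose proof (Rabs_pos (g t)). pose proof (exp_pos (- p * t ^ 2)). nra.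
Qed.

End GaussAmplitude.

(** Integrates the derivative of [g t * sin (w t)], whose boundary values at 0 and at infinity
    vanish. The partner [f] is present because the real and imaginary parts of a complex Gaussian
    satisfy a coupled system. *)
Lemma int_half_line_by_parts (p : R) (g f : R -> R) (a b w c sg sf : R) :
  0 < p ->
  (forall t, continuous g t) -> (forall t, Rabs (g t) <= exp (- p * t ^ 2)) ->
  (forall t, continuous f t) ->
  (forall t, is_derive g t (a * (t * g t) + b * (t * f t))) ->
  is_int_half_line (fun t => g t * cos (w * t)) c ->
  is_int_half_line (fun t => g t * (t * sin (w * t))) sg ->
  is_int_half_line (fun t => f t * (t * sin (w * t))) sf ->
  w * c + a * sg + b * sf = 0.
Proof.
  intros Hp Hgc Hg Hfc Hd Hc Hsg Hsf.
  assert (C1 := continuous_amplitude_mult g Hgc _ (continuous_cos_lin w)).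
  assert (C2 := continuous_amplitude_mult g Hgc _ (continuous_id_sin_lin w)).
  assert (C3 := continuous_amplitude_mult f Hfc _ (continuous_id_sin_lin w)).
  assert (C4 : forall t, continuous (fun t => w * (g t * cos (w * t)) +
    a * (g t * (t * sin (w * t)))) t).
  { intros t. apply (continuous_plus (V := R_NormedModule));
      now apply (continuous_scal_r (V := R_NormedModule)). }
  assert (G1 := int_half_line_lin _ _ w a _ _ C1 C2 Hc Hsg).
  assert (G2 := int_half_line_lin _ _ 1 b _ _ C4 C3 G1 Hsf). cbv beta in G2.
  assert (P := is_lim_amplitude_sin p g Hp Hg w).
  apply (int_half_line_derive _ (fun t => 1 * (w * (g t * cos (w * t)) +
    a * (g t * (t * sin (w * t)))) + b * (f t * (t * sin (w * t))))) in P.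
  - cbv beta in P. pose proof (int_half_line_unique _ _ _ G2 P) as E.
    rewrite Rmult_0_r, sin_0, Rmult_0_r in E. lra.
  - intros t. evar_last.
    + apply (is_derive_mult g (fun t => sin (w * t)) t
        (a * (t * g t) + b * (t * f t)) (w * cos (w * t))).
      * apply Hd.
      * auto_derive; [easy|ring].
      * intros n m. apply Rmult_comm.
    + unfold plus, mult; simpl. unfold mult; simpl. ring.
  - intros t. apply (continuous_plus (V := R_NormedModule));
      apply (continuous_scal_r (V := R_NormedModule)); auto.
Qed.

Section GaussIntegral.
Variables p s : R.
Hypothesis Hp : 0 < p.

Let gr (t : R) : R := exp (- p * t ^ 2) * cos (s * t ^ 2).
Let gi (t : R) : R := - exp (- p * t ^ 2) * sin (s * t ^ 2).

Lemma gauss_re_derive (t : R) : is_derive gr t (2 * s * (t * gi t) - 2 * p * (t * gr t)).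
Proof. unfold gr, gi. auto_derive; [easy|simpl; ring]. Qed.

Lemma gauss_im_derive (t : R) : is_derive gi t (- 2 * s * (t * gr t) - 2 * p * (t * gi t)).
Proof. unfold gr, gi. auto_derive; [easy|simpl; ring]. Qed.

Lemma gauss_re_continuous (t : R) : continuous gr t.
Proof. apply (ex_derive_continuous (V := R_NormedModule)). eexists. apply gauss_re_derive. Qed.

Lemma gauss_im_continuous (t : R) : continuous gi t.
Proof. apply (ex_derive_continuous (V := R_NormedModule)). eexists. apply gauss_im_derive. Qed.

Lemma gauss_re_le (t : R) : Rabs (gr t) <= exp (- p * t ^ 2).
Proof.
  unfold gr. rewrite Rabs_mult. pose proof (exp_pos (- p * t ^ 2)).
  assert (Rabs (cos (s * t ^ 2)) <= 1) by apply Rabs_le, COS_bound.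
  rewrite Rabs_pos_eq by lra. nra.
Qed.

Lemma gauss_im_le (t : R) : Rabs (gi t) <= exp (- p * t ^ 2).
Proof.
  unfold gi. rewrite Rabs_mult, Rabs_Ropp. pose proof (exp_pos (- p * t ^ 2)).
  assert (Rabs (sin (s * t ^ 2)) <= 1) by apply Rabs_le, SIN_bound.
  rewrite Rabs_pos_eq by lra. nra.
Qed.

(** With [A = p + i s], integration by parts shows that the integral [C w] of
    [exp (- A t^2) cos (w t)] satisfies [C' w = - w / (2 A) * C w], so that
    [C w = C 0 * exp (- w^2 / (4 A))]; [C 0] itself need not be computed. *)
Lemma gauss_cos_integral : exists l m : R, forall w,
  let e := exp (- p / (4 * (p ^ 2 + s ^ 2)) * w ^ 2) in
  let a := s / (4 * (p ^ 2 + s ^ 2)) * w ^ 2 in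
  is_int_half_line (fun t => gr t * cos (w * t)) (e * (cos a * l - sin a * m)) /\
  is_int_half_line (fun t => gi t * cos (w * t)) (e * (cos a * m + sin a * l)).
Proof.
  destruct (cos_decays p gr Hp gauss_re_continuous gauss_re_le) as [M1 D1].
  destruct (cos_decays p gi Hp gauss_im_continuous gauss_im_le) as [M2 D2].
  destruct (id_sin_decays p gr Hp gauss_re_continuous gauss_re_le) as [M3 D3].
  destruct (id_sin_decays p gi Hp gauss_im_continuous gauss_im_le) as [M4 D4].
  set (Cr := fun w => int_half_line (fun t => gr t * cos (w * t))).
  set (Ci := fun w => int_half_line (fun t => gi t * cos (w * t))).
  set (Sr := fun w => int_half_line (fun t => gr t * (t * sin (w * t)))).
  set (Si := fun w => int_half_line (fun t => gi t * (t * sin (w * t)))).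
  assert (HCr : forall w, is_int_half_line (fun t => gr t * cos (w * t)) (Cr w))
    by (intros w; apply (int_half_line_correct _ _ (D1 w))).
  assert (HCi : forall w, is_int_half_line (fun t => gi t * cos (w * t)) (Ci w))
    by (intros w; apply (int_half_line_correct _ _ (D2 w))).
  assert (HSr : forall w, is_int_half_line (fun t => gr t * (t * sin (w * t))) (Sr w))
    by (intros w; apply (int_half_line_correct _ _ (D3 w))).
  assert (HSi : forall w, is_int_half_line (fun t => gi t * (t * sin (w * t))) (Si w))
    by (intros w; apply (int_half_line_correct _ _ (D4 w))).
  assert (E1 : forall w, w * Cr w = 2 * p * Sr w - 2 * s * Si w).
  { intros w.
    pose proof (int_half_line_by_parts p gr gi (- 2 * p) (2 * s) w (Cr w) (Sr w) (Si w)
      Hp gauss_re_continuous gauss_re_le gauss_im_continuous) as P.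
    assert (w * Cr w + - 2 * p * Sr w + 2 * s * Si w = 0); [|lra].
    apply P; auto. intros t. evar_last; [apply gauss_re_derive|ring]. }
  assert (E2 : forall w, w * Ci w = 2 * p * Si w + 2 * s * Sr w).
  { intros w.
    pose proof (int_half_line_by_parts p gi gr (- 2 * p) (- 2 * s) w (Ci w) (Si w) (Sr w)
      Hp gauss_im_continuous gauss_im_le gauss_re_continuous) as P.
    assert (w * Ci w + - 2 * p * Si w + - 2 * s * Sr w = 0); [|lra].
    apply P; auto. intros t. evar_last; [apply gauss_im_derive|ring]. }
  set (D := p ^ 2 + s ^ 2). assert (HD : 0 < D) by (unfold D; nra).
  assert (F1 : forall w, is_derive Cr w (- (w * (p * Cr w + s * Ci w) / (2 * D)))).
  { intros w. evar_last.
    - apply (int_half_line_cos_derive p gr Hp gauss_re_continuous gauss_re_le Cr Sr); auto.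
    - transitivity (- ((p * (w * Cr w) + s * (w * Ci w)) / (2 * D)));
        [|field; lra].
      rewrite E1, E2. unfold D. field. unfold D in HD. lra. }
  assert (F2 : forall w, is_derive Ci w (- (w * (p * Ci w - s * Cr w) / (2 * D)))).
  { intros w. evar_last.
    - apply (int_half_line_cos_derive p gi Hp gauss_im_continuous gauss_im_le Ci Si); auto.
    - transitivity (- ((p * (w * Ci w) - s * (w * Cr w)) / (2 * D)));
        [|field; lra].
      rewrite E1, E2. unfold D. field. unfold D in HD. lra. }
  (* Since [1 / (4 A) = k - i sg], the functions [Er] and [Ei] below are the real and imaginary
     parts of [exp (w^2 / (4 A)) * C w]: the integrating factor makes them constant. *)
  set (k := p / (4 * D)). set (sg := s / (4 * D)).
  set (Er := fun w => exp (k * w ^ 2) * (cos (sg * w ^ 2) * Cr w + sin (sg * w ^ 2) * Ci w)).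
  set (Ei := fun w => exp (k * w ^ 2) * (cos (sg * w ^ 2) * Ci w - sin (sg * w ^ 2) * Cr w)).
  assert (K1 : forall w, is_derive Er w 0).
  { intros w. unfold Er.
    auto_derive; [repeat split; eexists; [apply F1|apply F2]|].
    replace (Derive (fun x => Cr x) w) with (- (w * (p * Cr w + s * Ci w) / (2 * D)))
      by (symmetry; apply is_derive_unique, F1).
    replace (Derive (fun x => Ci x) w) with (- (w * (p * Ci w - s * Cr w) / (2 * D)))
      by (symmetry; apply is_derive_unique, F2).
    unfold k, sg. field. lra. }
  assert (K2 : forall w, is_derive Ei w 0).
  { intros w. unfold Ei.
    auto_derive; [repeat split; eexists; [apply F2|apply F1]|].
    replace (Derive (fun x => Cr x) w) with (- (w * (p * Cr w + s * Ci w) / (2 * D)))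
      by (symmetry; apply is_derive_unique, F1).
    replace (Derive (fun x => Ci x) w) with (- (w * (p * Ci w - s * Cr w) / (2 * D)))
      by (symmetry; apply is_derive_unique, F2).
    unfold k, sg. field. lra. }
  assert (Kc : forall E : R -> R, (forall w, is_derive E w 0) -> forall w, E w = E 0).
  { intros E HE w. destruct (Rtotal_order w 0) as [H|[->|H]]; [|easy|].
    - apply (eq_is_derive (V := R_NormedModule) E); auto.
    - symmetry. apply (eq_is_derive (V := R_NormedModule) E); auto. }
  exists (Cr 0), (Ci 0). intros w e a.
  pose proof (Kc Er K1 w) as X1. pose proof (Kc Ei K2 w) as X2.
  unfold Er, Ei in X1, X2.
  replace (k * 0 ^ 2) with 0 in X1, X2 by ring.
  replace (sg * 0 ^ 2) with 0 in X1, X2 by ring.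
  rewrite exp_0, cos_0, sin_0 in X1, X2.
  replace (Cr 0) with (exp (k * w ^ 2) * (cos (sg * w ^ 2) * Cr w + sin (sg * w ^ 2) * Ci w)) by lra.
  replace (Ci 0) with (exp (k * w ^ 2) * (cos (sg * w ^ 2) * Ci w - sin (sg * w ^ 2) * Cr w)) by lra.
  assert (Ee : e * exp (k * w ^ 2) = 1).
  { unfold e. rewrite <- exp_plus, <- exp_0. f_equal. unfold k, D. field.
    unfold D in HD. lra. }
  assert (Ea : a = sg * w ^ 2) by easy. clearbody a e. subst a.
  pose proof (sin2_cos2 (sg * w ^ 2)) as T. unfold Rsqr in T.
  split; evar_last.
  - apply HCr.
  - transitivity ((e * exp (k * w ^ 2)) * (sin (sg * w ^ 2) * sin (sg * w ^ 2) +
      cos (sg * w ^ 2) * cos (sg * w ^ 2)) * Cr w); [rewrite Ee, T; ring|ring].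
  - apply HCi.
  - transitivity ((e * exp (k * w ^ 2)) * (sin (sg * w ^ 2) * sin (sg * w ^ 2) +
      cos (sg * w ^ 2) * cos (sg * w ^ 2)) * Ci w); [rewrite Ee, T; ring|ring].
Qed.
End GaussIntegral.

(** * Poisson summation at the half-integers *)

Fixpoint rsum (f : nat -> R) (n : nat) : R :=
  match n with O => 0 | S m => rsum f m + f m end.

(** Centred at [1/2] rather than [0]: hence the signs. *)
Fixpoint dirichlet (j : nat) (x : R) : R :=
  match j with
  | O => 1
  | S i => dirichlet i x + 2 * (-1) ^ S i * cos (2 * PI * INR (S i) * x)
  end.

Definition fejer (n : nat) (x : R) : R := rsum (fun j => dirichlet j x) n.

(** The classical quotient [sin((2j+1) pi u) / sin(pi u)] at [u = x - 1/2], cleared of its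
    denominator. *)
Lemma dirichlet_cos (j : nat) (x : R) :
  cos (PI * x) * dirichlet j x = (-1) ^ j * cos ((2 * INR j + 1) * (PI * x)).
Proof.
  induction j as [|j IH].
  - simpl. rewrite !Rmult_1_l, Rmult_1_r. f_equal. ring.
  - change (dirichlet (S j) x) with
      (dirichlet j x + 2 * (-1) ^ S j * cos (2 * PI * INR (S j) * x)).
    rewrite Rmult_plus_distr_l, IH.
    replace ((2 * INR j + 1) * (PI * x)) with (2 * PI * INR (S j) * x - PI * x)
      by (rewrite S_INR; ring).
    replace ((2 * INR (S j) + 1) * (PI * x)) with (2 * PI * INR (S j) * x + PI * x) by ring.
    rewrite cos_plus, cos_minus. simpl. ring.
Qed.

(** The right-hand side is [2 sin(n pi u)^2] with [u = x - 1/2], which shows the nonnegativity of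
    Fejér's kernel away from the half-integers. *)
Lemma fejer_cos2 (n : nat) (x : R) :
  2 * cos (PI * x) ^ 2 * fejer n x = 1 - (-1) ^ n * cos (2 * INR n * (PI * x)).
Proof.
  induction n as [|n IH].
  - unfold fejer. simpl. rewrite !Rmult_0_r, Rmult_0_l, cos_0. ring.
  - change (fejer (S n) x) with (fejer n x + dirichlet n x).
    rewrite Rmult_plus_distr_l, IH.
    replace (2 * cos (PI * x) ^ 2 * dirichlet n x) with
      (2 * cos (PI * x) * (cos (PI * x) * dirichlet n x)) by ring.
    rewrite dirichlet_cos.
    replace (2 * INR n * (PI * x)) with ((2 * INR n + 1) * (PI * x) - PI * x) by ring.
    replace (2 * INR (S n) * (PI * x)) with ((2 * INR n + 1) * (PI * x) + PI * x)
      by (rewrite S_INR; ring).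
    rewrite cos_plus, cos_minus. simpl. ring.
Qed.

Lemma fejer_cos2_bounds (n : nat) (x : R) :
  0 <= cos (PI * x) ^ 2 * fejer n x <= 1.
Proof.
  pose proof (fejer_cos2 n x) as H.
  assert (B : Rabs ((-1) ^ n * cos (2 * INR n * (PI * x))) <= 1).
  { rewrite Rabs_mult, pow_1_abs, Rmult_1_l. apply Rabs_le, COS_bound. }
  apply Rabs_le_between in B. lra.
Qed.

(** At the half-integers the closed form reads [0 = 0], so the kernel is evaluated there directly to
    get its sign. *)
Lemma dirichlet_at_zero_cos (j : nat) (x : R) :
  cos (PI * x) = 0 -> dirichlet j x = 2 * INR j + 1.
Proof.
  intros H.
  assert (K : forall k, cos (2 * PI * INR k * x) = (-1) ^ k /\
    sin (2 * PI * INR k * x) = 0).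
  { induction k as [|k [IH1 IH2]].
    - simpl. rewrite !Rmult_0_r, Rmult_0_l. now rewrite cos_0, sin_0.
    - replace (2 * PI * INR (S k) * x) with (2 * PI * INR k * x + 2 * (PI * x))
        by (rewrite S_INR; ring).
      rewrite cos_plus, sin_plus, IH1, IH2, cos_2a_cos, sin_2a, H. simpl. split; ring. }
  induction j as [|j IH]; [simpl; ring|].
  change (dirichlet (S j) x) with
      (dirichlet j x + 2 * (-1) ^ S j * cos (2 * PI * INR (S j) * x)).
  rewrite IH, (proj1 (K (S j))), Rmult_assoc, <- Rpow_mult_distr, S_INR.
  replace (-1 * -1) with 1 by ring. rewrite pow1. ring.
Qed.

Lemma fejer_ge_0 (n : nat) (x : R) : 0 <= fejer n x.
Proof.
  destruct (Req_dec (cos (PI * x)) 0) as [H|H].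
  - unfold fejer. induction n as [|n IH]; simpl; [lra|].
    rewrite (dirichlet_at_zero_cos n x H). pose proof (pos_INR n). lra.
  - destruct (fejer_cos2_bounds n x) as [B _].
    apply Rmult_le_reg_l with (cos (PI * x) ^ 2); [|lra].
    rewrite <- Rsqr_pow2. now apply Rsqr_pos_lt.
Qed.

Lemma dirichlet_continuous (j : nat) (x : R) : continuous (dirichlet j) x.
Proof.
  induction j as [|j IH]; [apply continuous_const|].
  apply (continuous_plus (V := R_NormedModule)); [exact IH|].
  apply (ex_derive_continuous (V := R_NormedModule)). auto_derive. easy.
Qed.

Lemma fejer_continuous (n : nat) (x : R) : continuous (fejer n) x.
Proof.
  unfold fejer. induction n as [|n IH]; simpl; [apply continuous_const|].
  apply (continuous_plus (V := R_NormedModule)); [exact IH|apply dirichlet_continuous].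
Qed.

Lemma is_RInt_dirichlet (j m : nat) : is_RInt (dirichlet j) (INR m) (INR (S m)) 1.
Proof.
  induction j as [|j IH].
  - replace 1 with (scal (INR (S m) - INR m) 1)
      by (rewrite S_INR; unfold scal; simpl; unfold mult; simpl; ring).
    apply (is_RInt_const (V := R_NormedModule)).
  - replace 1 with (plus 1 0) by (unfold plus; simpl; ring).
    apply (is_RInt_plus (V := R_NormedModule) (dirichlet j)
      (fun x => 2 * (-1) ^ S j * cos (2 * PI * INR (S j) * x))); [exact IH|].
    set (w := 2 * PI * INR (S j)).
    assert (Hw : w <> 0).
    { pose proof PI_RGT_0. pose proof (lt_0_INR (S j) ltac:(lia)).
      unfold w. apply Rmult_integral_contrapositive_currified; lra. }
    assert (Z : forall i, sin (w * INR i) = 0).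
    { intros i. unfold w.
      replace (2 * PI * INR (S j) * INR i) with (0 + 2 * INR (S j * i) * PI)
        by (rewrite mult_INR; ring).
      now rewrite sin_period, sin_0. }
    replace 0 with (minus (2 * (-1) ^ S j / w * sin (w * INR (S m)))
      (2 * (-1) ^ S j / w * sin (w * INR m)))
      by (rewrite !Z; unfold minus, plus, opp; simpl; ring).
    apply (is_RInt_derive (V := R_CompleteNormedModule)
      (fun x => 2 * (-1) ^ S j / w * sin (w * x))).
    + intros x _. auto_derive; [easy|]. simpl. field; exact Hw.
    + intros x _. apply (ex_derive_continuous (V := R_NormedModule)). auto_derive. easy.
Qed.

Lemma is_RInt_fejer (n m : nat) : is_RInt (fejer n) (INR m) (INR (S m)) (INR n).
Proof.
  induction n as [|n IH].
  - replace (INR 0) with (scal (INR (S m) - INR m) 0)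
      by (unfold scal; simpl; unfold mult; simpl; ring).
    apply (is_RInt_const (V := R_NormedModule)).
  - rewrite (S_INR n). apply (is_RInt_plus (V := R_NormedModule)); [exact IH|].
    apply is_RInt_dirichlet.
Qed.

Lemma sin2_ge (d u : R) : 0 < d -> d <= Rabs u <= 1 / 2 ->
  sin (PI * d) ^ 2 <= sin (PI * u) ^ 2.
Proof.
  intros Hd Hu. pose proof PI_RGT_0.
  assert (E : sin (PI * u) ^ 2 = sin (PI * Rabs u) ^ 2).
  { unfold Rabs. destruct (Rcase_abs u); [|easy].
    replace (PI * - u) with (- (PI * u)) by ring. rewrite sin_neg. ring. }
  rewrite E. apply pow_incr. split.
  - apply sin_ge_0; nra.
  - apply sin_incr_1; nra.
Qed.

(** The error is stated with [cos (PI x)^2] because [fejer n] times this factor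
    is at most [1], whereas its integral over the cell is [n]. *)
Lemma continuous_le_cos2 (f : R -> R) (B eps : R) (m : nat) :
  continuous f (INR m + 1 / 2) ->
  (forall x, INR m <= x <= INR (S m) -> Rabs (f x) <= B) -> 0 < eps ->
  exists K, 0 <= K /\ forall x, INR m <= x <= INR (S m) ->
    Rabs (f x - f (INR m + 1 / 2)) <= eps + K * cos (PI * x) ^ 2.
Proof.
  intros Hf HB He. set (c := INR m + 1 / 2) in *.
  rewrite S_INR in *.
  destruct (proj1 (filterlim_locally _ _) Hf (mkposreal eps He)) as [[d0 Hd0] Hd].
  simpl in Hd.
  set (d := Rmin d0 (1 / 2)).
  assert (Hd' : 0 < d <= 1 / 2 /\ d <= d0).
  { unfold d, Rmin. destruct (Rle_dec d0 (1 / 2)); lra. }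
  pose proof PI_RGT_0.
  assert (Hs : 0 < sin (PI * d)) by (apply sin_gt_0; nra).
  assert (Hs2 : 0 < sin (PI * d) ^ 2) by (apply pow_lt; lra).
  assert (HB0 : 0 <= B).
  { eapply Rle_trans; [apply Rabs_pos|apply (HB c); unfold c; lra]. }
  assert (K0 : 0 <= 2 * B / sin (PI * d) ^ 2).
  { apply Rmult_le_pos; [lra|]. now apply Rlt_le, Rinv_0_lt_compat. }
  (* At distance at least [d] from the centre, [cos (PI x)^2] is at least [sin (PI d)^2], so
     [K cos (PI x)^2] exceeds the trivial bound [2 B]. *)
  exists (2 * B / sin (PI * d) ^ 2). split; [exact K0|].
  intros x Hx.
  destruct (Rlt_le_dec (Rabs (x - c)) d) as [H1|H1].
  - assert (Rabs (f x - f c) < eps) by (apply (Hd x); change (Rabs (x - c) < d0); lra).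
    pose proof (Rmult_le_pos _ _ K0 (pow2_ge_0 (cos (PI * x)))). lra.
  - assert (E : cos (PI * x) ^ 2 = sin (PI * (x - c)) ^ 2).
    { replace (PI * (x - c)) with (- (PI / 2 - PI * x) - INR m * PI)
        by (unfold c; field).
      rewrite sin_minus, sin_neg, cos_neg, sin_shift.
      assert (S0 : sin (INR m * PI) = 0).
      { clear. induction m as [|m IH]; [simpl; now rewrite Rmult_0_l, sin_0|].
        rewrite S_INR, Rmult_plus_distr_r, Rmult_1_l, neg_sin, IH. ring. }
      rewrite S0. pose proof (sin2_cos2 (INR m * PI)) as T.
      rewrite S0 in T. unfold Rsqr in T.
      transitivity (cos (PI * x) ^ 2 * (cos (INR m * PI) * cos (INR m * PI))); [|ring].
      replace (cos (INR m * PI) * cos (INR m * PI)) with 1 by lra. ring. }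
    rewrite E.
    assert (sin (PI * d) ^ 2 <= sin (PI * (x - c)) ^ 2).
    { apply sin2_ge; [lra|]. split; [exact H1|]. apply Rabs_le. unfold c. lra. }
    assert (2 * B <= 2 * B / sin (PI * d) ^ 2 * sin (PI * (x - c)) ^ 2).
    { replace (2 * B) with (2 * B / sin (PI * d) ^ 2 * sin (PI * d) ^ 2) at 1
        by (field; lra).
      now apply Rmult_le_compat_l. }
    pose proof (Rabs_triang (f x) (- f c)) as T. rewrite Rabs_Ropp in T.
    change (f x + - f c) with (f x - f c) in T.
    pose proof (HB x Hx). pose proof (HB c ltac:(unfold c; lra)). lra.
Qed.

(** Against the kernel, the error [eps/2 + K cos^2] integrates to at most [eps/2 * (n+1) + K];
    division by the total mass [n + 1] makes the contribution of [K] vanish in the limit. *)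
Lemma fejer_approximation (f : R -> R) (B : R) (m : nat) :
  (forall x, continuous f x) ->
  (forall x, INR m <= x <= INR (S m) -> Rabs (f x) <= B) ->
  is_lim_seq (fun n => / INR (S n) *
    RInt (fun x => f x * fejer (S n) x) (INR m) (INR (S m))) (f (INR m + 1 / 2)).
Proof.
  intros Hf HB. apply is_lim_seq_spec. intros [eps He].
  change (exists N, forall n, (N <= n)%nat -> Rabs (/ INR (S n) *
    RInt (fun x => f x * fejer (S n) x) (INR m) (INR (S m)) - f (INR m + 1 / 2)) < eps).
  destruct (continuous_le_cos2 f B (eps / 2) m (Hf _) HB ltac:(lra)) as [K [HK0 HK]].
  set (c := f (INR m + 1 / 2)) in *.
  destruct (INR_unbounded (2 * K / eps)) as [N HN]. exists N. intros n Hn.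
  assert (HnN : INR N <= INR (S n)) by (apply le_INR; lia).
  assert (Hpos : 0 < INR (S n)) by (apply lt_0_INR; lia).
  assert (Hm : INR m <= INR (S m)) by (apply le_INR; lia).
  assert (HKn : K < eps / 2 * INR (S n)).
  { apply Rmult_lt_reg_r with (2 / eps); [apply Rdiv_lt_0_compat; lra|].
    replace (eps / 2 * INR (S n) * (2 / eps)) with (INR (S n)) by (field; lra).
    replace (K * (2 / eps)) with (2 * K / eps) by (field; lra). lra. }
  pose proof (is_RInt_fejer (S n) m) as IF.
  assert (Hc : forall x, continuous (fun x => f x * fejer (S n) x) x).
  { intros x. apply (continuous_mult (K := R_AbsRing)); auto using fejer_continuous. }
  pose proof (RInt_correct (V := R_CompleteNormedModule) _ _ _
    (ex_RInt_cont _ (INR m) (INR (S m)) Hc)) as IG.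
  set (I := RInt (fun x => f x * fejer (S n) x) (INR m) (INR (S m))) in *.
  assert (D : Rabs (I - c * INR (S n)) <= eps / 2 * INR (S n) + K).
  { apply (norm_RInt_le (V := R_NormedModule)
      (fun x => minus (f x * fejer (S n) x) (scal c (fejer (S n) x)))
      (fun x => plus (scal (eps / 2) (fejer (S n) x)) K) (INR m) (INR (S m))); auto.
    - intros x Hx.
      change (Rabs (f x * fejer (S n) x - c * fejer (S n) x) <=
        eps / 2 * fejer (S n) x + K).
      rewrite <- Rmult_minus_distr_r, Rabs_mult, (Rabs_pos_eq (fejer _ _))
        by apply fejer_ge_0.
      specialize (HK x Hx). pose proof (fejer_ge_0 (S n) x).
      pose proof (fejer_cos2_bounds (S n) x). nra.
    - apply (is_RInt_minus (V := R_NormedModule)); [exact IG|].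
      apply (is_RInt_scal (V := R_NormedModule)). exact IF.
    - apply (is_RInt_plus (V := R_NormedModule)).
      + apply (is_RInt_scal (V := R_NormedModule)). exact IF.
      + evar_last; [apply (is_RInt_const (V := R_NormedModule))|].
        rewrite S_INR. unfold scal; simpl; unfold mult; simpl. ring. }
  replace (/ INR (S n) * I - c) with (/ INR (S n) * (I - c * INR (S n)))
    by (field; lra).
  rewrite Rabs_mult, (Rabs_pos_eq (/ INR (S n)))
    by (apply Rlt_le, Rinv_0_lt_compat, Hpos).
  apply Rmult_lt_reg_l with (INR (S n)); [exact Hpos|].
  rewrite <- Rmult_assoc, Rinv_r, Rmult_1_l by lra. lra.
Qed.

(** Partial sums of the dual side of Poisson summation. The sign is the value of [cos (2 pi k x)] at
    the half-integers. *)
Fixpoint alt_psum (c : nat -> R) (j : nat) : R :=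
  match j with
  | O => c O
  | S i => alt_psum c i + 2 * (-1) ^ S i * c (S i)
  end.

Section Poisson.
Variables (f : R -> R) (M : R) (c : nat -> R).
Hypothesis Hf : decays f M.
Hypothesis Hc : forall k, is_int_half_line (fun t => f t * cos (2 * PI * INR k * t)) (c k).

Lemma continuous_mult_R (g : R -> R) :
  (forall x, continuous g x) -> forall x, continuous (fun t => f t * g t) x.
Proof. intros Hg x. apply (continuous_mult (K := R_AbsRing)); [apply Hf|apply Hg]. Qed.

Lemma int_half_line_dirichlet (j : nat) :
  is_int_half_line (fun t => f t * dirichlet j t) (alt_psum c j).
Proof.
  induction j as [|j IH].
  - apply int_half_line_ext with (2 := Hc O). intros t. simpl.
    now rewrite Rmult_0_r, Rmult_0_l, cos_0.
  - pose proof (continuous_mult_R _ (dirichlet_continuous j)) as C1.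
    assert (C2 : forall x, continuous (fun t => f t * cos (2 * PI * INR (S j) * t)) x).
    { apply continuous_mult_R. intros x.
      apply (ex_derive_continuous (V := R_NormedModule)). auto_derive. easy. }
    pose proof (int_half_line_lin _ _ 1 (2 * (-1) ^ S j) _ _ C1 C2 IH (Hc (S j))) as G.
    rewrite Rmult_1_l in G. revert G. apply int_half_line_ext. intros t.
    change (dirichlet (S j) t) with
      (dirichlet j t + 2 * (-1) ^ S j * cos (2 * PI * INR (S j) * t)). ring.
Qed.

Lemma int_half_line_fejer (n : nat) :
  is_int_half_line (fun t => f t * fejer n t) (rsum (alt_psum c) n).
Proof.
  induction n as [|n IH].
  - apply is_lim_ext with (fun _ => 0); [|apply is_lim_const].
    intros X. symmetry. apply is_RInt_unique.
    apply (is_RInt_ext (V := R_NormedModule) (fun _ => 0)).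
    + intros x _. unfold fejer. simpl. now rewrite Rmult_0_r.
    + evar_last; [apply (is_RInt_const (V := R_NormedModule))|].
      apply Rmult_0_r.
  - pose proof (continuous_mult_R _ (fejer_continuous n)) as C1.
    pose proof (continuous_mult_R _ (dirichlet_continuous n)) as C2.
    pose proof (int_half_line_lin _ _ 1 1 _ _ C1 C2 IH (int_half_line_dirichlet n)) as G.
    rewrite !Rmult_1_l in G. revert G. apply int_half_line_ext. intros t.
    change (fejer (S n) t) with (fejer n t + dirichlet n t). ring.
Qed.

Let a (n m : nat) : R :=
  / INR (S n) * RInt (fun x => f x * fejer (S n) x) (INR m) (INR (S m)).

Lemma Rabs_f_cell (m : nat) (x : R) :
  INR m <= x <= INR (S m) -> Rabs (f x) <= M * exp (- INR m).
Proof.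
  intros Hx. pose proof (pos_INR m).
  eapply Rle_trans; [apply Hf; lra|].
  apply Rmult_le_compat_l; [eapply decays_bound_pos, Hf|].
  apply exp_le_compat. lra.
Qed.

(** The kernel is nonnegative with mass [n + 1] on each cell, so its average inherits the bound of
    [f] there, uniformly in [n]. *)
Lemma fejer_mean_le (n m : nat) : Rabs (a n m) <= M * exp (- INR m).
Proof.
  assert (Hpos : 0 < INR (S n)) by (apply lt_0_INR; lia).
  unfold a. rewrite Rabs_mult, (Rabs_pos_eq (/ INR (S n)))
    by (apply Rlt_le, Rinv_0_lt_compat, Hpos).
  apply Rmult_le_reg_l with (INR (S n)); [exact Hpos|].
  rewrite <- Rmult_assoc, Rinv_r, Rmult_1_l by lra. rewrite Rmult_comm.
  apply (norm_RInt_le (V := R_NormedModule) (fun x => f x * fejer (S n) x)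
    (fun x => scal (M * exp (- INR m)) (fejer (S n) x)) (INR m) (INR (S m))).
  - apply le_INR; lia.
  - intros x Hx. change (Rabs (f x * fejer (S n) x) <= M * exp (- INR m) * fejer (S n) x).
    rewrite Rabs_mult, (Rabs_pos_eq (fejer _ _)) by apply fejer_ge_0.
    apply Rmult_le_compat_r; [apply fejer_ge_0|now apply Rabs_f_cell].
  - apply (RInt_correct (V := R_CompleteNormedModule)), ex_RInt_cont.
    apply continuous_mult_R, fejer_continuous.
  - apply (is_RInt_scal (V := R_NormedModule)), is_RInt_fejer.
Qed.

(** The cells tile the half-line, so the series is one half-line integral, namely a Cesàro mean of
    [alt_psum c]. *)
Lemma fejer_mean_series (n : nat) :
  cser (fun m => RtoC (a n m)) (RtoC (/ INR (S n) * rsum (alt_psum c) (S n))).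
Proof.
  apply clim_ext with (fun m =>
    RtoC (/ INR (S n) * RInt (fun x => f x * fejer (S n) x) 0 (INR m))).
  - intros m. induction m as [|m IH].
    + replace (INR 0) with 0 by easy.
      rewrite (RInt_point (V := R_CompleteNormedModule)).
      change (zero : R) with 0. rewrite Rmult_0_r. reflexivity.
    + rewrite <- (RInt_Chasles_cont _ 0 (INR m) (INR (S m)))
        by apply continuous_mult_R, fejer_continuous.
      rewrite Rmult_plus_distr_l, RtoC_plus, IH. reflexivity.
  - apply clim_RtoC. apply (is_lim_seq_scal_l _ (/ INR (S n)) (rsum (alt_psum c) (S n))).
    apply (is_lim_comp_seq _ _ p_infty _ (int_half_line_fejer (S n))).
    + exists O. intros m _. discriminate.
    + apply is_lim_seq_INR.
Qed.

Lemma ex_series_exp_neg : ex_series (fun m => M * exp (- INR m)).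
Proof.
  apply ex_series_ext with (fun m => M * exp (- 1) ^ m).
  - intros m. f_equal. induction m as [|m IH]; [simpl; now rewrite Ropp_0, exp_0|].
    rewrite S_INR. replace (- (INR m + 1)) with (- 1 + - INR m) by ring.
    rewrite exp_plus, <- IH. reflexivity.
  - apply ex_series_geom_scal. split; [apply Rlt_le, exp_pos|].
    rewrite <- exp_0. apply exp_increasing. lra.
Qed.

Lemma cesaro_mean (u : nat -> R) (l : R) :
  is_lim_seq u l -> is_lim_seq (fun n => / INR (S n) * rsum u (S n)) l.
Proof.
  intros Hu. apply is_lim_seq_Reals in Hu. apply Cesaro_1 in Hu.
  apply is_lim_seq_Reals in Hu.
  apply (is_lim_seq_incr_1 (fun n => sum_f_R0 u (Init.Nat.pred n) / INR n)) in Hu.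
  revert Hu. apply is_lim_seq_ext. intros n.
  unfold Rdiv. rewrite Rmult_comm. f_equal. simpl Init.Nat.pred.
  induction n as [|n IH]; [simpl; ring|].
  rewrite tech5, IH. reflexivity.
Qed.

(** The Fejér means have two limits to be identified: cell by cell, [tannery] gives the sum over the
    half-integers, while as Cesàro means of a convergent sequence they tend to [s]. *)
Theorem poisson_half_integers (s : R) :
  is_lim_seq (alt_psum c) s -> is_series (fun m => f (INR m + 1 / 2)) s.
Proof.
  intros Hs. apply cser_RtoC.
  assert (Hle : forall m, Cmod (RtoC (f (INR m + 1 / 2))) <= M * exp (- INR m)).
  { intros m. rewrite Cmod_R. apply Rabs_f_cell. rewrite S_INR. lra. }
  destruct (cser_dominated _ _ ex_series_exp_neg Hle) as [S HS].
  replace (RtoC s) with S; [exact HS|].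
  apply clim_unique with (fun n => RtoC (/ INR (Datatypes.S n) * rsum (alt_psum c) (Datatypes.S n))).
  - apply tannery with (a := fun n m => RtoC (a n m)) (l := fun m => RtoC (f (INR m + 1 / 2)))
      (b := fun m => M * exp (- INR m)).
    + apply ex_series_exp_neg.
    + intros n m. rewrite Cmod_R. apply fejer_mean_le.
    + intros m. apply clim_RtoC. apply fejer_approximation with (M * exp (- INR m)).
      * apply Hf.
      * intros x Hx. now apply Rabs_f_cell.
    + apply fejer_mean_series.
    + exact HS.
  - apply clim_RtoC. now apply cesaro_mean.
Qed.

End Poisson.

(** * Transformation of theta series *)

Lemma RtoC_m1 : RtoC (-1) = (- (1))%C.
Proof. unfold RtoC, Copp. simpl. f_equal; ring. Qed.

Lemma Cexp_plus (z w : C) : Cexp (z + w) = (Cexp z * Cexp w)%C.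
Proof.
  unfold Cexp. destruct z as [a b], w as [c d]. simpl.
  rewrite exp_plus, cos_plus, sin_plus.
  unfold Cmult; simpl. f_equal; ring.
Qed.

Lemma Cmod_Cexp (z : C) : Cmod (Cexp z) = exp (Re z).
Proof.
  unfold Cexp, Cmod; simpl.
  replace (_ + _) with (exp (Re z) ^ 2 * (cos (Im z) ^ 2 + sin (Im z) ^ 2)) by ring.
  rewrite <- !Rsqr_pow2, (Rplus_comm (Rsqr (cos _))), sin2_cos2, Rmult_1_r.
  apply sqrt_Rsqr, Rlt_le, exp_pos.
Qed.

(** A relation in place of the closed form [sqrt (pi / A) / 2], which would call for a branch of the
    complex square root. *)
Definition gauss_integral (A L : C) : Prop :=
  is_int_half_line (fun t => Re (Cexp (- A * RtoC (t ^ 2)))) (Re L) /\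
  is_int_half_line (fun t => Im (Cexp (- A * RtoC (t ^ 2)))) (Im L).

Lemma Cexp_gauss (A : C) (x : R) :
  Cexp (- A * RtoC x) = (exp (- Re A * x) * cos (Im A * x),
                         - exp (- Re A * x) * sin (Im A * x)).
Proof.
  destruct A as [p s]. unfold Cexp. simpl.
  replace (- p * x - - s * 0) with (- p * x) by ring.
  replace (- p * 0 + - s * x) with (- (s * x)) by ring.
  rewrite cos_neg, sin_neg. f_equal. ring.
Qed.

Lemma continuous_Cexp_gauss (A : C) (t : R) :
  continuous (fun t => Re (Cexp (- A * RtoC (t ^ 2)))) t /\
  continuous (fun t => Im (Cexp (- A * RtoC (t ^ 2)))) t.
Proof.
  split.
  - apply (continuous_ext (fun t => exp (- Re A * t ^ 2) * cos (Im A * t ^ 2))).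
    { intros x. now rewrite Cexp_gauss. }
    apply gauss_re_continuous.
  - apply (continuous_ext (fun t => - exp (- Re A * t ^ 2) * sin (Im A * t ^ 2))).
    { intros x. now rewrite Cexp_gauss. }
    apply gauss_im_continuous.
Qed.

Lemma Cexp_inv_gauss (A : C) (x : R) : 0 < Re A ->
  let D := Re A ^ 2 + Im A ^ 2 in
  Cexp (RtoC (- x) / A) = (exp (- Re A / D * x) * cos (Im A / D * x),
                           exp (- Re A / D * x) * sin (Im A / D * x)).
Proof.
  destruct A as [p s]. simpl. intros Hp. assert (0 < p * (p * 1) + s * (s * 1)) by nra.
  unfold Cexp. simpl.
  replace (- x * (p / (p * (p * 1) + s * (s * 1))) - 0 * (- s / (p * (p * 1) + s * (s * 1))))
    with (- p / (p * (p * 1) + s * (s * 1)) * x) by (field; lra).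
  replace (- x * (- s / (p * (p * 1) + s * (s * 1))) + 0 * (p / (p * (p * 1) + s * (s * 1))))
    with (s / (p * (p * 1) + s * (s * 1)) * x) by (field; lra).
  easy.
Qed.

Lemma gauss_integral_ex (A : C) : 0 < Re A -> exists L : C, gauss_integral A L /\
  forall w : R,
  is_int_half_line (fun t => Re (Cexp (- A * RtoC (t ^ 2))) * cos (w * t))
    (Re (L * Cexp (RtoC (- (w ^ 2 / 4)) / A))) /\
  is_int_half_line (fun t => Im (Cexp (- A * RtoC (t ^ 2))) * cos (w * t))
    (Im (L * Cexp (RtoC (- (w ^ 2 / 4)) / A))).
Proof.
  intros HA. destruct (gauss_cos_integral (Re A) (Im A) HA) as [l [m H]].
  assert (HD : 0 < Re A ^ 2 + Im A ^ 2) by nra.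
  assert (K : forall w : R,
  is_int_half_line (fun t => Re (Cexp (- A * RtoC (t ^ 2))) * cos (w * t))
    (Re ((l, m) * Cexp (RtoC (- (w ^ 2 / 4)) / A))) /\
  is_int_half_line (fun t => Im (Cexp (- A * RtoC (t ^ 2))) * cos (w * t))
    (Im ((l, m) * Cexp (RtoC (- (w ^ 2 / 4)) / A)))).
  { intros w. destruct (H w) as [H1 H2]. cbv zeta in H1, H2.
    rewrite Cexp_inv_gauss by exact HA. cbv zeta.
    replace (- Re A / (Re A ^ 2 + Im A ^ 2) * (w ^ 2 / 4)) with
      (- Re A / (4 * (Re A ^ 2 + Im A ^ 2)) * w ^ 2) by (field; lra).
    replace (Im A / (Re A ^ 2 + Im A ^ 2) * (w ^ 2 / 4)) with
      (Im A / (4 * (Re A ^ 2 + Im A ^ 2)) * w ^ 2) by (field; lra).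
    split.
    - eapply int_half_line_ext; [|evar_last; [exact H1|]].
      + intros t. cbv beta. rewrite Cexp_gauss. reflexivity.
      + rewrite re_mult. unfold Re, Im, fst, snd. ring.
    - eapply int_half_line_ext; [|evar_last; [exact H2|]].
      + intros t. cbv beta. rewrite Cexp_gauss. reflexivity.
      + rewrite im_mult. unfold Re, Im, fst, snd. ring. }
  exists (l, m). split; [|exact K].
  destruct (K 0) as [K1 K2].
  replace (Cexp (RtoC (- (0 ^ 2 / 4)) / A)) with (RtoC 1) in K1, K2.
  - rewrite Cmult_1_r in K1, K2. split.
    + revert K1. apply int_half_line_ext. intros t. now rewrite Rmult_0_l, cos_0, Rmult_1_r.
    + revert K2. apply int_half_line_ext. intros t. now rewrite Rmult_0_l, cos_0, Rmult_1_r.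
  - rewrite Cexp_inv_gauss by exact HA.
    replace (0 ^ 2 / 4) with 0 by field. rewrite !Rmult_0_r, exp_0, cos_0, sin_0.
    unfold RtoC. f_equal; ring.
Qed.

Lemma gauss_integral_unique (A L L' : C) :
  gauss_integral A L -> gauss_integral A L' -> L = L'.
Proof.
  intros [H1 H2] [K1 K2]. destruct L, L'. f_equal.
  - exact (int_half_line_unique _ _ _ H1 K1).
  - exact (int_half_line_unique _ _ _ H2 K2).
Qed.

(** The real substitution [t = u / sqrt P]. It is the only source of the factor [sqrt P] in the
    theta transformation. *)
Lemma gauss_integral_scale (A L : C) (P : R) :
  0 < P -> gauss_integral A L -> gauss_integral (A / RtoC P) (RtoC (sqrt P) * L).
Proof.
  intros HP [H1 H2].
  assert (Hs : 0 < / sqrt P) by now apply Rinv_0_lt_compat, sqrt_lt_R0.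
  assert (E : forall t, (- A * RtoC ((/ sqrt P * t) ^ 2) = - (A / RtoC P) * RtoC (t ^ 2))%C).
  { intros t. rewrite Rpow_mult_distr, pow_inv, <- Rsqr_pow2, Rsqr_sqrt by lra.
    rewrite RtoC_mult, RtoC_inv by lra. field. intros E0. injection E0. lra. }
  split.
  - replace (Re (RtoC (sqrt P) * L)) with (/ / sqrt P * Re L)
      by (rewrite Rinv_inv; destruct L; simpl; ring).
    apply int_half_line_ext with (fun t => Re (Cexp (- A * RtoC ((/ sqrt P * t) ^ 2)))).
    { intros t. now rewrite E. }
    apply (int_half_line_scale (fun t => Re (Cexp (- A * RtoC (t ^ 2))))); auto.
    intros t. apply (proj1 (continuous_Cexp_gauss A t)).
  - replace (Im (RtoC (sqrt P) * L)) with (/ / sqrt P * Im L)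
      by (rewrite Rinv_inv; destruct L; simpl; ring).
    apply int_half_line_ext with (fun t => Im (Cexp (- A * RtoC ((/ sqrt P * t) ^ 2)))).
    { intros t. now rewrite E. }
    apply (int_half_line_scale (fun t => Im (Cexp (- A * RtoC (t ^ 2))))); auto.
    intros t. apply (proj2 (continuous_Cexp_gauss A t)).
Qed.

Section ThetaPoisson.
Variable A : C.
Hypothesis HA : 0 < Re A.

Let E (u : R) : C := Cexp (RtoC (- (PI ^ 2 * u ^ 2)) / A).

Lemma gauss_term_even (u v : R) : u ^ 2 = v ^ 2 -> E u = E v.
Proof. intros H. unfold E. now rewrite H. Qed.

Lemma Cmod_gauss_term_le : exists M, forall u, Cmod (E u) <= M * exp (- u).
Proof.
  assert (HD : 0 < Re A ^ 2 + Im A ^ 2) by nra.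
  set (k := PI ^ 2 * (Re A / (Re A ^ 2 + Im A ^ 2))).
  assert (Hk : 0 < k).
  { apply Rmult_lt_0_compat; [apply pow_lt, PI_RGT_0|now apply Rdiv_lt_0_compat]. }
  exists (exp (/ (4 * k))). intros u.
  unfold E. rewrite Cmod_Cexp, <- exp_plus. apply exp_le_compat.
  replace (Re (RtoC (- (PI ^ 2 * u ^ 2)) / A)) with (- (k * u ^ 2)).
  - assert (H : 0 <= k * (u - / (2 * k)) ^ 2)
      by (apply Rmult_le_pos; [lra|apply pow2_ge_0]).
    replace (k * (u - / (2 * k)) ^ 2) with (k * u ^ 2 - u + / (4 * k)) in H
      by (field; lra). lra.
  - unfold Cdiv. rewrite re_scal_l. unfold k. destruct A as [p s]. simpl in *.
    field. lra.
Qed.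

Lemma clim_gauss_term (y : R) : clim (fun n => E (INR n + 1 + y)) 0.
Proof.
  destruct Cmod_gauss_term_le as [M HM].
  apply is_lim_seq_squeeze0 with (fun n => M * exp (- (1 + y)) * exp (- INR n)).
  - intros n. split; [apply Cmod_ge_0|].
    replace (E (INR n + 1 + y) - 0)%C with (E (INR n + 1 + y)) by ring.
    rewrite Rmult_assoc, <- exp_plus.
    replace (- (1 + y) + - INR n) with (- (INR n + 1 + y)) by ring. apply HM.
  - apply (ex_series_lim_0 (fun n => M * exp (- (1 + y)) * exp (- INR n))).
    apply ex_series_exp_neg.
Qed.

Variables (L : C) (y : R) (z : C).
Hypothesis Hz : cser (fun i => RtoC ((-1) ^ i) *
  (E (INR i - y) - E (INR i + 1 + y)))%C z.

Let c (k : nat) : C := (L * ((E (INR k + y) + E (INR k - y)) * RtoC (1 / 2)))%C.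

(** [phi] stands for [Re] or [Im]; only real linearity and [Rabs (phi u) <= Cmod u] are used, so one
    argument transfers the real Poisson formula to both parts. *)
Lemma theta_poisson_part (phi : C -> R) :
  (forall u v, phi (u + v)%C = phi u + phi v) ->
  (forall r u, phi (RtoC r * u)%C = r * phi u) ->
  (forall u, Rabs (phi u) <= Cmod u) ->
  (forall t, continuous (fun t => phi (Cexp (- A * RtoC (t ^ 2)))) t) ->
  (forall w : R, is_int_half_line (fun t => phi (Cexp (- A * RtoC (t ^ 2))) * cos (w * t))
    (phi (L * Cexp (RtoC (- (w ^ 2 / 4)) / A))%C)) ->
  is_series (fun m => phi (RtoC (cos (2 * PI * y * (INR m + 1 / 2))) *
    Cexp (- A * RtoC ((INR m + 1 / 2) ^ 2)))%C) (phi (L * z)%C).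
Proof.
  intros Hadd Hscal Hmod Hcont Hint.
  assert (Hamp : forall t, Rabs (phi (Cexp (- A * RtoC (t ^ 2)))) <= exp (- Re A * t ^ 2)).
  { intros t. eapply Rle_trans; [apply Hmod|]. rewrite Cmod_Cexp.
    rewrite re_scal_r, re_opp. apply Rle_refl. }
  destruct (cos_decays (Re A) _ HA Hcont Hamp) as [M HM].
  apply is_series_ext with (fun m => (fun t => phi (Cexp (- A * RtoC (t ^ 2))) *
    cos (2 * PI * y * t)) (INR m + 1 / 2)).
  { intros m. rewrite Hscal. apply Rmult_comm. }
  apply (poisson_half_integers (fun t => phi (Cexp (- A * RtoC (t ^ 2))) *
    cos (2 * PI * y * t)) M (fun k => phi (c k))).
  - apply HM.
  - intros k.
    assert (Cc : forall w, forall t, continuous (fun t =>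
      phi (Cexp (- A * RtoC (t ^ 2))) * cos (w * t)) t).
    { intros w. apply (continuous_amplitude_mult _ Hcont), continuous_cos_lin. }
    pose proof (int_half_line_lin _ _ (1 / 2) (1 / 2) _ _
      (Cc (2 * PI * (INR k + y))) (Cc (2 * PI * (INR k - y)))
      (Hint (2 * PI * (INR k + y))) (Hint (2 * PI * (INR k - y)))) as G.
    assert (EE : forall u, Cexp (RtoC (- ((2 * PI * u) ^ 2 / 4)) / A) = E u).
    { intros u. unfold E. do 3 f_equal. field. }
    rewrite !EE in G.
    replace (phi (c k)) with
      (1 / 2 * phi (L * E (INR k + y))%C + 1 / 2 * phi (L * E (INR k - y))%C).
    + refine (int_half_line_ext _ _ _ _ G). intros t.
      replace (2 * PI * (INR k + y) * t) with (2 * PI * INR k * t + 2 * PI * y * t) by ring.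
      replace (2 * PI * (INR k - y) * t) with (2 * PI * INR k * t - 2 * PI * y * t) by ring.
      rewrite cos_plus, cos_minus. field.
    + unfold c.
      replace (L * ((E (INR k + y) + E (INR k - y)) * RtoC (1 / 2)))%C with
        (RtoC (1 / 2) * (L * E (INR k + y)) + RtoC (1 / 2) * (L * E (INR k - y)))%C by ring.
      now rewrite Hadd, !Hscal.
  - set (u := fun K => (L * (csum (fun i => RtoC ((-1) ^ i) *
      (E (INR i - y) - E (INR i + 1 + y))) (S K) -
      RtoC ((-1) ^ S K) * E (INR K + 1 + y)))%C).
    assert (Hu : clim u (L * z)%C).
    { apply clim_mult; [apply clim_const|].
      replace z with (z + 0)%C by ring. apply clim_plus.
      - apply (clim_subseq _ S) in Hz; [exact Hz|].
        apply filterlim_eventually_le with O. intros n. lia.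
      - pose proof (clim_gauss_term y) as T.
        apply is_lim_seq_ext with (2 := T). intros n.
        replace (E (INR n + 1 + y) - 0)%C with (E (INR n + 1 + y)) by ring.
        replace (- (RtoC ((-1) ^ S n) * E (INR n + 1 + y)) - 0)%C with
          (- (RtoC ((-1) ^ S n) * E (INR n + 1 + y)))%C by ring.
        rewrite Cmod_opp, Cmod_mult, Cmod_R, pow_1_abs. ring. }
    assert (Hphi : is_lim_seq (fun n => phi (u n)) (phi (L * z)%C)).
    { apply clim_RtoC. apply is_lim_seq_squeeze0 with (2 := Hu).
      intros n. split; [apply Cmod_ge_0|].
      rewrite <- RtoC_minus, Cmod_R.
      replace (phi (u n) - phi (L * z)%C) with (phi (u n - L * z)%C); [apply Hmod|].
      replace (u n - L * z)%C with (u n + RtoC (-1) * (L * z))%C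
        by (rewrite RtoC_m1; ring).
      rewrite Hadd, Hscal. ring. }
    revert Hphi. apply is_lim_seq_ext. intros K.
    unfold u. clear u Hu. induction K as [|K IH].
    + simpl alt_psum. f_equal. unfold c. simpl csum.
      change (INR 0) with 0.
      rewrite (gauss_term_even (0 - y) (0 + y)) by ring.
      simpl pow. rewrite Rmult_1_r, RtoC_m1, RtoC_div by lra. field.
    + change (alt_psum (fun k => phi (c k)) (S K)) with
        (alt_psum (fun k => phi (c k)) K + 2 * (-1) ^ S K * phi (c (S K))).
      rewrite <- IH, <- Hscal, <- Hadd. f_equal.
      change (csum ?g (S (S K))) with (csum g (S K) + g (S K))%C.
      unfold c. cbv beta.
      rewrite (S_INR K). rewrite RtoC_div by lra.
      replace ((-1) ^ S (S K)) with (- (-1) ^ S K) by (simpl; ring).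
      rewrite RtoC_opp, RtoC_mult. field.
Qed.

End ThetaPoisson.

Lemma theta_poisson (A L : C) (y : R) (z : C) :
  0 < Re A -> gauss_integral A L ->
  cser (fun i => RtoC ((-1) ^ i) *
    (Cexp (RtoC (- (PI ^ 2 * (INR i - y) ^ 2)) / A) -
     Cexp (RtoC (- (PI ^ 2 * (INR i + 1 + y) ^ 2)) / A)))%C z ->
  cser (fun m => RtoC (cos (2 * PI * y * (INR m + 1 / 2))) *
    Cexp (- A * RtoC ((INR m + 1 / 2) ^ 2)))%C (L * z)%C.
Proof.
  intros HA HL Hz.
  destruct (gauss_integral_ex A HA) as [L' [HL' Hint]].
  rewrite <- (gauss_integral_unique _ _ _ HL HL') in Hint.
  apply cser_Re_Im. split.
  - apply (theta_poisson_part A HA L y z Hz Re).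
    + apply re_plus.
    + apply re_scal_l.
    + apply re_le_Cmod.
    + intros t. apply (proj1 (continuous_Cexp_gauss A t)).
    + intros w. exact (proj1 (Hint w)).
  - apply (theta_poisson_part A HA L y z Hz Im).
    + apply im_plus.
    + apply im_scal_l.
    + apply Rabs_Im_le_Cmod.
    + intros t. apply (proj2 (continuous_Cexp_gauss A t)).
    + intros w. exact (proj2 (Hint w)).
Qed.

(** * Theta series as infinite products *)

Lemma RtoC_neq_0 (x : R) : x <> 0 -> RtoC x <> 0.
Proof. intros H E. injection E. exact H. Qed.

Lemma qpow_plus (tau : C) (x y : R) : qpow tau (x + y) = (qpow tau x * qpow tau y)%C.
Proof.
  unfold qpow. rewrite <- Cexp_plus. f_equal. rewrite RtoC_plus. ring.
Qed.

Lemma qpow_0 (tau : C) : qpow tau 0 = RtoC 1.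
Proof.
  unfold qpow. replace (2 * PI * 0 * Ci * tau)%C with (RtoC 0) by ring.
  unfold Cexp. simpl. rewrite exp_0, cos_0, sin_0. unfold RtoC. f_equal; ring.
Qed.

Lemma qpow_pow (tau : C) (x : R) (n : nat) :
  (qpow tau x ^ n)%C = qpow tau (INR n * x).
Proof.
  induction n as [|n IH].
  - simpl. now rewrite Rmult_0_l, qpow_0.
  - rewrite S_INR. simpl. rewrite IH, <- qpow_plus. f_equal. ring.
Qed.

Lemma qpow_inv_l (tau : C) (x : R) : (qpow tau (- x) * qpow tau x = 1)%C.
Proof. rewrite <- qpow_plus, Rplus_opp_l. apply qpow_0. Qed.

Lemma Cmod_qpow (tau : C) (x : R) :
  Cmod (qpow tau x) = exp (- (2 * PI * x * Im tau)).
Proof.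
  unfold qpow. rewrite Cmod_Cexp. f_equal. destruct tau as [a b]. simpl. ring.
Qed.

Lemma qpow_neq_0 (tau : C) (x : R) : qpow tau x <> 0.
Proof.
  apply Cmod_gt_0. rewrite Cmod_qpow. apply exp_pos.
Qed.

Lemma qpow_half (tau : C) (x : R) : qpow (tau / 2) x = qpow tau (x / 2).
Proof.
  unfold qpow. f_equal. rewrite RtoC_div by lra. field.
Qed.

Lemma INR_tri (i : nat) : INR (tri i) = INR i * (INR i + 1) / 2.
Proof.
  pose proof (f_equal INR (two_tri i)) as H.
  rewrite !mult_INR, plus_INR in H. simpl in H. lra.
Qed.

Lemma Cpow_RtoC_mult (e : R) (c : C) (n : nat) :
  ((RtoC e * c) ^ n = RtoC (e ^ n) * c ^ n)%C.
Proof. now rewrite Cpow_mult_l, RtoC_pow. Qed.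

(** The triple product with [w = e1 q^u] and [p = e2 q^v], where the signs [e1] and [e2] cover every
    product in [h] and [hvee]. The value of [y] completes the square in the exponent, at the price
    of the factor [q^(v y^2 / 2)]. *)
Lemma theta_jtp (tau : C) (u v e1 e2 : R) :
  0 < Im tau -> 0 < v -> e1 * e1 = 1 -> e2 * e2 = 1 ->
  let y := u / v - 1 / 2 in
  cser (fun i => RtoC ((-1) ^ i * e2 ^ tri i * e1 ^ i) *
      (qpow tau (v / 2 * (INR i - y) ^ 2) -
       RtoC e1 * qpow tau (v / 2 * (INR i + 1 + y) ^ 2)))%C
    (qpow tau (v / 2 * y ^ 2) *
     qpochs (RtoC e1 * qpow tau u :: RtoC (e1 * e2) * qpow tau (v - u) ::
       RtoC e2 * qpow tau v :: nil) (RtoC e2 * qpow tau v))%C.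
Proof.
  intros Ht Hv H1 H2 y.
  assert (E1 : e1 <> 0) by (intros ->; lra).
  assert (E2 : e2 <> 0) by (intros ->; lra).
  set (w := (RtoC e1 * qpow tau u)%C). set (p := (RtoC e2 * qpow tau v)%C).
  assert (Hw : w <> 0).
  { apply Cmult_neq_0; [now apply RtoC_neq_0|apply qpow_neq_0]. }
  assert (Hp0 : p <> 0).
  { apply Cmult_neq_0; [now apply RtoC_neq_0|apply qpow_neq_0]. }
  assert (Hp : Cmod p < 1).
  { unfold p. rewrite Cmod_mult, Cmod_R, Cmod_qpow.
    replace (Rabs e2) with 1
      by (destruct (Rmult_integral (e2 - 1) (e2 + 1)) as [K|K];
          [lra| |]; unfold Rabs; destruct (Rcase_abs e2); lra).
    rewrite Rmult_1_l, <- exp_0. apply exp_increasing.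
    assert (0 < 2 * PI * v * Im tau); [|lra].
    pose proof PI_RGT_0.
    apply Rmult_lt_0_compat; [apply Rmult_lt_0_compat|]; lra. }
  assert (Ew : (/ w = RtoC e1 * qpow tau (- u))%C).
  { replace (/ w)%C with (/ w * ((RtoC (e1 * e1)) * (qpow tau (- u) * qpow tau u)))%C
      by (rewrite qpow_inv_l, H1; ring).
    rewrite RtoC_mult.
    transitivity ((/ w * w) * (RtoC e1 * qpow tau (- u)))%C; [unfold w; ring|].
    rewrite Cinv_l by exact Hw. ring. }
  assert (Epw : (p / w = RtoC (e1 * e2) * qpow tau (v - u))%C).
  { unfold Cdiv. rewrite Ew. unfold p.
    replace (v - u) with (v + - u) by ring. rewrite qpow_plus, RtoC_mult. ring. }
  pose proof (jacobi_triple_product p Hp Hp0 w Hw) as J.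
  rewrite Epw in J.
  apply (cser_scal (qpow tau (v / 2 * y ^ 2))) in J.
  revert J. apply cser_ext. intros i.
  replace (- / w)%C with (RtoC (-1) * (RtoC e1 * qpow tau (- u)))%C
    by (rewrite Ew, RtoC_m1; ring).
  replace (- w)%C with (RtoC (-1) * (RtoC e1 * qpow tau u))%C
    by (unfold w; rewrite RtoC_m1; ring).
  unfold p. rewrite !Cpow_RtoC_mult, !qpow_pow, INR_tri, S_INR, !RtoC_mult.
  replace ((-1) ^ S i) with (- (-1) ^ i) by (simpl; ring).
  replace (e1 ^ S i) with (e1 * e1 ^ i) by (simpl; ring).
  rewrite RtoC_opp, RtoC_mult.
  replace (v / 2 * (INR i - y) ^ 2) with
    (v / 2 * y ^ 2 + (INR i * (INR i + 1) / 2 * v + INR i * - u))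
    by (unfold y; field; lra).
  replace (v / 2 * (INR i + 1 + y) ^ 2) with
    (v / 2 * y ^ 2 + (INR i * (INR i + 1) / 2 * v + (INR i + 1) * u))
    by (unfold y; field; lra).
  rewrite !qpow_plus. ring.
Qed.

Lemma Im_neg_inv_double (tau : C) : 0 < Im tau -> 0 < Im (- (1) / (2 * tau))%C.
Proof.
  destruct tau as [a b]. simpl. intros Hb.
  match goal with |- 0 < ?x => replace x with (b / (2 * (a ^ 2 + b ^ 2))) end.
  - apply Rdiv_lt_0_compat; nra.
  - field. nra.
Qed.

Lemma neg_inv_double_involutive (tau : C) : 0 < Im tau ->
  (- (1) / (2 * (- (1) / (2 * tau))))%C = tau.
Proof.
  intros H. assert (tau <> 0) by (intros ->; simpl in H; lra).
  field. assumption.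
Qed.

(** * The inversion tau |-> -1/(2 tau) *)

(** The scale [Im tau] makes the moduli [exp (- pi (2m+1)^2 / 8)] independent of [tau]. The first
    one exceeds the sum of the others, as comparison with a geometric series of ratio
    [exp (- 1) < 1/2] shows. *)
Lemma odd_squares_series_neq_0 (tau : C) :
  0 < Im tau ->
  ~ cser (fun m => qpow tau ((2 * INR m + 1) ^ 2 / (16 * Im tau))) 0.
Proof.
  intros Ht H. set (f := fun m => qpow tau ((2 * INR m + 1) ^ 2 / (16 * Im tau))).
  fold f in H.
  assert (Ef : forall m, Cmod (f m) = exp (- (PI * (2 * INR m + 1) ^ 2 / 8))).
  { intros m. unfold f. rewrite Cmod_qpow. f_equal. field. lra. }
  set (b0 := exp (- (PI / 8))).
  assert (Hb0 : 0 < b0) by apply exp_pos.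
  assert (Hr : 0 < exp (- 1) < 1 / 2).
  { split; [apply exp_pos|].
    replace (exp (- 1)) with (/ exp 1) by (rewrite <- exp_Ropp; f_equal; ring).
    pose proof (exp_ineq1 1 ltac:(lra)).
    unfold Rdiv. rewrite Rmult_1_l. apply Rinv_lt_contravar; lra. }
  assert (B : is_series (fun m => b0 * exp (- 1) ^ m) (b0 * / (1 - exp (- 1)))).
  { apply (is_series_scal_l (K := R_AbsRing) b0 (fun m => exp (- 1) ^ m)).
    apply is_series_geom. rewrite Rabs_pos_eq; lra. }
  assert (Hb : forall m, Cmod (f m) <= b0 * exp (- 1) ^ m).
  { intros m. rewrite Ef.
    replace (exp (- 1) ^ m) with (exp (- INR m)).
    - unfold b0. rewrite <- exp_plus. apply exp_le_compat.
      pose proof PI2_1. pose proof (pos_INR m).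
      assert (K : m = O \/ 1 <= INR m).
      { destruct m; [now left|right]. rewrite S_INR. pose proof (pos_INR m). lra. }
      destruct K as [->|K]; [simpl; lra|]. nra.
    - induction m as [|m IH]; [simpl; now rewrite Ropp_0, exp_0|].
      rewrite S_INR. replace (- (INR m + 1)) with (- 1 + - INR m) by ring.
      rewrite exp_plus, IH. reflexivity. }
  pose proof (cser_tail_le f _ 0 _ 1 B Hb H) as T.
  simpl csum in T.
  replace (0 - (0 + f O))%C with (- f O)%C in T by ring.
  rewrite Cmod_opp, Ef in T. simpl in T.
  replace (- (PI * ((2 * 0 + 1) * ((2 * 0 + 1) * 1)) / 8)) with (- (PI / 8)) in T by field.
  fold b0 in T.
  assert (I : b0 * / (1 - exp (- 1)) < b0 * 2).
  { apply Rmult_lt_compat_l; [exact Hb0|].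
    rewrite <- (Rinv_inv 2). apply Rinv_lt_contravar; [|lra].
    apply Rmult_lt_0_compat; lra. }
  lra.
Qed.

Lemma theta_transform (tau : C) : 0 < Im tau ->
  let tau' := (- (1) / (2 * tau))%C in
  exists c : C, c <> 0 /\ forall (P y : R) (z : C), 0 < P ->
  cser (fun i => RtoC ((-1) ^ i) *
    (qpow tau' (2 * P * (INR i - y) ^ 2) - qpow tau' (2 * P * (INR i + 1 + y) ^ 2)))%C z ->
  cser (fun m => RtoC (cos (PI * y * (2 * INR m + 1))) *
    qpow tau ((2 * INR m + 1) ^ 2 / (16 * P)))%C (RtoC (sqrt P) * c * z)%C.
Proof.
  intros Ht tau'.
  assert (Ht0 : tau <> 0) by (intros ->; simpl in Ht; lra).
  assert (HPI : RtoC PI <> 0) by (apply RtoC_neq_0, PI_neq0).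
  assert (HCi : Ci <> 0) by (intros E; injection E; lra).
  assert (HCi2 : (Ci * Ci = - (1))%C).
  { unfold Ci, Cmult, Copp, RtoC. simpl. f_equal; ring. }
  (* Chosen so that [exp (- (A / P) (m + 1/2)^2)] is [q^((2m+1)^2 / (16 P))], while
     [exp (- pi^2 u^2 P / A)] is [q'^(2 P u^2)]. *)
  set (A := (- Ci * PI * tau / 2)%C).
  assert (HA : 0 < Re A).
  { unfold A. destruct tau as [a b]. simpl in *.
    match goal with |- 0 < ?x => replace x with (PI * b / 2) by field end.
    pose proof PI_RGT_0. nra. }
  destruct (gauss_integral_ex A HA) as [c [Hc _]].
  assert (K : forall (P y : R) (z : C), 0 < P ->
  cser (fun i => RtoC ((-1) ^ i) *
    (qpow tau' (2 * P * (INR i - y) ^ 2) - qpow tau' (2 * P * (INR i + 1 + y) ^ 2)))%C z ->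
  cser (fun m => RtoC (cos (PI * y * (2 * INR m + 1))) *
    qpow tau ((2 * INR m + 1) ^ 2 / (16 * P)))%C (RtoC (sqrt P) * c * z)%C).
  { intros P y z HP Hz.
    assert (HP0 : RtoC P <> 0) by (apply RtoC_neq_0; lra).
    assert (HAP : 0 < Re (A / RtoC P)).
    { unfold Cdiv. rewrite <- RtoC_inv by lra. rewrite re_scal_r.
      apply Rmult_lt_0_compat; [exact HA|now apply Rinv_0_lt_compat]. }
    assert (EQ : forall u : R, qpow tau' (2 * P * u ^ 2) =
      Cexp (RtoC (- (PI ^ 2 * u ^ 2)) / (A / RtoC P))).
    { intros u. unfold qpow, tau', A. f_equal.
      rewrite RtoC_opp, !RtoC_mult, !RtoC_pow.
      transitivity (- (2 * PI * P * u ^ 2) / tau * Ci)%C; [field; exact Ht0|].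
      transitivity (2 * PI * P * u ^ 2 / (tau * Ci))%C.
      - replace (Ci) with (/ Ci * (Ci * Ci))%C at 1 by (field; exact HCi).
        rewrite HCi2. field. now split.
      - field. repeat split; auto. }
    pose proof (theta_poisson (A / RtoC P) _ y z HAP
      (gauss_integral_scale A c P HP Hc)) as T.
    refine (cser_ext _ _ _ _ (T (cser_ext _ _ _ _ Hz))).
    - intros m. f_equal.
      + do 2 f_equal. field.
      + unfold qpow, A. f_equal.
        rewrite !RtoC_div by lra.
        rewrite RtoC_pow, RtoC_plus, RtoC_div by lra.
        rewrite RtoC_pow, RtoC_plus, !RtoC_mult. field. exact HP0.
    - intros i. now rewrite !EQ. }
  exists c. split; [|exact K].
  (* If [c] were 0, the case [P = Im tau], [y = 0] would sum the odd-squares series to 0. The triple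
     product with [v = 2 u] supplies the dual series of that case. *)
  intros ->. apply (odd_squares_series_neq_0 tau Ht).
  pose proof (theta_jtp tau' (2 * Im tau) (4 * Im tau) 1 1 (Im_neg_inv_double tau Ht)
    ltac:(lra) ltac:(lra) ltac:(lra)) as J.
  cbv zeta in J. replace (2 * Im tau / (4 * Im tau) - 1 / 2) with 0 in J by (field; lra).
  match type of J with cser _ ?z0 => specialize (K (Im tau) 0 z0 Ht) end.
  match type of K with _ -> cser _ ?x => replace x with (RtoC 0) in K by ring end.
  refine (cser_ext _ _ _ _ (K (cser_ext _ _ _ _ J))).
  - intros m. rewrite Rmult_0_r, Rmult_0_l, cos_0. ring.
  - intros i.
    rewrite !pow1, !Rmult_1_r.
    replace (4 * Im tau / 2) with (2 * Im tau) by field. ring.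
Qed.

(** * Sorting odd integers by residues; signs and quarter angles *)

Lemma csum_odd_pairs (g : nat -> C) (n : nat) :
  csum g (2 * n + 1) = (csum (fun k => g k + g (2 * n - k)%nat) n + g n)%C.
Proof.
  revert g. induction n as [|n IH]; intros g.
  - simpl. ring.
  - replace (2 * S n + 1)%nat with (S (S (2 * n + 1))) by lia.
    change (csum g (S (S (2 * n + 1)))) with (csum g (S (2 * n + 1)) + g (S (2 * n + 1)))%C.
    rewrite csum_S_l, (IH (fun i => g (S i))), csum_S_l.
    rewrite Nat.sub_0_r. replace (2 * S n)%nat with (S (2 * n + 1)) by lia.
    rewrite (csum_ext (fun k => g (S k) + g (S (2 * n - k)))%C
      (fun i => g (S i) + g (S (2 * n + 1) - S i)%nat)%C).
    + ring.
    + intros i Hi. do 2 f_equal. lia.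
Qed.

(** [f m] stands for a term attached to the odd number [2 m + 1]. Modulo
    [2 (2 n + 1)], the indices [k] and [2 n - k] of a block of length [2 n + 1]
    are the opposite classes of [2 k + 1] and [- (2 k + 1)], and the middle
    index [n] is the class of [2 n + 1]. *)
Lemma cser_residues (n : nat) (f : nat -> C) (g : nat -> nat -> C)
    (theta v : nat -> C) (s : C) :
  cser f s ->
  (forall i, f ((2 * n + 1) * i + n)%nat = 0) ->
  (forall k i, (k < n)%nat ->
    (f ((2 * n + 1) * i + k)%nat + f ((2 * n + 1) * i + (2 * n - k))%nat =
      theta k * g k i)%C) ->
  (forall k, (k < n)%nat -> cser (g k) (v k)) ->
  s = csum (fun k => theta k * v k)%C n.
Proof.
  intros Hf H0 Hg Hv.
  apply (cser_block f (2 * n + 1) s) in Hf; [|lia].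
  apply cser_unique with (1 := Hf).
  apply cser_ext with (fun i => csum (fun k => theta k * g k i)%C n).
  - intros i. rewrite csum_odd_pairs, H0, Cplus_0_r.
    apply csum_ext. intros k Hk. now rewrite Hg.
  - apply (cser_csum (fun k i => theta k * g k i)%C). intros k Hk.
    now apply cser_scal, Hv.
Qed.

(** Congruence modulo 2 with explicit witnesses: sign identities become equations between natural
    numbers, fit for [lia] and [nia]. *)
Lemma pow_m1_eq (a b x y : nat) :
  (a + 2 * x = b + 2 * y)%nat -> (-1) ^ a = (-1) ^ b.
Proof.
  intros H. pose proof (f_equal (pow (-1)) H) as E.
  rewrite !pow_add, !pow_1_even, !Rmult_1_r in E. exact E.
Qed.

Lemma pow_m1_opp (a b x y : nat) :
  (a + 2 * x = b + 1 + 2 * y)%nat -> (-1) ^ a = - (-1) ^ b.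
Proof.
  intros H. rewrite (pow_m1_eq a (b + 1) x y H), pow_add. ring.
Qed.

Lemma cos_plus_nat_PI (n : nat) (x : R) : cos (x + INR n * PI) = (-1) ^ n * cos x.
Proof.
  induction n as [|n IH].
  - simpl. rewrite Rmult_0_l, Rplus_0_r. ring.
  - rewrite S_INR. replace (x + (INR n + 1) * PI) with ((x + INR n * PI) + PI) by ring.
    rewrite neg_cos, IH. simpl. ring.
Qed.

Lemma cos_odd_quarter_PI (m : nat) :
  sqrt 2 * cos (PI / 4 * (2 * INR m + 1)) = (-1) ^ tri m.
Proof.
  assert (H2 : sqrt 2 <> 0) by (apply Rgt_not_eq, Rlt_sqrt2_0).
  (* Raising [m] by 1 rotates the angle by [PI / 2] and exchanges cosine and sine, so the induction
     has to carry both. *)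
  enough (sqrt 2 * cos (PI / 4 * (2 * INR m + 1)) = (-1) ^ tri m /\
    sqrt 2 * sin (PI / 4 * (2 * INR m + 1)) = (-1) ^ (tri m + m)) by tauto.
  induction m as [|m [IH1 IH2]].
  - simpl INR. replace (PI / 4 * (2 * 0 + 1)) with (PI / 4) by field.
    rewrite cos_PI4, sin_PI4. simpl. split; field; exact H2.
  - rewrite S_INR.
    replace (PI / 4 * (2 * (INR m + 1) + 1)) with (PI / 2 + PI / 4 * (2 * INR m + 1)) by field.
    rewrite cos_plus, sin_plus, cos_PI2, sin_PI2, !Rmult_0_l, !Rmult_1_l.
    unfold Rminus. rewrite Rplus_0_l, Rplus_0_r, IH1, <- Ropp_mult_distr_r, IH2.
    simpl tri. split.
    + symmetry. apply (pow_m1_opp _ _ 0 0). lia.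
    + apply (pow_m1_eq _ _ (S m) 0). lia.
Qed.

(** * Numerators and denominators *)

(** Isolates the conclusion of [theta_transform] for a fixed [c], so that numerators and
    denominators share the same constant. *)
Definition transforms (tau c : C) : Prop :=
  let tau' := (- (1) / (2 * tau))%C in
  forall (P y : R) (z : C), 0 < P ->
  cser (fun i => RtoC ((-1) ^ i) *
    (qpow tau' (2 * P * (INR i - y) ^ 2) - qpow tau' (2 * P * (INR i + 1 + y) ^ 2)))%C z ->
  cser (fun m => RtoC (cos (PI * y * (2 * INR m + 1))) *
    qpow tau ((2 * INR m + 1) ^ 2 / (16 * P)))%C (RtoC (sqrt P) * c * z)%C.

Section Numerators.
Variables n j : nat.
Let N : R := 2 * INR n + 1.
(** Here [j] counts from 0, so [2 j + 1] is the [2j - 1] of the theorem; with this [y],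
    [PI * y * (2 k + 1)] is [- angle k]. *)
Let y : R := - (2 * INR j + 1) / (2 * N).

Definition angle (k : nat) : R :=
  (2 * INR j + 1) * (2 * INR k + 1) * PI / (2 * (2 * INR n + 1)).

Lemma modulus_pos : 0 < N.
Proof. unfold N. pose proof (pos_INR n). lra. Qed.

Lemma cos_residue_low (k i : nat) :
  cos (PI * y * (2 * INR ((2 * n + 1) * i + k) + 1)) = (-1) ^ i * cos (angle k).
Proof.
  pose proof modulus_pos.
  replace (PI * y * (2 * INR ((2 * n + 1) * i + k) + 1)) with
    (- (angle k + INR ((2 * j + 1) * i) * PI)).
  - rewrite cos_neg, cos_plus_nat_PI. f_equal. apply (pow_m1_eq _ _ 0 (j * i)). nia.
  - unfold angle, y. fold N. rewrite !plus_INR, !mult_INR, !plus_INR, !mult_INR.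
    change (INR 2) with 2. change (INR 1) with 1. fold N. field. lra.
Qed.

(** The odd number at this index is [2 N (i + 1) - (2 k + 1)]; the shift by [i + 1] in place of [i]
    produces the extra minus sign. *)
Lemma cos_residue_high (k i : nat) : (k < n)%nat ->
  cos (PI * y * (2 * INR ((2 * n + 1) * i + (2 * n - k)) + 1)) =
  - (-1) ^ i * cos (angle k).
Proof.
  intros Hk. pose proof modulus_pos.
  replace (PI * y * (2 * INR ((2 * n + 1) * i + (2 * n - k)) + 1)) with
    (- (- angle k + INR ((2 * j + 1) * (i + 1)) * PI)).
  - rewrite cos_neg, cos_plus_nat_PI, cos_neg. f_equal.
    apply (pow_m1_opp _ _ 0 (j * (i + 1))). nia.
  - unfold angle, y. fold N. rewrite !plus_INR, minus_INR, !mult_INR, !plus_INR, !mult_INR by lia.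
    change (INR 2) with 2. change (INR 1) with 1.
    replace (2 * INR n) with (N - 1) by (unfold N; ring). field. lra.
Qed.

Lemma cos_residue_mid (i : nat) :
  cos (PI * y * (2 * INR ((2 * n + 1) * i + n) + 1)) = 0.
Proof.
  pose proof modulus_pos.
  replace (PI * y * (2 * INR ((2 * n + 1) * i + n) + 1)) with
    (- (PI / 2 + INR ((2 * j + 1) * i + j) * PI)).
  - rewrite cos_neg, cos_plus_nat_PI, cos_PI2. ring.
  - unfold y. rewrite !plus_INR, !mult_INR, !plus_INR, !mult_INR.
    change (INR 2) with 2. change (INR 1) with 1.
    replace (INR n) with ((N - 1) / 2) by (unfold N; field). field. lra.
Qed.

Variables tau c : C.
Hypothesis Htr : transforms tau c.
Let tau' : C := (- (1) / (2 * tau))%C.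
Let yk (k : nat) : R := - (2 * INR k + 1) / (2 * N).

Lemma square_residue_low (k i : nat) :
  (2 * INR ((2 * n + 1) * i + k) + 1) ^ 2 / (16 * N) = N / 4 * (INR i - yk k) ^ 2.
Proof.
  pose proof modulus_pos. unfold yk. rewrite !plus_INR, !mult_INR, !plus_INR, !mult_INR.
  change (INR 2) with 2. change (INR 1) with 1. fold N. field. lra.
Qed.

Lemma square_residue_high (k i : nat) : (k < n)%nat ->
  (2 * INR ((2 * n + 1) * i + (2 * n - k)) + 1) ^ 2 / (16 * N) =
  N / 4 * (INR i + 1 + yk k) ^ 2.
Proof.
  intros Hk. pose proof modulus_pos. unfold yk.
  rewrite !plus_INR, minus_INR, !mult_INR, !plus_INR, !mult_INR by lia.
  change (INR 2) with 2. change (INR 1) with 1.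
  replace (2 * INR n) with (N - 1) by (unfold N; ring). field. lra.
Qed.

Lemma first_numerator (z : C) (v : nat -> C) :
  cser (fun i => RtoC ((-1) ^ i) *
    (qpow tau' (2 * N * (INR i - y) ^ 2) - qpow tau' (2 * N * (INR i + 1 + y) ^ 2)))%C z ->
  (forall k, (k < n)%nat -> cser (fun i => RtoC ((-1) ^ i) *
    (qpow tau (N / 4 * (INR i - yk k) ^ 2) -
     qpow tau (N / 4 * (INR i + 1 + yk k) ^ 2)))%C (v k)) ->
  (RtoC (sqrt N) * c * z = csum (fun k => RtoC (cos (angle k)) * v k) n)%C.
Proof.
  intros Hz Hv. apply (Htr N y z modulus_pos) in Hz.
  refine (cser_residues n _ _ (fun k => RtoC (cos (angle k))) v _ Hz _ _ Hv).
  - intros i. rewrite cos_residue_mid. ring.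
  - intros k i Hk. cbv beta.
    rewrite cos_residue_low, cos_residue_high, square_residue_low,
      square_residue_high by exact Hk.
    rewrite !RtoC_mult, RtoC_opp. ring.
Qed.

Variable s : nat.
Hypothesis Hs : n = (2 * s)%nat.

(** Evenness of [n] gives [2 n + 1 = 1] modulo 4. The parity of [tri] depends only on its argument
    modulo 4, so the sign is that of [tri (i + k) = tri i + tri k + i k]. *)
Lemma tri_residue_low (k i : nat) :
  (-1) ^ tri ((2 * n + 1) * i + k) = (-1) ^ tri k * ((-1) ^ tri i * ((-1) ^ k) ^ i).
Proof.
  rewrite <- pow_mult, <- !pow_add.
  apply (pow_m1_eq _ _ 0 (s * i * (4 * s * i + 1) + 2 * s * i * i + 2 * s * i * k)).
  pose proof (two_tri ((2 * n + 1) * i + k)). pose proof (two_tri i).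
  pose proof (two_tri k). subst n. nia.
Qed.

(** The two indices differ by [2 d] with [d = n - k], and [tri (2 d) = d (2 d + 1)] has the parity
    of [d], hence of [k], as [n] is even. *)
Lemma tri_residue_high (k i : nat) : (k < n)%nat ->
  (-1) ^ tri ((2 * n + 1) * i + (2 * n - k)) =
  (-1) ^ k * (-1) ^ tri ((2 * n + 1) * i + k).
Proof.
  intros Hk. rewrite <- pow_add.
  set (m := ((2 * n + 1) * i + k)%nat). set (d := (n - k)%nat).
  replace ((2 * n + 1) * i + (2 * n - k))%nat with (m + 2 * d)%nat by (unfold m, d; lia).
  rewrite tri_add. pose proof (two_tri (2 * d)).
  apply (pow_m1_eq _ _ k (s + d * d + d * m)).
  assert (d + k = 2 * s)%nat by (unfold d; lia). nia.
Qed.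

(** The shifts by [1/4] combine through [cos (a + b) + cos (a - b) = 2 cos a cos b]. In residue [k]
    the resulting sign splits into the constant [(-1)^tri k] and the signs of a triple product with
    [e2 = -1] and [e1 = (-1)^k]. *)
Lemma second_numerator (z1 z2 : C) (v : nat -> C) :
  let y1 := y + 1 / 4 in let y2 := y - 1 / 4 in
  cser (fun i => RtoC ((-1) ^ i) *
    (qpow tau' (2 * N * (INR i - y1) ^ 2) - qpow tau' (2 * N * (INR i + 1 + y1) ^ 2)))%C z1 ->
  cser (fun i => RtoC ((-1) ^ i) *
    (qpow tau' (2 * N * (INR i - y2) ^ 2) - qpow tau' (2 * N * (INR i + 1 + y2) ^ 2)))%C z2 ->
  (forall k, (k < n)%nat ->
    cser (fun i => RtoC ((-1) ^ i * (-1) ^ tri i * ((-1) ^ k) ^ i) *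
      (qpow tau (N / 4 * (INR i - yk k) ^ 2) -
       RtoC ((-1) ^ k) * qpow tau (N / 4 * (INR i + 1 + yk k) ^ 2)))%C (v k)) ->
  (RtoC (sqrt N) * c * (z1 + z2) =
   RtoC (sqrt 2) * csum (fun k => RtoC (cos (angle k)) * (RtoC ((-1) ^ tri k) * v k)) n)%C.
Proof.
  intros y1 y2 Hz1 Hz2 Hv.
  apply (Htr N y1 z1 modulus_pos) in Hz1. apply (Htr N y2 z2 modulus_pos) in Hz2.
  pose proof (cser_plus _ _ _ _ Hz1 Hz2) as H.
  replace (RtoC (sqrt N) * c * z1 + RtoC (sqrt N) * c * z2)%C with
    (RtoC (sqrt N) * c * (z1 + z2))%C in H by ring.
  rewrite <- csum_scal.
  rewrite (csum_ext _ (fun k => (RtoC (sqrt 2 * cos (angle k))) * (RtoC ((-1) ^ tri k) * v k))%C)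
    by (intros; rewrite RtoC_mult; ring).
  assert (E : forall m : nat,
    (RtoC (cos (PI * y1 * (2 * INR m + 1))) * qpow tau ((2 * INR m + 1) ^ 2 / (16 * N)) +
     RtoC (cos (PI * y2 * (2 * INR m + 1))) * qpow tau ((2 * INR m + 1) ^ 2 / (16 * N)) =
     RtoC (sqrt 2 * (-1) ^ tri m * cos (PI * y * (2 * INR m + 1))) *
       qpow tau ((2 * INR m + 1) ^ 2 / (16 * N)))%C).
  { intros m. rewrite <- Cmult_plus_distr_r, <- RtoC_plus. do 2 f_equal.
    rewrite <- cos_odd_quarter_PI.
    replace (PI * y1 * (2 * INR m + 1)) with
      (PI * y * (2 * INR m + 1) + PI / 4 * (2 * INR m + 1)) by (unfold y1; field).
    replace (PI * y2 * (2 * INR m + 1)) with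
      (PI * y * (2 * INR m + 1) - PI / 4 * (2 * INR m + 1)) by (unfold y2; field).
    rewrite cos_plus, cos_minus, <- Rmult_assoc, sqrt_sqrt by lra. ring. }
  apply (cser_ext _ _ _ E) in H.
  apply (cser_residues n _ (fun k i => RtoC ((-1) ^ tri k) *
    (RtoC ((-1) ^ i * (-1) ^ tri i * ((-1) ^ k) ^ i) *
      (qpow tau (N / 4 * (INR i - yk k) ^ 2) -
       RtoC ((-1) ^ k) * qpow tau (N / 4 * (INR i + 1 + yk k) ^ 2))))%C
    (fun k => RtoC (sqrt 2 * cos (angle k)))
    (fun k => RtoC ((-1) ^ tri k) * v k)%C _ H).
  - intros i. rewrite cos_residue_mid, Rmult_0_r. ring.
  - intros k i Hk.
    rewrite tri_residue_high, tri_residue_low, cos_residue_low, cos_residue_high,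
      square_residue_low, square_residue_high by exact Hk.
    rewrite !RtoC_mult, RtoC_opp. ring.
  - intros k Hk. now apply cser_scal, Hv.
Qed.

End Numerators.

(** At [P = 1], [y = - 1/4] the cosines are [(-1)^tri m / sqrt 2]. The odd numbers [4 i + 1] and
    [4 i + 3] carry opposite signs and give the two squares of the index [i]. *)
Lemma first_denominator (tau c z v : C) :
  let tau' := (- (1) / (2 * tau))%C in
  transforms tau c ->
  cser (fun i => RtoC ((-1) ^ i) *
    (qpow tau' (2 * (INR i - - 1 / 4) ^ 2) - qpow tau' (2 * (INR i + 1 + - 1 / 4) ^ 2)))%C z ->
  cser (fun i => RtoC ((-1) ^ i) *
    (qpow tau ((INR i - - 1 / 4) ^ 2) - qpow tau ((INR i + 1 + - 1 / 4) ^ 2)))%C v ->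
  (RtoC (sqrt 2) * (c * z) = v)%C.
Proof.
  intros tau' Htr Hz Hv.
  assert (H := Htr 1 (- 1 / 4) z Rlt_0_1). rewrite Rmult_1_r, sqrt_1 in H.
  apply H in Hz. apply (cser_scal (RtoC (sqrt 2))) in Hz. rewrite Cmult_1_l in Hz.
  apply (cser_block _ 2) in Hz; [|lia].
  apply cser_unique with (1 := Hz). revert Hv. apply cser_ext. intros i.
  assert (E : forall m, (RtoC (sqrt 2) * (RtoC (cos (PI * (- 1 / 4) * (2 * INR m + 1))) *
    qpow tau ((2 * INR m + 1) ^ 2 / (16 * 1))) =
    RtoC ((-1) ^ tri m) * qpow tau ((2 * INR m + 1) ^ 2 / 16))%C).
  { intros m. rewrite <- cos_odd_quarter_PI, RtoC_mult, Rmult_1_r.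
    replace (PI * (- 1 / 4) * (2 * INR m + 1)) with (- (PI / 4 * (2 * INR m + 1))) by field.
    rewrite cos_neg. ring. }
  simpl csum. rewrite !E.
  rewrite (pow_m1_eq (tri (i + (i + 0) + 0)) i 0 (i * i)),
    (pow_m1_opp (tri (i + (i + 0) + 1)) i 0 (i * i + i)).
  - replace ((2 * INR (i + (i + 0) + 0) + 1) ^ 2 / 16) with ((INR i - - 1 / 4) ^ 2)
      by (rewrite !plus_INR; simpl; field).
    replace ((2 * INR (i + (i + 0) + 1) + 1) ^ 2 / 16) with ((INR i + 1 + - 1 / 4) ^ 2)
      by (rewrite !plus_INR; simpl; field).
    rewrite RtoC_opp. ring.
  - pose proof (two_tri (i + (i + 0) + 1)). nia.
  - pose proof (two_tri (i + (i + 0) + 0)). nia.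
Qed.

(** At [y = 0] all cosines are 1, so no [sqrt 2] appears and the folded series has plus signs: the
    products in [- q] of [den3]. *)
Lemma second_denominator (tau c z v : C) :
  let tau' := (- (1) / (2 * tau))%C in
  transforms tau c ->
  cser (fun i => RtoC ((-1) ^ i) *
    (qpow tau' (2 * (INR i - 0) ^ 2) - qpow tau' (2 * (INR i + 1 + 0) ^ 2)))%C z ->
  cser (fun i =>
    (qpow tau ((INR i - - 1 / 4) ^ 2) + qpow tau ((INR i + 1 + - 1 / 4) ^ 2)))%C v ->
  (c * z = v)%C.
Proof.
  intros tau' Htr Hz Hv.
  assert (H := Htr 1 0 z Rlt_0_1). rewrite Rmult_1_r, sqrt_1 in H.
  apply H in Hz. rewrite Cmult_1_l in Hz.
  apply (cser_block _ 2) in Hz; [|lia].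
  apply cser_unique with (1 := Hz). revert Hv. apply cser_ext. intros i.
  cbn [csum].
  replace ((2 * INR (2 * i + 0) + 1) ^ 2 / (16 * 1)) with ((INR i - - 1 / 4) ^ 2)
      by (rewrite plus_INR, mult_INR; simpl; field).
  replace ((2 * INR (2 * i + 1) + 1) ^ 2 / (16 * 1)) with ((INR i + 1 + - 1 / 4) ^ 2)
      by (rewrite plus_INR, mult_INR; simpl; field).
  rewrite Rmult_0_r, !Rmult_0_l, cos_0. ring.
Qed.

(** * The quotients [h] and [hvee] in terms of theta series *)

Definition den1 (tau : C) : C :=
  let q := qpow tau in
  (q (1 / 8)%R * qpochs (q 1%R :: q 3%R :: q 4%R :: nil) (q 4%R))%C.

(** The completing factor is [q^(2 y^2)]: it is 1 here, where [y = 0], and [q^(1/8)] in [den1] and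
    [den3], where [y = - 1/4]. *)
Definition den2 (tau : C) : C :=
  let q := qpow tau in qpochs (q 2%R :: q 2%R :: q 4%R :: nil) (q 4%R).

Definition den3 (tau : C) : C :=
  let q := qpow tau in
  (q (1 / 8)%R * qpochs (- q 1%R :: - q 3%R :: q 4%R :: nil) (q 4%R))%C.

Lemma theta_jtp_plus (tau : C) (v y : R) : 0 < Im tau -> 0 < v ->
  let u := v * (y + 1 / 2) in
  cser (fun i => RtoC ((-1) ^ i) * (qpow tau (v / 2 * (INR i - y) ^ 2) -
       qpow tau (v / 2 * (INR i + 1 + y) ^ 2)))%C
    (qpow tau (v / 2 * y ^ 2) *
     qpochs (qpow tau u :: qpow tau (v - u) :: qpow tau v :: nil) (qpow tau v))%C.
Proof.
  intros Ht Hv u.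
  pose proof (theta_jtp tau u v 1 1 Ht Hv ltac:(ring) ltac:(ring)) as H. cbv zeta in H.
  replace (u / v - 1 / 2) with y in H by (unfold u; field; lra).
  rewrite Rmult_1_r, !Cmult_1_l in H.
  revert H. apply cser_ext. intros i. rewrite !pow1, !Rmult_1_r. now rewrite Cmult_1_l.
Qed.

Lemma den1_series (tau : C) : 0 < Im tau ->
  cser (fun i => RtoC ((-1) ^ i) * (qpow tau (2 * (INR i - - 1 / 4) ^ 2) -
       qpow tau (2 * (INR i + 1 + - 1 / 4) ^ 2)))%C (den1 tau).
Proof.
  intros Ht. pose proof (theta_jtp_plus tau 4 (- 1 / 4) Ht ltac:(lra)) as H.
  cbv zeta in H.
  replace (4 / 2) with 2 in H by field.
  replace (2 * (- 1 / 4) ^ 2) with (1 / 8) in H by field.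
  replace (4 * (- 1 / 4 + 1 / 2)) with 1 in H by field.
  replace (4 - 1) with 3 in H by ring. exact H.
Qed.

Lemma den2_series (tau : C) : 0 < Im tau ->
  cser (fun i => RtoC ((-1) ^ i) * (qpow tau (2 * (INR i - 0) ^ 2) -
       qpow tau (2 * (INR i + 1 + 0) ^ 2)))%C (den2 tau).
Proof.
  intros Ht. pose proof (theta_jtp_plus tau 4 0 Ht ltac:(lra)) as H.
  cbv zeta in H.
  replace (4 / 2) with 2 in H by field.
  replace (2 * 0 ^ 2) with 0 in H by ring.
  replace (4 * (0 + 1 / 2)) with 2 in H by field.
  replace (4 - 2) with 2 in H by ring.
  rewrite qpow_0, Cmult_1_l in H. exact H.
Qed.

Lemma den3_series (tau : C) : 0 < Im tau ->
  cser (fun i => qpow tau (2 * (INR i - - 1 / 4) ^ 2) +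
       qpow tau (2 * (INR i + 1 + - 1 / 4) ^ 2))%C (den3 tau).
Proof.
  intros Ht. pose proof (theta_jtp tau 1 4 (-1) 1 Ht ltac:(lra) ltac:(ring) ltac:(ring)) as H.
  cbv zeta in H.
  replace (4 / 2) with 2 in H by field.
  replace (1 / 4 - 1 / 2) with (- 1 / 4) in H by field.
  replace (2 * (- 1 / 4) ^ 2) with (1 / 8) in H by field.
  replace (4 - 1) with 3 in H by ring.
  rewrite Rmult_1_r, RtoC_m1, !Cmult_1_l in H. unfold den3. cbv zeta.
  replace (- qpow tau 1)%C with (- (1) * qpow tau 1)%C by ring.
  replace (- qpow tau 3)%C with (- (1) * qpow tau 3)%C by ring.
  revert H. apply cser_ext. intros i.
  rewrite pow1, Rmult_1_r, <- Rpow_mult_distr.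
  replace (-1 * -1) with 1 by ring. rewrite pow1. ring.
Qed.

Lemma qpow_inv (tau : C) (x : R) : (/ qpow tau x = qpow tau (- x))%C.
Proof.
  replace (/ qpow tau x)%C with (/ qpow tau x * (qpow tau (- x) * qpow tau x))%C
    by (rewrite qpow_inv_l; ring).
  field. apply qpow_neq_0.
Qed.

(** The case [v = 0] holds by the convention [/ 0 = 0], so infinite products in denominators are
    handled as formal inverses. *)
Lemma Cinv_scal (k v : C) : k <> 0 -> (/ (k * v) = / k * / v)%C.
Proof.
  intros Hk. destruct (Ceq_dec v 0) as [->|Hv]; [|now field].
  assert (E : (/ 0 = 0)%C) by (unfold Cinv, RtoC, Rdiv; simpl; f_equal; ring).
  rewrite Cmult_0_r, E. ring.
Qed.

Section Level.
Variable r : nat.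
Hypothesis hr : (2 <= r)%nat.
Let n : nat := (2 * r - 2)%nat.
Let N : R := 2 * INR n + 1.

Lemma INR_size : INR n = 2 * INR r - 2.
Proof. unfold n. rewrite minus_INR, mult_INR by lia. reflexivity. Qed.

Lemma modulus_eq : N = 4 * INR r - 3.
Proof. unfold N. rewrite INR_size. ring. Qed.

Lemma modulus_ge_1 : 1 <= N.
Proof. unfold N. pose proof (pos_INR n). lra. Qed.

Let yk (k : nat) : R := - (2 * INR k + 1) / (2 * N).

Lemma h_theta (j : nat) (tau : C) : 0 < Im tau ->
  exists z za zb : C,
  cser (fun i => RtoC ((-1) ^ i) * (qpow tau (2 * N * (INR i - yk j) ^ 2) -
    qpow tau (2 * N * (INR i + 1 + yk j) ^ 2)))%C z /\
  cser (fun i => RtoC ((-1) ^ i) * (qpow tau (2 * N * (INR i - (yk j + 1 / 4)) ^ 2) -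
    qpow tau (2 * N * (INR i + 1 + (yk j + 1 / 4)) ^ 2)))%C za /\
  cser (fun i => RtoC ((-1) ^ i) * (qpow tau (2 * N * (INR i - (yk j - 1 / 4)) ^ 2) -
    qpow tau (2 * N * (INR i + 1 + (yk j - 1 / 4)) ^ 2)))%C zb /\
  h r (S j) tau = (z / den1 tau + (za + zb) / den2 tau)%C.
Proof.
  intros Ht. pose proof modulus_ge_1 as HN. pose proof modulus_eq as EN.
  pose proof (theta_jtp_plus tau (4 * N) (yk j) Ht ltac:(lra)) as H.
  pose proof (theta_jtp_plus tau (4 * N) (yk j + 1 / 4) Ht ltac:(lra)) as Ha.
  pose proof (theta_jtp_plus tau (4 * N) (yk j - 1 / 4) Ht ltac:(lra)) as Hb.
  cbv zeta in H, Ha, Hb.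
  replace (4 * N / 2) with (2 * N) in H, Ha, Hb by field.
  eexists. eexists. eexists.
  split; [exact H|]. split; [exact Ha|]. split; [exact Hb|].
  match type of Ha with cser _ ?x => set (za := x) in * end.
  match type of Hb with cser _ ?x => set (zb := x) in * end.
  (* The second numerator has scale [N / 2]; since [N/2 (2 i - Y)^2 = 2 N (i - Y/2)^2], its even
     indices return to the scale [2 N] with shift [yk j + 1/4], and its odd indices with shift
     [yk j - 1/4]. *)
  set (Y := 2 * (yk j + 1 / 4)).
  pose proof (theta_jtp tau (N * (Y + 1 / 2)) N 1 (-1) Ht ltac:(lra) ltac:(ring) ltac:(ring)) as Hc.
  cbv zeta in Hc.
  replace (N * (Y + 1 / 2) / N - 1 / 2) with Y in Hc by (field; lra).
  match type of Hc with cser _ ?x => assert (Ec : x = (za + zb)%C) end.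
  (* The pairing crosses over: in an index [2 i] the first square belongs to [za] and the second to
     [zb], in [2 i + 1] conversely. Blocks of two therefore match the sum, not the separate
     series. *)
  { apply (cser_block _ 2) in Hc; [|lia].
    apply cser_unique with (1 := Hc).
    pose proof (cser_plus _ _ _ _ Ha Hb) as Hab. revert Hab. apply cser_ext. intros i.
    cbn [csum]. rewrite !pow1, !Rmult_1_r.
    rewrite <- !pow_add.
    rewrite (pow_m1_eq (2 * i + 0 + tri (2 * i + 0)) i 0 (i * i + i)),
      (pow_m1_eq (2 * i + 1 + tri (2 * i + 1)) i 0 (i * i + 2 * i + 1)).
    - replace (N / 2 * (INR (2 * i + 0) - Y) ^ 2) with
        (2 * N * (INR i - (yk j + 1 / 4)) ^ 2)
        by (unfold Y; rewrite plus_INR, mult_INR; simpl; field).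
      replace (N / 2 * (INR (2 * i + 1) - Y) ^ 2) with
        (2 * N * (INR i - (yk j - 1 / 4)) ^ 2)
        by (unfold Y; rewrite plus_INR, mult_INR; simpl; field).
      replace (N / 2 * (INR (2 * i + 0) + 1 + Y) ^ 2) with
        (2 * N * (INR i + 1 + (yk j - 1 / 4)) ^ 2)
        by (unfold Y; rewrite plus_INR, mult_INR; simpl; field).
      replace (N / 2 * (INR (2 * i + 1) + 1 + Y) ^ 2) with
        (2 * N * (INR i + 1 + (yk j + 1 / 4)) ^ 2)
        by (unfold Y; rewrite plus_INR, mult_INR; simpl; field).
      ring.
    - pose proof (two_tri (2 * i + 1)). nia.
    - pose proof (two_tri (2 * i + 0)). nia. }
  rewrite <- Ec. clear Ec Hc Ha Hb za zb H.
  unfold h, den1, den2. cbv zeta. rewrite S_INR.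
  assert (EY : N * (Y + 1 / 2) = 2 * (2 * INR r - (INR j + 1) - 1))
    by (unfold Y, yk; rewrite EN in *; field; lra).
  rewrite EY.
  replace (N - 2 * (2 * INR r - (INR j + 1) - 1)) with (2 * (INR j + 1) - 1)
    by (rewrite EN; ring).
  replace (4 * N * (yk j + 1 / 2)) with (4 * (2 * INR r - 1 - (INR j + 1)))
    by (unfold yk; rewrite EN in *; field; lra).
  replace (4 * N - 4 * (2 * INR r - 1 - (INR j + 1))) with (8 * INR r + 4 * (INR j + 1) - 8)
    by (rewrite EN; ring).
  replace (4 * N) with (16 * INR r - 12) by (rewrite EN; ring).
  rewrite <- EN.
  rewrite Cmult_1_l, !Rmult_1_l, RtoC_m1.
  replace (- (1) * qpow tau (2 * (INR j + 1) - 1))%C with (- qpow tau (2 * (INR j + 1) - 1))%C by ring.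
  replace (- (1) * qpow tau N)%C with (- qpow tau N)%C by ring.
  replace (N / 2 * Y ^ 2) with ((4 * (INR j + 1) - 4 * INR r + 1) ^ 2 / (32 * INR r - 24))
    by (unfold Y, yk; rewrite EN in *; field; lra).
  rewrite Cmult_plus_distr_l. f_equal; [|unfold Cdiv; ring].
  unfold Cdiv. rewrite Cinv_scal by apply qpow_neq_0.
  rewrite qpow_inv.
  (* The three exponents are the completing factor of the numerator, the inverse of the one in
     [den1], and the opposite of the extra power of [q] in the definition of [h]. *)
  replace ((4 * (INR j + 1) - 4 * INR r + 1) ^ 2 / (32 * INR r - 24)) with
    (2 * N * yk j ^ 2 + - (1 / 8) + - ((4 * (INR j + 1) - 2 * INR r - 1) / 4))
    by (unfold yk; rewrite EN in *; field; lra).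
  rewrite !qpow_plus.
  match goal with |- (_ * _ * qpow tau (- ?x) * (qpow tau ?x * (?X * ?D)))%C = _ =>
    transitivity (qpow tau (2 * N * yk j ^ 2) * qpow tau (- (1 / 8)) * X * D *
      (qpow tau (- x) * qpow tau x))%C; [ring|] end.
  rewrite qpow_inv_l. ring.
Qed.

Lemma hvee_theta (k : nat) (tau : C) : (k < n)%nat -> 0 < Im tau ->
  exists v1 v2 : C,
  cser (fun i => RtoC ((-1) ^ i) * (qpow tau (N / 4 * (INR i - yk k) ^ 2) -
    qpow tau (N / 4 * (INR i + 1 + yk k) ^ 2)))%C v1 /\
  cser (fun i => RtoC ((-1) ^ i * (-1) ^ tri i * ((-1) ^ k) ^ i) *
    (qpow tau (N / 4 * (INR i - yk k) ^ 2) -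
     RtoC ((-1) ^ k) * qpow tau (N / 4 * (INR i + 1 + yk k) ^ 2)))%C v2 /\
  hvee r (S k) tau = (RtoC (1 / 2) * (v1 / den1 (tau / 2) +
    RtoC ((-1) ^ tri k) * v2 / den3 (tau / 2)))%C.
Proof.
  intros Hk Ht. pose proof modulus_ge_1 as HN. pose proof modulus_eq as EN.
  assert (Ht2 : 0 < Im (tau / 2)%C).
  { unfold Cdiv. rewrite <- RtoC_inv by lra. rewrite im_scal_r. lra. }
  pose proof (theta_jtp_plus (tau / 2) N (yk k) Ht2 ltac:(lra)) as H1.
  assert (Hsq : (-1) ^ k * (-1) ^ k = 1)
    by (rewrite <- Rpow_mult_distr; replace (-1 * -1) with 1 by ring; apply pow1).
  pose proof (theta_jtp (tau / 2) (N * (yk k + 1 / 2)) N ((-1) ^ k) (-1) Ht2 ltac:(lra) Hsq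
    ltac:(ring)) as H2.
  cbv zeta in H1, H2.
  replace (N * (yk k + 1 / 2) / N - 1 / 2) with (yk k) in H2 by (field; lra).
  assert (Eq : forall x, N / 2 * x / 2 = N / 4 * x) by (intros x; field).
  eexists. eexists.
  split; [|split].
  - refine (cser_ext _ _ _ _ H1). intros i. now rewrite !qpow_half, !Eq.
  - refine (cser_ext _ _ _ _ H2). intros i. now rewrite !qpow_half, !Eq.
  - clear H1 H2. unfold hvee, hvee_double, den1, den3. cbv zeta.
    set (t := (tau / 2)%C).
    assert (Er : INR (S k) = INR k + 1) by apply S_INR.
    assert (Ey : N * (yk k + 1 / 2) = 2 * INR r - INR (S k) - 1)
      by (unfold yk; rewrite Er, EN in *; field; lra).
    rewrite Ey.
    replace (N - (2 * INR r - INR (S k) - 1)) with (2 * INR r + INR (S k) - 2)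
      by (rewrite EN; ring).
    rewrite <- EN.
    (* With [j = k + 1] the two exponents of [- q] have the parities of [k] and [k + 1], which
       yields the signs [e1 = (-1)^k] and [e1 * e2] with [e2 = -1]. *)
    assert (Em : forall m, ((- qpow t 1) ^ m = RtoC ((-1) ^ m) * qpow t (INR m))%C).
    { intros m. replace (- qpow t 1)%C with (RtoC (-1) * qpow t 1)%C
        by (rewrite RtoC_m1; ring).
      now rewrite Cpow_RtoC_mult, qpow_pow, Rmult_1_r. }
    rewrite !Em. unfold n in Hk.
    replace (INR (2 * r - S k - 1)) with (2 * INR r - INR (S k) - 1)
      by (rewrite !minus_INR, mult_INR by lia; simpl; ring).
    replace (INR (2 * r + S k - 2)) with (2 * INR r + INR (S k) - 2)
      by (rewrite minus_INR, plus_INR, mult_INR by lia; simpl; ring).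
    rewrite (pow_m1_eq (2 * r - S k - 1) k (k + 1) r) by lia.
    replace ((-1) ^ (2 * r + S k - 2)) with ((-1) ^ k * -1)
      by (rewrite (pow_m1_opp (2 * r + S k - 2) k 1 r) by lia; ring).
    replace (- qpow t N)%C with (RtoC (-1) * qpow t N)%C by (rewrite RtoC_m1; ring).
    assert (Es : hvee_sign (S k) = RtoC ((-1) ^ tri k)).
    { unfold hvee_sign. rewrite <- RtoC_pow. do 2 f_equal.
      pose proof (two_tri k). replace (S k * (S k - 1))%nat with (tri k * 2)%nat by nia.
      now rewrite Nat.div_mul. }
    rewrite Es.
    unfold Cdiv. rewrite !Cinv_scal by apply qpow_neq_0.
    replace ((INR (S k) ^ 2 - INR (S k) - INR r + 1) / (8 * INR r - 6)) with
      (N / 2 * yk k ^ 2 + - (1 / 8))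
      by (unfold yk; rewrite Er, EN in *; field; lra).
    rewrite qpow_plus.
    rewrite qpow_inv. ring.
Qed.
End Level.

(** * The cosine matrix *)

Lemma rsum_ext (f g : nat -> R) (n : nat) :
  (forall i, (i < n)%nat -> f i = g i) -> rsum f n = rsum g n.
Proof.
  induction n as [|n IH]; intros H; simpl; [easy|].
  rewrite IH, H; auto.
Qed.

Lemma csum_RtoC (f : nat -> R) (n : nat) : csum (fun i => RtoC (f i)) n = RtoC (rsum f n).
Proof.
  induction n as [|n IH]; [easy|]. simpl. now rewrite IH, <- RtoC_plus.
Qed.

Lemma cos_odd_multiples_sum (n : nat) (x : R) :
  2 * sin x * rsum (fun k => cos ((2 * INR k + 1) * x)) n = sin (2 * INR n * x).
Proof.
  induction n as [|n IH].
  - simpl. rewrite !Rmult_0_r, Rmult_0_l, sin_0. ring.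
  - simpl rsum. rewrite Rmult_plus_distr_l, IH, S_INR.
    replace (2 * INR n * x) with ((2 * INR n + 1) * x - x) by ring.
    replace (2 * (INR n + 1) * x) with ((2 * INR n + 1) * x + x) by ring.
    rewrite sin_plus, sin_minus. ring.
Qed.

(** For [x = m pi / (2n+1)] one has [2 n x = m pi - x], so the quotient of sines collapses to a
    sign; the range of [m] keeps [sin x] positive. *)
Lemma cos_odd_multiples_sum_PI (n m : nat) : (0 < m < 2 * n + 1)%nat ->
  2 * rsum (fun k => cos ((2 * INR k + 1) * (INR m * PI / (2 * INR n + 1)))) n = - (-1) ^ m.
Proof.
  intros Hm. pose proof PI_RGT_0. pose proof (pos_INR n).
  assert (Hm0 : 0 < INR m) by (apply lt_0_INR; lia).
  assert (Hm1 : INR m < 2 * INR n + 1).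
  { replace (2 * INR n + 1) with (INR (2 * n + 1))
      by (rewrite plus_INR, mult_INR; simpl; ring). apply lt_INR; lia. }
  set (x := INR m * PI / (2 * INR n + 1)).
  assert (Hx : 0 < sin x).
  { apply sin_gt_0; unfold x.
    - apply Rdiv_lt_0_compat; [now apply Rmult_lt_0_compat|lra].
    - apply Rmult_lt_reg_r with (2 * INR n + 1); [lra|].
      unfold Rdiv. rewrite Rmult_assoc, Rinv_l by lra. nra. }
  pose proof (cos_odd_multiples_sum n x) as E.
  replace (2 * INR n * x) with (- x + INR m * PI) in E by (unfold x; field; lra).
  assert (Es : forall q, sin (- x + INR q * PI) = (-1) ^ q * sin (- x)).
  { induction q as [|q IH]; [simpl; rewrite Rmult_0_l, Rplus_0_r; ring|].
    rewrite S_INR. replace (- x + (INR q + 1) * PI) with ((- x + INR q * PI) + PI) by ring.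
    rewrite neg_sin, IH. simpl. ring. }
  rewrite Es, sin_neg in E. apply Rmult_eq_reg_l with (sin x); lra.
Qed.

Lemma rsum_plus (f g : nat -> R) (n : nat) :
  rsum (fun i => f i + g i) n = rsum f n + rsum g n.
Proof. induction n as [|n IH]; simpl; [ring|rewrite IH; ring]. Qed.

Lemma rsum_scal (c : R) (f : nat -> R) (n : nat) :
  rsum (fun i => c * f i) n = c * rsum f n.
Proof. induction n as [|n IH]; simpl; [ring|rewrite IH; ring]. Qed.

Lemma cos_angle_product (n j l k : nat) : (l <= j)%nat ->
  2 * (cos (angle n j k) * cos (angle n l k)) =
  cos ((2 * INR k + 1) * (INR (j + l + 1) * PI / (2 * INR n + 1))) +
  cos ((2 * INR k + 1) * (INR (j - l) * PI / (2 * INR n + 1))).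
Proof.
  intros Hl. pose proof (pos_INR n).
  rewrite !plus_INR, minus_INR by exact Hl. change (INR 1) with 1.
  replace ((2 * INR k + 1) * ((INR j + INR l + 1) * PI / (2 * INR n + 1)))
    with (angle n j k + angle n l k) by (unfold angle; field; lra).
  replace ((2 * INR k + 1) * ((INR j - INR l) * PI / (2 * INR n + 1)))
    with (angle n j k - angle n l k) by (unfold angle; field; lra).
  rewrite cos_plus, cos_minus. ring.
Qed.

(** Off the diagonal [j + l + 1] and [j - l] have opposite parities and the two cosine sums cancel.
    On it the difference is 0, and its sum is [n] instead of a sign. *)
Lemma cos_angle_orthogonal (n j l : nat) : (j < n)%nat -> (l < n)%nat ->
  4 * rsum (fun k => cos (angle n j k) * cos (angle n l k)) n =
  if Nat.eq_dec j l then 2 * INR n + 1 else 0.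
Proof.
  assert (K : forall j l, (l <= j < n)%nat ->
    4 * rsum (fun k => cos (angle n j k) * cos (angle n l k)) n =
    if Nat.eq_dec j l then 2 * INR n + 1 else 0).
  { clear j l. intros j l H.
    replace (4 * rsum (fun k => cos (angle n j k) * cos (angle n l k)) n) with
      (2 * rsum (fun k => 2 * (cos (angle n j k) * cos (angle n l k))) n)
      by (rewrite rsum_scal; ring).
    rewrite (rsum_ext _ _ n (fun k _ => cos_angle_product n j l k (proj1 H))).
    rewrite rsum_plus, Rmult_plus_distr_l, cos_odd_multiples_sum_PI by lia.
    destruct (Nat.eq_dec j l) as [->|Hne].
    - rewrite Nat.sub_diag, (pow_m1_opp (l + l + 1) 0 0 l) by lia.
      assert (E : rsum (fun k => cos ((2 * INR k + 1) * (INR 0 * PI / (2 * INR n + 1)))) n = INR n).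
      { clear. induction n as [|n IH]; [easy|].
        rewrite S_INR. simpl rsum.
        replace (rsum _ n) with (INR n).
        - simpl INR at 3. unfold Rdiv. rewrite !Rmult_0_l, Rmult_0_r, cos_0. reflexivity.
        - rewrite <- IH at 1. apply rsum_ext. intros i _. simpl (INR 0).
          unfold Rdiv. now rewrite !Rmult_0_l. }
      rewrite E. simpl. ring.
    - rewrite cos_odd_multiples_sum_PI by lia.
      rewrite (pow_m1_opp (j + l + 1) (j - l) 0 l) by lia. ring. }
  intros Hj Hl. destruct (Nat.le_ge_cases l j) as [H|H].
  - now apply K.
  - rewrite (rsum_ext _ (fun k => cos (angle n l k) * cos (angle n j k)))
      by (intros; apply Rmult_comm).
    rewrite K by lia. destruct (Nat.eq_dec l j), (Nat.eq_dec j l); congruence.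
Qed.

(** * Assembly of the two transformation formulas *)

Lemma smx_angle (r j k : nat) : (2 <= r)%nat ->
  smx r (S j) (S k) = sqrt (2 / (4 * INR r - 3)) * cos (angle (2 * r - 2) j k).
Proof.
  intros hr. unfold smx, angle. do 2 f_equal.
  assert (2 <= INR r) by (apply (le_INR 2); exact hr).
  rewrite !S_INR, minus_INR, mult_INR by lia. simpl INR. field. lra.
Qed.

(** Turns the witnesses of [hvee_theta] into functions of the residue; induction on the finite range
    replaces an axiom of choice. *)
Lemma finite_choice (P : nat -> C -> C -> Prop) (n : nat) :
  (forall k, (k < n)%nat -> exists a b, P k a b) ->
  exists f g : nat -> C, forall k, (k < n)%nat -> P k (f k) (g k).
Proof.
  induction n as [|n IH]; intros H.
  - exists (fun _ => RtoC 0), (fun _ => RtoC 0). intros k Hk. lia.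
  - destruct IH as [f [g IH]]; [intros k Hk; apply H; lia|].
    destruct (H n (le_n _)) as [a [b Hab]].
    exists (fun k => if Nat.eq_dec k n then a else f k),
      (fun k => if Nat.eq_dec k n then b else g k).
    intros k Hk. destruct (Nat.eq_dec k n) as [->|]; [exact Hab|]. apply IH. lia.
Qed.

Lemma h_transform (r : nat) (hr : (2 <= r)%nat) (tau : C) (j : nat) :
  0 < Im tau ->
  h r (S j) (- (1) / (2 * tau))%C =
  (2 * csum (fun k => RtoC (smx r (S j) (S k)) * hvee r (S k) tau) (2 * r - 2))%C.
Proof.
  intros Ht. set (tau' := (- (1) / (2 * tau))%C). set (n := (2 * r - 2)%nat).
  assert (Ht' : 0 < Im tau') by now apply Im_neg_inv_double.
  assert (Ht2 : 0 < Im (tau / 2)%C).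
  { unfold Cdiv. rewrite <- RtoC_inv by lra. rewrite im_scal_r. lra. }
  destruct (theta_transform tau Ht) as [c [Hc0 Htr]]. fold (transforms tau c) in Htr.
  pose proof (modulus_ge_1 r) as HN. pose proof (modulus_eq r hr) as EN. fold n in HN, EN.
  set (N := 2 * INR n + 1) in *.
  destruct (h_theta r hr j tau' Ht') as [z [za [zb [Hz [Hza [Hzb Eh]]]]]].
  fold n in Hz, Hza, Hzb. fold N in Hz, Hza, Hzb.
  assert (Q : forall x, qpow (tau / 2) (2 * x) = qpow tau x).
  { intros x. rewrite qpow_half. f_equal. field. }
  (* The denominators of [hvee] live at [tau / 2], where the scale 2 of their theta series becomes
     the scale 1 of the transformed side. *)
  assert (E1 : (RtoC (sqrt 2) * (c * den1 tau') = den1 (tau / 2))%C).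
  { apply (first_denominator tau c); [exact Htr|now apply den1_series|].
    refine (cser_ext _ _ _ _ (den1_series _ Ht2)). intros i. now rewrite !Q. }
  assert (E2 : (c * den2 tau' = den3 (tau / 2))%C).
  { apply (second_denominator tau c); [exact Htr|now apply den2_series|].
    refine (cser_ext _ _ _ _ (den3_series _ Ht2)). intros i. now rewrite !Q. }
  destruct (finite_choice _ n (fun k Hk => hvee_theta r hr k tau Hk Ht)) as [v1 [v2 Hv]].
  cbv beta in Hv.
  assert (Hn : n = (2 * (r - 1))%nat) by (unfold n; lia).
  pose proof (first_numerator n j tau c Htr z v1 Hz (fun k Hk => proj1 (Hv k Hk))) as F1.
  pose proof (second_numerator n j tau c Htr (r - 1) Hn za zb v2 Hza Hzb
    (fun k Hk => proj1 (proj2 (Hv k Hk)))) as F2.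
  fold N in F1, F2.
  assert (HsN : sqrt N <> 0) by (apply Rgt_not_eq, sqrt_lt_R0; lra).
  assert (Hsq : RtoC (sqrt N) <> 0) by now apply RtoC_neq_0.
  assert (Hs2 : RtoC (sqrt 2) <> 0) by (apply RtoC_neq_0, Rgt_not_eq, Rlt_sqrt2_0).
  assert (Z1 : (z = / (RtoC (sqrt N) * c) * csum (fun k => RtoC (cos (angle n j k)) * v1 k) n)%C).
  { rewrite <- F1. field. now split. }
  assert (Z2 : (za + zb = / (RtoC (sqrt N) * c) * (RtoC (sqrt 2) *
    csum (fun k => RtoC (cos (angle n j k)) * (RtoC ((-1) ^ tri k) * v2 k)) n))%C).
  { rewrite <- F2. field. now split. }
  rewrite Eh, Z1, Z2.
  rewrite (csum_ext (fun k => RtoC (smx r (S j) (S k)) * hvee r (S k) tau)%C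
    (fun k => RtoC (sqrt 2) * / RtoC (sqrt N) * RtoC (1 / 2) * (/ den1 (tau / 2) *
      (RtoC (cos (angle n j k)) * v1 k) + / den3 (tau / 2) *
      (RtoC (cos (angle n j k)) * (RtoC ((-1) ^ tri k) * v2 k))))%C).
  - rewrite csum_scal, csum_plus, !csum_scal.
    rewrite <- E1, <- E2. unfold Cdiv.
    replace (RtoC (sqrt 2) * (c * den1 tau'))%C with ((RtoC (sqrt 2) * c) * den1 tau')%C by ring.
    rewrite (Cinv_scal c), (Cinv_scal (RtoC (sqrt 2) * c)%C)
      by (auto using Cmult_neq_0).
    (* With the inverse denominators abstracted, [field] has to invert only [c] and the two square
       roots. *)
    rewrite RtoC_div by lra. generalize (/ den1 tau')%C, (/ den2 tau')%C. intros x y.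
    field. now repeat split.
  - intros k Hk. destruct (Hv k Hk) as [_ [_ ->]]. rewrite smx_angle by exact hr.
    fold n. rewrite <- EN, sqrt_div, RtoC_mult, RtoC_div by (assumption || lra).
    unfold Cdiv. ring.
Qed.

Lemma smx_sq (r : nat) (hr : (2 <= r)%nat) (f : nat -> C) (j : nat) : (j < 2 * r - 2)%nat ->
  (csum (fun k => RtoC (smx r (S j) (S k)) *
     (2 * csum (fun l => RtoC (smx r (S k) (S l)) * f l) (2 * r - 2))) (2 * r - 2) = f j)%C.
Proof.
  intros Hj. pose proof (modulus_eq r hr) as EN. pose proof (modulus_ge_1 r) as HN.
  set (n := (2 * r - 2)%nat) in *. set (N := 2 * INR n + 1) in *.
  rewrite (csum_ext _ (fun k => csum (fun l => RtoC (2 * (smx r (S j) (S k) *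
    smx r (S k) (S l))) * f l) n)%C).
  - rewrite csum_exchange.
    rewrite (csum_ext _ (fun l => if Nat.eq_dec j l then f l else 0)%C).
    + clear - Hj. induction n as [|n IH]; [lia|]. simpl.
      destruct (Nat.eq_dec j n) as [->|Hne].
      * replace (csum _ n) with (RtoC 0); [ring|].
        clear. assert (K : forall m, (m <= n)%nat ->
          csum (fun l => if Nat.eq_dec n l then f l else 0) m = RtoC 0).
        { induction m as [|m IH]; intros Hm; [easy|]. simpl. rewrite IH by lia.
          destruct (Nat.eq_dec n m); [lia|ring]. }
        symmetry. now apply K.
      * rewrite IH by lia. ring.
    + intros l Hl.
      (* The factor [4 / N] is 2 times the square of [sqrt (2 / N)]; it meets the value [N / 4] of
         the diagonal sum. *)
      rewrite (csum_ext _ (fun k => f l * RtoC (4 / N * (cos (angle n j k) *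
        cos (angle n l k))))%C).
      * rewrite csum_scal, csum_RtoC, rsum_scal.
        pose proof (cos_angle_orthogonal n j l Hj Hl) as O.
        replace (4 / N * rsum (fun k => cos (angle n j k) * cos (angle n l k)) n) with
          (/ N * (4 * rsum (fun k => cos (angle n j k) * cos (angle n l k)) n))
          by (field; lra).
        rewrite O. fold N. destruct (Nat.eq_dec j l).
        -- rewrite Rinv_l by lra. ring.
        -- rewrite Rmult_0_r. ring.
      * intros k Hk. rewrite Cmult_comm. do 2 f_equal.
        rewrite !smx_angle by exact hr. fold n. rewrite <- EN.
        assert (Ea : angle n k l = angle n l k) by (unfold angle; f_equal; ring).
        rewrite Ea.
        transitivity (2 * (sqrt (2 / N) * sqrt (2 / N)) * (cos (angle n j k) *
          cos (angle n l k))); [ring|].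
        rewrite sqrt_sqrt; [field; lra|].
        apply Rlt_le, Rdiv_lt_0_compat; lra.
  - intros k Hk. rewrite <- !csum_scal. apply csum_ext. intros l Hl.
    rewrite !RtoC_mult. ring.
Qed.

(** [Mmult] sums inclusively up to the predecessor of the dimension, which agrees with [csum] when
    the dimension is positive. *)
Lemma sum_n_csum (f : nat -> C) (n : nat) :
  (0 < n)%nat -> sum_n (G := C_Ring) f (Init.Nat.pred n) = csum f n.
Proof.
  intros Hn. destruct n as [|n]; [lia|]. simpl Init.Nat.pred. clear Hn.
  induction n as [|n IH].
  - rewrite sum_O. simpl. ring.
  - rewrite sum_Sn, IH. reflexivity.
Qed.

Lemma Mmult_Stilde_colvec (r : nat) (f : nat -> C) : (2 <= r)%nat ->
  Mmult (Stilde r) (colvec (2 * r - 2) f) =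
  colvec (2 * r - 2) (fun j => csum (fun k => RtoC (smx r j (S k)) * f (S k))%C (2 * r - 2)).
Proof.
  intros hr. unfold Mmult, colvec. apply mk_matrix_ext. intros i j Hi Hj.
  rewrite sum_n_csum by lia. apply csum_ext. intros k Hk.
  unfold Stilde. rewrite !coeff_mat_bij by assumption. reflexivity.
Qed.

Theorem theorem5p7 (r : nat) (hr : (2 <= r)%nat) (tau : C)
  (htau : 0 < Im tau) :
  hvec r (- (1) / (2 * tau))%C =
    Mscale (RtoC 2) (Mmult (Stilde r) (hveevec r tau)) /\
  hveevec r (- (1) / (2 * tau))%C = Mmult (Stilde r) (hvec r tau).
Proof.
  unfold hvec, hveevec. rewrite !Mmult_Stilde_colvec by exact hr. split.
  - unfold Mscale, colvec. apply mk_matrix_ext. intros i j Hi Hj.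
    rewrite coeff_mat_bij by assumption. now apply h_transform.
  - unfold colvec. apply mk_matrix_ext. intros i j Hi Hj.
    pose proof (Im_neg_inv_double tau htau) as Ht'.
    (* Each [h r (S k) tau] is expanded by [h_transform] at [- (1) / (2 * tau)], whose image is
       [tau] again; [smx_sq] then contracts the double sum. *)
    rewrite (csum_ext _ (fun k => RtoC (smx r (S i) (S k)) * (2 *
      csum (fun l => RtoC (smx r (S k) (S l)) *
        hvee r (S l) (- (1) / (2 * tau))) (2 * r - 2)))%C).
    + symmetry. now apply (smx_sq r hr (fun l => hvee r (S l) (- (1) / (2 * tau))%C)).
    + intros k Hk. f_equal. rewrite <- h_transform by assumption.
      now rewrite neg_inv_double_involutive.
Qed.
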